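(* Consider the equation $y''=P(x,y)+3Q(x,y)y'+3R(x,y)y'^2+S(x,y)y'^3$ near a point $p$ of the $(x,y)$-plane, with $A,B,F,N,\Omega,L$ and $I_1$ computed from its coefficients as in the context. Suppose the equation belongs to the seventh case of intermediate degeneration, i.e. $A$ and $B$ do not vanish simultaneously, and $F=0$, $N=0$, $\Omega=0$ identically. Then the Lie algebra of point symmetries of the equation is one-dimensional if and only if $L$ is nonzero and the function $$I_1=\frac{(\nabla_\theta L)^4}{L^5}$$ is identically constant.
   Context: Setting. $P,Q,R,S$ are smooth real functions of $(x,y)$ near a point $p$. Everything is local (germs at $p$): ''$=0$'' and ''constant'' mean identically in a neighbourhood of $p$, ''nonzero'' or ''$\ne0$'' means non-vanishing at $p$ (hence near $p$). Subscripts $x,y$ denote partial derivatives; $x^1=x$, $x^2=y$, $\partial_1=\partial_x$, $\partial_2=\partial_y$. The algebra of point symmetries is the Lie algebra of (germs of) vector fields on the $(x,y)$-plane whose local flows map graphs of solutions to graphs of solutions. Basic quantities. $A=P_{yy}-2Q_{xy}+R_{xx}+2PS_x+SP_x-3PR_y-3RP_y-3QR_x+6QQ_y$, $B=S_{xx}-2R_{xy}+Q_{yy}-2SP_y-PS_y+3SQ_x+3QS_x+3RQ_y-6RR_x$. $F$ is defined by $F^5=ABA_y+ABB_x-A^2B_y-B^2A_x-PB^3+3QAB^2-3RA^2B+SA^3$. $G=-BB_x-3AB_y+4BA_y+3SA^2-6RAB+3QB^2$, $\;H=-AA_y-3BA_x+4AB_x-3PB^2+6QAB-3RA^2$. Assume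 $(A,B)\neq(0,0)$ and $F=0$. Where two expressions are given below, one for $B\ne0$ and one for $A\neq0$, they agree when both apply. $N=\frac{G}{3B}$ (if $B\ne0$), $N=-\frac{H}{3A}$ (if $A\ne0$). If $B\ne0$: $\varphi_1=-3A\frac{AS-B_y}{5B^2}-3\frac{A_y+B_x-3AR}{5B}-\frac65Q$, $\varphi_2=3\frac{AS-B_y}{5B}-\frac35R$. If $A\ne0$: $\varphi_1=-3\frac{BP+A_x}{5A}+\frac35Q$, $\varphi_2=3B\frac{BP+A_x}{5A^2}-3\frac{B_x+A_y+3BQ}{5A}+\frac65R$. $\Omega=\frac53(\partial_y\varphi_1-\partial_x\varphi_2)$. Curvature (when $N=0$, $\Omega=0$). Let $\varGamma^k_{ij}=\varGamma^k_{ji}$ be: $\varGamma^1_{11}=Q-\frac23\varphi_1$, $\varGamma^1_{12}=R-\frac13\varphi_2$, $\varGamma^1_{22}=S$, $\varGamma^2_{11}=-P$, $\varGamma^2_{12}=-Q-\frac13\varphi_1$, $\varGamma^2_{22}=-R-\frac23\varphi_2$. Put $\rho^k_q=\partial_1\varGamma^k_{2q}-\partial_2\varGamma^k_{1q}+\sum_{s=1}^2(\varGamma^k_{1s}\varGamma^s_{2q}-\varGamma^k_{2s}\varGamma^s_{1q})$. Define $\omega_1=\frac{\rho^1_1}{B}$, $\omega_2=\frac{\rho^1_2}{B}$ (if $B\ne0$); $\omega_1=-\frac{\rho^2_1}{A}$, $\omega_2=-\frac{\rho^2_2}{A}$ (if $A\neq0$). $\Theta=\omega_2/B$ (if $B\ne0$),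 $\Theta=\omega_1/A$ (if $A\neq0$). $\theta_1=\Theta_x-2\varphi_1\Theta$, $\theta_2=\Theta_y-2\varphi_2\Theta$; $C=\theta^1=\theta_2$, $D=\theta^2=-\theta_1$. $Z=CD(D_y-C_x)+C^2D_x-D^2C_y-PC^3-3QC^2D-3RCD^2-SD^3$. $L=Z-\frac12\Theta^2$, $\;\nabla_\theta L=\theta^1(L_x-4\varphi_1L)+\theta^2(L_y-4\varphi_2L)$. *)

(* Defs.v *)
From Stdlib Require Import Reals Lra.
From Coquelicot Require Import Coquelicot.
Open Scope R_scope.

(** * Germs at a point of the plane *)

(* A germ at [p] is represented by a total function, of which only the
   restriction to some neighbourhood of [p] is ever used. *)
Definition near (p : R * R) (Pr : R -> R -> Prop) : Prop :=
  locally_2d Pr (fst p) (snd p).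

(* C^infinity on one neighbourhood of [p], uniform in the order [n]:
   [ex_diff_n f n] says that the iterated partial derivatives of [f] of order
   at most [n] exist and are (jointly) continuous. *)
Definition smooth_near (p : R * R) (f : R -> R -> R) : Prop :=
  near p (fun x y => forall n : nat, ex_diff_n f n x y).

Definition dx (f : R -> R -> R) : R -> R -> R :=
  fun x y => Derive (fun z => f z y) x.
Definition dy (f : R -> R -> R) : R -> R -> R :=
  fun x y => Derive (fun z => f x z) y.

(** * The equation y'' = P + 3 Q y' + 3 R y'^2 + S y'^3 *)

Record equation := Equation {
  coefP : R -> R -> R;
  coefQ : R -> R -> R;
  coefR : R -> R -> R;
  coefS : R -> R -> R }.

Definition smooth_equation (E : equation) (p : R * R) : Prop :=
  smooth_near p (coefP E) /\ smooth_near p (coefQ E) /\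
  smooth_near p (coefR E) /\ smooth_near p (coefS E).

(* [f], restricted to the open interval (a, b), is a solution. *)
Definition is_solution (E : equation) (a b : R) (f : R -> R) : Prop :=
  forall x, a < x < b ->
    ex_derive f x /\
    is_derive (Derive f) x
      (coefP E x (f x) + 3 * coefQ E x (f x) * Derive f x
       + 3 * coefR E x (f x) * Derive f x ^ 2
       + coefS E x (f x) * Derive f x ^ 3).

(** * Point symmetries *)

Definition in_box (p : R * R) (eps : R) (x y : R) : Prop :=
  Rabs (x - fst p) < eps /\ Rabs (y - snd p) < eps.

(* (u t, v t) is the time-[t] map, for |t| < eps and starting points in the
   box of size [eps] around [p], of the flow of xi d/dx + eta d/dy. *)
Definition local_flow (p : R * R) (xi eta : R -> R -> R) (eps : R)
    (u v : R -> R -> R -> R) : Prop :=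
  forall x y, in_box p eps x y ->
    u 0 x y = x /\ v 0 x y = y /\
    forall t, Rabs t < eps ->
      is_derive (fun s => u s x y) t (xi (u t x y) (v t x y)) /\
      is_derive (fun s => v s x y) t (eta (u t x y) (v t x y)).

(* Around each of its points, the graph of a solution is mapped, for small
   times, onto the graph of a solution.  The restriction to small pieces and
   small times cannot be avoided: even for a symmetry, the image of a long or
   steep graph need not be the graph of a function of x. *)
Definition flow_maps_solutions (E : equation) (p : R * R) (eps : R)
    (u v : R -> R -> R -> R) : Prop :=
  forall (a b : R) (f : R -> R),
    is_solution E a b f ->
    (forall x, a < x < b -> in_box p eps x (f x)) ->
    forall x1, a < x1 < b ->
    exists delta, 0 < delta <= eps /\ a <= x1 - delta /\ x1 + delta <= b /\
      forall t, Rabs t < delta ->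
      exists (c d : R) (g : R -> R),
        c < d /\ is_solution E c d g /\
        forall x y,
          (c < x < d /\ y = g x) <->
          (exists z, Rabs (z - x1) < delta /\
                     x = u t z (f z) /\ y = v t z (f z)).

(* Membership of the germ at [p] of xi d/dx + eta d/dy in the algebra of
   point symmetries.  Integral curves being unique, the choice of the local
   flow is immaterial. *)
Definition point_symmetry (E : equation) (p : R * R)
    (xi eta : R -> R -> R) : Prop :=
  smooth_near p xi /\ smooth_near p eta /\
  exists (eps : R) (u v : R -> R -> R -> R),
    0 < eps /\ local_flow p xi eta eps u v /\
    flow_maps_solutions E p eps u v.

(* The space of germs of point symmetries is the line spanned by one nonzero
   germ. *)
Definition symmetry_algebra_one_dimensional (E : equation) (p : R * R) : Prop :=
  exists xi eta : R -> R -> R,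
    ~ near p (fun x y => xi x y = 0 /\ eta x y = 0) /\
    forall xi' eta' : R -> R -> R,
      point_symmetry E p xi' eta' <->
      exists c : R,
        near p (fun x y => xi' x y = c * xi x y /\ eta' x y = c * eta x y).

(** * Quantities computed from the coefficients *)

Definition qA (E : equation) : R -> R -> R :=
  let P := coefP E in let Q := coefQ E in
  let R := coefR E in let S := coefS E in
  fun x y =>
    dy (dy P) x y - 2 * dy (dx Q) x y + dx (dx R) x y
    + 2 * P x y * dx S x y + S x y * dx P x y
    - 3 * P x y * dy R x y - 3 * R x y * dy P x y
    - 3 * Q x y * dx R x y + 6 * Q x y * dy Q x y.

Definition qB (E : equation) : R -> R -> R :=
  let P := coefP E in let Q := coefQ E in
  let R := coefR E in let S := coefS E in
  fun x y =>
    dx (dx S) x y - 2 * dy (dx R) x y + dy (dy Q) x y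
    - 2 * S x y * dy P x y - P x y * dy S x y
    + 3 * S x y * dx Q x y + 3 * Q x y * dx S x y
    + 3 * R x y * dy Q x y - 6 * R x y * dx R x y.

Definition fifth_root (r : R) : R :=
  if Req_dec_T r 0 then 0 else sign r * Rpower (Rabs r) (/ 5).

Lemma fifth_root_spec (r : R) : fifth_root r ^ 5 = r.
Proof.
unfold fifth_root; destruct (Req_dec_T r 0) as [->|Hr]; [ring|].
rewrite Rpow_mult_distr.
assert (Hp : Rpower (Rabs r) (/ 5) ^ 5 = Rabs r).
{ rewrite <- Rpower_pow by apply exp_pos.
  rewrite Rpower_mult.
  replace (/ 5 * INR 5) with 1 by (simpl; field).
  apply Rpower_1, Rabs_pos_lt, Hr. }
rewrite Hp; destruct (Rdichotomy _ _ Hr) as [H|H].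
- rewrite (sign_eq_m1 _ H), (Rabs_left _ H); ring.
- rewrite (sign_eq_1 _ H), (Rabs_right _ (Rle_ge _ _ (Rlt_le _ _ H))); ring.
Qed.

Definition qF (E : equation) : R -> R -> R :=
  let P := coefP E in let Q := coefQ E in
  let R := coefR E in let S := coefS E in
  let A := qA E in let B := qB E in
  fun x y =>
    fifth_root
      (A x y * B x y * dy A x y + B x y * A x y * dx B x y
       - A x y ^ 2 * dy B x y - B x y ^ 2 * dx A x y
       - P x y * B x y ^ 3 + 3 * Q x y * A x y * B x y ^ 2
       - 3 * R x y * A x y ^ 2 * B x y + S x y * A x y ^ 3).

Definition qG (E : equation) : R -> R -> R :=
  let Q := coefQ E in let R := coefR E in let S := coefS E in
  let A := qA E in let B := qB E in
  fun x y =>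
    - B x y * dx B x y - 3 * A x y * dy B x y + 4 * B x y * dy A x y
    + 3 * S x y * A x y ^ 2 - 6 * R x y * A x y * B x y
    + 3 * Q x y * B x y ^ 2.

Definition qH (E : equation) : R -> R -> R :=
  let P := coefP E in let Q := coefQ E in let R := coefR E in
  let A := qA E in let B := qB E in
  fun x y =>
    - A x y * dy A x y - 3 * B x y * dx A x y + 4 * A x y * dx B x y
    - 3 * P x y * B x y ^ 2 + 6 * Q x y * A x y * B x y
    - 3 * R x y * A x y ^ 2.

(* Selection between the expression [fB] for "B <> 0" and the expression [fA]
   for "A <> 0".  As all is about germs at [p], "B <> 0" means B(p) <> 0, so
   one and the same expression is used on a whole neighbourhood of [p].  When
   A and B are both nonzero at [p] the two expressions agree in the case
   under study, and the preference for [fB] is immaterial. *)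
Definition select (E : equation) (p : R * R) (fB fA : R -> R -> R) :
    R -> R -> R :=
  if Req_dec_T (qB E (fst p) (snd p)) 0 then fA else fB.

Definition qN (E : equation) (p : R * R) : R -> R -> R :=
  select E p
    (fun x y => qG E x y / (3 * qB E x y))
    (fun x y => - (qH E x y / (3 * qA E x y))).

Definition phi1 (E : equation) (p : R * R) : R -> R -> R :=
  let P := coefP E in let Q := coefQ E in
  let R := coefR E in let S := coefS E in
  let A := qA E in let B := qB E in
  select E p
    (fun x y =>
       - 3 * A x y * ((A x y * S x y - dy B x y) / (5 * B x y ^ 2))
       - 3 * ((dy A x y + dx B x y - 3 * A x y * R x y) / (5 * B x y))
       - 6 / 5 * Q x y)
    (fun x y =>
       - 3 * ((B x y * P x y + dx A x y) / (5 * A x y)) + 3 / 5 * Q x y).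

Definition phi2 (E : equation) (p : R * R) : R -> R -> R :=
  let P := coefP E in let Q := coefQ E in
  let R := coefR E in let S := coefS E in
  let A := qA E in let B := qB E in
  select E p
    (fun x y =>
       3 * ((A x y * S x y - dy B x y) / (5 * B x y)) - 3 / 5 * R x y)
    (fun x y =>
       3 * B x y * ((B x y * P x y + dx A x y) / (5 * A x y ^ 2))
       - 3 * ((dx B x y + dy A x y + 3 * B x y * Q x y) / (5 * A x y))
       + 6 / 5 * R x y).

Definition qOmega (E : equation) (p : R * R) : R -> R -> R :=
  fun x y => 5 / 3 * (dy (phi1 E p) x y - dx (phi2 E p) x y).

Inductive index := i1 | i2.

Definition sum_index (f : index -> R) : R := f i1 + f i2.

Definition d (i : index) (f : R -> R -> R) : R -> R -> R :=
  match i with i1 => dx f | i2 => dy f end.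

(* [Gam E p k i j] has upper index [k] and lower indices [i], [j]. *)
Definition Gam (E : equation) (p : R * R) (k i j : index) : R -> R -> R :=
  fun x y =>
  match k, i, j with
  | i1, i1, i1 => coefQ E x y - 2 / 3 * phi1 E p x y
  | i1, i1, i2 | i1, i2, i1 => coefR E x y - 1 / 3 * phi2 E p x y
  | i1, i2, i2 => coefS E x y
  | i2, i1, i1 => - coefP E x y
  | i2, i1, i2 | i2, i2, i1 => - coefQ E x y - 1 / 3 * phi1 E p x y
  | i2, i2, i2 => - coefR E x y - 2 / 3 * phi2 E p x y
  end.

(* Upper index [k], lower index [q]. *)
Definition rho (E : equation) (p : R * R) (k q : index) : R -> R -> R :=
  let G := Gam E p in
  fun x y =>
    d i1 (G k i2 q) x y - d i2 (G k i1 q) x y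
    + sum_index (fun s =>
        G k i1 s x y * G s i2 q x y - G k i2 s x y * G s i1 q x y).

Definition omega1 (E : equation) (p : R * R) : R -> R -> R :=
  select E p
    (fun x y => rho E p i1 i1 x y / qB E x y)
    (fun x y => - (rho E p i2 i1 x y / qA E x y)).

Definition omega2 (E : equation) (p : R * R) : R -> R -> R :=
  select E p
    (fun x y => rho E p i1 i2 x y / qB E x y)
    (fun x y => - (rho E p i2 i2 x y / qA E x y)).

Definition qTheta (E : equation) (p : R * R) : R -> R -> R :=
  select E p
    (fun x y => omega2 E p x y / qB E x y)
    (fun x y => omega1 E p x y / qA E x y).

Definition theta_lower (E : equation) (p : R * R) (i : index) : R -> R -> R :=
  let phi := match i with i1 => phi1 E p | i2 => phi2 E p end in
  fun x y => d i (qTheta E p) x y - 2 * phi x y * qTheta E p x y.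

Definition theta_upper (E : equation) (p : R * R) (i : index) : R -> R -> R :=
  fun x y =>
  match i with
  | i1 => theta_lower E p i2 x y
  | i2 => - theta_lower E p i1 x y
  end.

Definition qZ (E : equation) (p : R * R) : R -> R -> R :=
  let P := coefP E in let Q := coefQ E in
  let R := coefR E in let S := coefS E in
  let C := theta_upper E p i1 in let D := theta_upper E p i2 in
  fun x y =>
    C x y * D x y * (dy D x y - dx C x y)
    + C x y ^ 2 * dx D x y - D x y ^ 2 * dy C x y
    - P x y * C x y ^ 3 - 3 * Q x y * C x y ^ 2 * D x y
    - 3 * R x y * C x y * D x y ^ 2 - S x y * D x y ^ 3.

Definition qL (E : equation) (p : R * R) : R -> R -> R :=
  fun x y => qZ E p x y - 1 / 2 * qTheta E p x y ^ 2.

Definition nabla_theta_L (E : equation) (p : R * R) : R -> R -> R :=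
  let L := qL E p in
  fun x y =>
    theta_upper E p i1 x y * (dx L x y - 4 * phi1 E p x y * L x y)
    + theta_upper E p i2 x y * (dy L x y - 4 * phi2 E p x y * L x y).

Definition qI1 (E : equation) (p : R * R) : R -> R -> R :=
  fun x y => nabla_theta_L E p x y ^ 4 / qL E p x y ^ 5.

(** * The seventh case of intermediate degeneration *)

Definition seventh_case (E : equation) (p : R * R) : Prop :=
  (qA E (fst p) (snd p), qB E (fst p) (snd p)) <> (0, 0) /\
  near p (fun x y => qF E x y = 0) /\
  near p (fun x y => qN E p x y = 0) /\
  near p (fun x y => qOmega E p x y = 0).

(* Main.v *)
(* Normal coordinates.  Since [Omega = 0], [phi] is the gradient of a function
   [f].  The covector [exp f (A, B)] is closed, say equal to [dY], and with
   [X = Theta exp (- 2 f)] the curvature identities make [(X, Y)] a coordinate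
   system in which the equation reads [X'' = - (X^2 / 2 + l (Y))], where
   [L = exp (4 f) l] and [nabla_theta L = - exp (5 f) l'].  Hence [I1 = l'^4 / l^5].

   Symmetries.  Moving a solution [h] by the flow of [a d_X + b d_Y] changes it
   to first order by [w = a - h' b], which must satisfy [w'' = - h w].  As the
   value and the slope of [h] at a point are arbitrary, this gives polynomial
   determining equations, whose solutions are [b = al Y + be], [a = - 2 al X]
   with constants such that [(al Y + be) l' + 4 al l = 0]; conversely the flow of
   such a field is explicit and permutes the solutions.  This condition says that
   [(al Y + be)^4 l] is constant.  If [l = 0] all pairs [(al, be)] are admissible;
   otherwise the admissible pairs form a line when [l] is constant or a multiple
   of a power [(Y + be0)^(-4)], that is when [l'^4 / l^5] is constant, and
   vanish if not. *)

(* The obstacle is the definition of a symmetry: an image graph is given only as a set, and a local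
   flow comes with no regularity in its starting point. Instead of prolonging the field to jets,
   difference quotients in the time of the flow are estimated by the mean value theorem. For small
   times the estimates show that an image is again a graph over [Y], and they produce [w] as a
   limit. Varying value and slope freely requires solutions through every point; in normal
   coordinates these come from a fixed point.

   The inverse of [(X, Y)] is never shown to be smooth. It is Lipschitz, which suffices to
   differentiate it along curves; the determining equations are solved with the derivations [DX] and
   [DY] in the original plane.

   The exponents are weights. If a flow multiplies [Y] by [w], then [X''] gains [w^(-2)] besides the
   factor of [X]; balance with [X^2] forces the factor [w^(-2)] for [X], and then [w^(-4)] for [l].
   The term [X^2 / 2] is the difference between [Z] and [L], chosen so that [L] does not vary along
   [Y = const] once it is rescaled. *)
Require Import Defs.
From Stdlib Require Import Reals Ranalysis5 Lra Lia Classical ClassicalEpsilon.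
From Coquelicot Require Import Coquelicot.
Open Scope R_scope.

(** * Smooth functions on boxes *)

(* [lra] with [Rmin a b <= a, b] and [- Rabs a <= a <= Rabs a] for all such
   terms in sight, and with positivity of minima, products and quotients. *)
Ltac abs_lra :=
  repeat match goal with |- _ /\ _ => split | |- 0 < Rmin _ _ => apply Rmin_glb_lt end;
  match goal with
  | |- Rabs _ < _ => apply Rabs_def1
  | |- Rabs _ <= _ => apply Rabs_le; split
  | _ => idtac
  end;
  repeat match goal with
  | |- context [Rmin ?a ?b] => lazymatch goal with
      | _ : Rmin a b <= a |- _ => fail
      | _ => pose proof (Rmin_l a b); pose proof (Rmin_r a b) end
  | _ : context [Rmin ?a ?b] |- _ => lazymatch goal with
      | _ : Rmin a b <= a |- _ => fail
      | _ => pose proof (Rmin_l a b); pose proof (Rmin_r a b) end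
  | |- context [Rabs ?a] => lazymatch goal with
      | _ : a <= Rabs a |- _ => fail
      | _ => pose proof (Rle_abs a); pose proof (Rabs_maj2 a) end
  | _ : context [Rabs ?a] |- _ => lazymatch goal with
      | _ : a <= Rabs a |- _ => fail
      | _ => pose proof (Rle_abs a); pose proof (Rabs_maj2 a) end
  end;
  first [lra |
    repeat first [apply Rmult_lt_0_compat | apply Rdiv_lt_0_compat | apply Rinv_0_lt_compat]; lra].

Lemma in_box_le p r r' x y : r <= r' -> in_box p r x y -> in_box p r' x y.
Proof. intros H [H1 H2]; split; lra. Qed.

Lemma in_box_center p r : 0 < r -> in_box p r (fst p) (snd p).
Proof. intros H; split; unfold Rminus; rewrite Rplus_opp_r, Rabs_R0; exact H. Qed.

Lemma in_box_open p r x y :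
  in_box p r x y ->
  exists e, 0 < e /\ forall u v, Rabs (u - x) < e -> Rabs (v - y) < e -> in_box p r u v.
Proof.
intros [H1 H2].
exists (Rmin (r - Rabs (x - fst p)) (r - Rabs (y - snd p))); split.
- apply Rmin_glb_lt; lra.
- intros u v Hu Hv.
  pose proof (Rmin_l (r - Rabs (x - fst p)) (r - Rabs (y - snd p))).
  pose proof (Rmin_r (r - Rabs (x - fst p)) (r - Rabs (y - snd p))).
  split.
  + replace (u - fst p) with ((u - x) + (x - fst p)) by ring.
    eapply Rle_lt_trans; [apply Rabs_triang | lra].
  + replace (v - snd p) with ((v - y) + (y - snd p)) by ring.
    eapply Rle_lt_trans; [apply Rabs_triang | lra].
Qed.

Lemma in_box_locally p r x y :
  in_box p r x y -> locally_2d (in_box p r) x y.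
Proof.
intros H; destruct (in_box_open _ _ _ _ H) as [e [He Hb]].
exists (mkposreal e He); exact Hb.
Qed.

Lemma in_box_sect1 p r x y :
  in_box p r x y -> locally x (fun z => in_box p r z y).
Proof.
intros H; destruct (in_box_open _ _ _ _ H) as [e [He Hb]].
exists (mkposreal e He); intros z Hz; apply Hb; [exact Hz|].
unfold Rminus; rewrite Rplus_opp_r, Rabs_R0; exact He.
Qed.

Lemma in_box_sect2 p r x y :
  in_box p r x y -> locally y (fun z => in_box p r x z).
Proof.
intros H; destruct (in_box_open _ _ _ _ H) as [e [He Hb]].
exists (mkposreal e He); intros z Hz; apply Hb; [|exact Hz].
unfold Rminus; rewrite Rplus_opp_r, Rabs_R0; exact He.
Qed.

Lemma near_box p P :
  near p P <-> exists r, 0 < r /\ forall x y, in_box p r x y -> P x y.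
Proof.
split.
- intros [d H]; exists d; split; [apply cond_pos|].
  intros x y [H1 H2]; apply H; assumption.
- intros [r [Hr H]]; exists (mkposreal r Hr); intros u v Hu Hv.
  apply H; split; assumption.
Qed.

(** The order is a parameter on one fixed box because the closure properties are proved by induction
    on it: [smooth_to_S] trades one order for the two partial derivatives. *)
Definition smooth_to (p : R * R) (r : R) (n : nat) (f : R -> R -> R) : Prop :=
  forall x y, in_box p r x y -> ex_diff_n f n x y.

Definition smooth_on (p : R * R) (r : R) (f : R -> R -> R) : Prop :=
  forall n, smooth_to p r n f.

Lemma smooth_near_on p f :
  smooth_near p f <-> exists r, 0 < r /\ smooth_on p r f.
Proof.
unfold smooth_near; rewrite near_box; split; intros [r [Hr H]]; exists r; split;
  auto; intros ? ? ? ?; apply H; auto.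
Qed.

Section Smooth.
Variables (p : R * R) (r : R).
Notation "'box'" := (in_box p r).

Lemma smooth_to_S n f :
  smooth_to p r (S n) f <->
  ((forall x y, box x y -> continuity_2d_pt f x y /\
       ex_derive (fun z => f z y) x /\ ex_derive (fun z => f x z) y) /\
   smooth_to p r n (dx f) /\ smooth_to p r n (dy f)).
Proof.
split.
- intros H; split; [|split]; intros x y Hb; destruct (H x y Hb) as (H1 & H2 & H3 & H4 & H5);
    auto.
- intros (H1 & H2 & H3) x y Hb; destruct (H1 x y Hb) as (H4 & H5 & H6).
  exact (conj H4 (conj H5 (conj H6 (conj (H2 x y Hb) (H3 x y Hb))))).
Qed.

Lemma smooth_to_le n m f : (m <= n)%nat -> smooth_to p r n f -> smooth_to p r m f.
Proof. intros Hm H x y Hb; apply (ex_diff_n_m n m Hm), H, Hb. Qed.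

Lemma smooth_to_0 n f :
  smooth_to p r n f -> forall x y, box x y -> continuity_2d_pt f x y.
Proof. intros H x y Hb; destruct n; apply (H x y Hb). Qed.

Lemma smooth_to_ext n f g :
  (forall x y, box x y -> f x y = g x y) -> smooth_to p r n f -> smooth_to p r n g.
Proof.
intros Heq H x y Hb; apply (ex_diff_n_ext_loc f); [|apply H, Hb].
destruct (in_box_locally _ _ _ _ Hb) as [d Hd]; exists d; intros; apply Heq, Hd; auto.
Qed.

Lemma smooth_ext f g :
  (forall x y, box x y -> f x y = g x y) -> smooth_on p r f -> smooth_on p r g.
Proof. intros H Hf n; apply (smooth_to_ext n f); auto. Qed.

Lemma smooth_cont f x y : smooth_on p r f -> box x y -> continuity_2d_pt f x y.
Proof. intros H Hb; apply (H 0%nat x y Hb). Qed.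

Lemma smooth_ex1 f x y : smooth_on p r f -> box x y -> ex_derive (fun z => f z y) x.
Proof. intros H Hb; apply (H 1%nat x y Hb). Qed.

Lemma smooth_ex2 f x y : smooth_on p r f -> box x y -> ex_derive (fun z => f x z) y.
Proof. intros H Hb; apply (H 1%nat x y Hb). Qed.

Lemma smooth_dx f : smooth_on p r f -> smooth_on p r (dx f).
Proof. intros H n; apply (proj1 (smooth_to_S n f) (H (S n))). Qed.

Lemma smooth_dy f : smooth_on p r f -> smooth_on p r (dy f).
Proof. intros H n; apply (proj1 (smooth_to_S n f) (H (S n))). Qed.

Lemma dx_eq f g :
  (forall x y, box x y -> f x y = g x y) ->
  forall x y, box x y -> dx f x y = dx g x y.
Proof.
intros Heq x y Hb; apply Derive_ext_loc.
apply (filter_imp (fun z => box z y)); [intros; apply Heq; auto|].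
apply in_box_sect1, Hb.
Qed.

Lemma dy_eq f g :
  (forall x y, box x y -> f x y = g x y) ->
  forall x y, box x y -> dy f x y = dy g x y.
Proof.
intros Heq x y Hb; apply Derive_ext_loc.
apply (filter_imp (fun z => box x z)); [intros; apply Heq; auto|].
apply in_box_sect2, Hb.
Qed.

(** Order [n + 1] of [f] only asks for order [n] of [g] and [h], which are smooth already, so no
    induction is involved. This serves functions known through their derivatives, such as
    potentials. *)
Lemma smooth_intro f g h :
  (forall x y, box x y -> continuity_2d_pt f x y) ->
  (forall x y, box x y -> is_derive (fun z => f z y) x (g x y)) ->
  (forall x y, box x y -> is_derive (fun z => f x z) y (h x y)) ->
  smooth_on p r g -> smooth_on p r h -> smooth_on p r f.
Proof.
intros H1 H2 H3 Hg Hh n; destruct n as [|n]; [intros x y Hb; split; auto|].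
apply smooth_to_S; split; [|split].
- intros x y Hb; split; [|split]; auto; eexists; [apply H2|apply H3]; auto.
- apply (smooth_to_ext n g); [|apply Hg].
  intros x y Hb; symmetry; apply is_derive_unique, H2, Hb.
- apply (smooth_to_ext n h); [|apply Hh].
  intros x y Hb; symmetry; apply is_derive_unique, H3, Hb.
Qed.

Lemma smooth_const c : smooth_on p r (fun _ _ => c).
Proof.
assert (H : forall n c, smooth_to p r n (fun _ _ => c)).
{ induction n as [|n IH]; intros c'.
  - intros x y _; split; auto; apply continuity_2d_pt_const.
  - apply smooth_to_S; split; [|split].
    + intros x y _; split; [|split]; [apply continuity_2d_pt_const|apply ex_derive_const..].
    + apply (smooth_to_ext n (fun _ _ => 0)); auto.
      intros x y _; symmetry; exact (Derive_const c' x).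
    + apply (smooth_to_ext n (fun _ _ => 0)); auto.
      intros x y _; symmetry; exact (Derive_const c' y). }
intros n; apply H.
Qed.

Lemma smooth_to_plus n f g : smooth_to p r n f -> smooth_to p r n g ->
  smooth_to p r n (fun x y => f x y + g x y).
Proof.
revert f g; induction n as [|n IH]; intros f' g' Hf Hg.
- intros x y Hb; split; auto; apply continuity_2d_pt_plus; eapply smooth_to_0; eauto.
- apply smooth_to_S in Hf; apply smooth_to_S in Hg.
  destruct Hf as (Hf1 & Hf2 & Hf3); destruct Hg as (Hg1 & Hg2 & Hg3).
  apply smooth_to_S; split; [|split].
  + intros x y Hb; destruct (Hf1 x y Hb) as (?&?&?); destruct (Hg1 x y Hb) as (?&?&?).
    split; [apply continuity_2d_pt_plus; auto|].
    split; apply @ex_derive_plus; auto.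
  + apply (smooth_to_ext n (fun x y => dx f' x y + dx g' x y)); auto.
    intros x y Hb; destruct (Hf1 x y Hb) as (?&?&?); destruct (Hg1 x y Hb) as (?&?&?).
    symmetry; apply (Derive_plus (fun z => f' z y) (fun z => g' z y)); auto.
  + apply (smooth_to_ext n (fun x y => dy f' x y + dy g' x y)); auto.
    intros x y Hb; destruct (Hf1 x y Hb) as (?&?&?); destruct (Hg1 x y Hb) as (?&?&?).
    symmetry; apply (Derive_plus (fun z => f' x z) (fun z => g' x z)); auto.
Qed.

Lemma smooth_to_mult n f g : smooth_to p r n f -> smooth_to p r n g ->
  smooth_to p r n (fun x y => f x y * g x y).
Proof.
revert f g; induction n as [|n IH]; intros f' g' Hf Hg.
- intros x y Hb; split; auto; apply continuity_2d_pt_mult; eapply smooth_to_0; eauto.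
- pose proof (smooth_to_le (S n) n f' (Nat.le_succ_diag_r n) Hf).
  pose proof (smooth_to_le (S n) n g' (Nat.le_succ_diag_r n) Hg).
  apply smooth_to_S in Hf; apply smooth_to_S in Hg.
  destruct Hf as (Hf1 & Hf2 & Hf3); destruct Hg as (Hg1 & Hg2 & Hg3).
  apply smooth_to_S; split; [|split].
  + intros x y Hb; destruct (Hf1 x y Hb) as (?&?&?); destruct (Hg1 x y Hb) as (?&?&?).
    split; [apply continuity_2d_pt_mult; auto|].
    split; apply @ex_derive_mult; auto.
  + apply (smooth_to_ext n (fun x y => dx f' x y * g' x y + f' x y * dx g' x y)).
    * intros x y Hb; destruct (Hf1 x y Hb) as (?&?&?); destruct (Hg1 x y Hb) as (?&?&?).
      symmetry; apply (Derive_mult (fun z => f' z y) (fun z => g' z y)); auto.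
    * apply smooth_to_plus; apply IH; auto.
  + apply (smooth_to_ext n (fun x y => dy f' x y * g' x y + f' x y * dy g' x y)).
    * intros x y Hb; destruct (Hf1 x y Hb) as (?&?&?); destruct (Hg1 x y Hb) as (?&?&?).
      symmetry; apply (Derive_mult (fun z => f' x z) (fun z => g' x z)); auto.
    * apply smooth_to_plus; apply IH; auto.
Qed.

Lemma smooth_plus f g :
  smooth_on p r f -> smooth_on p r g -> smooth_on p r (fun x y => f x y + g x y).
Proof. intros Hf Hg n; apply smooth_to_plus; auto. Qed.

Lemma smooth_mult f g :
  smooth_on p r f -> smooth_on p r g -> smooth_on p r (fun x y => f x y * g x y).
Proof. intros Hf Hg n; apply smooth_to_mult; auto. Qed.

Lemma smooth_opp f : smooth_on p r f -> smooth_on p r (fun x y => - f x y).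
Proof.
intros Hf; apply (smooth_ext (fun x y => (-1) * f x y)); [intros; ring|].
apply smooth_mult; [apply smooth_const|exact Hf].
Qed.

Lemma smooth_minus f g :
  smooth_on p r f -> smooth_on p r g -> smooth_on p r (fun x y => f x y - g x y).
Proof. intros Hf Hg; apply smooth_plus; [|apply smooth_opp]; assumption. Qed.

Lemma smooth_pow f n : smooth_on p r f -> smooth_on p r (fun x y => f x y ^ n).
Proof.
intros Hf; induction n as [|n IH]; [exact (smooth_const 1)|].
apply (smooth_mult f (fun x y => f x y ^ n)); auto.
Qed.

Lemma smooth_fst : smooth_on p r (fun x _ => x).
Proof.
apply (smooth_intro _ (fun _ _ => 1) (fun _ _ => 0)); try apply smooth_const; intros x y _.
- apply continuity_2d_pt_id1.
- auto_derive; auto.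
- auto_derive; auto.
Qed.

Lemma smooth_snd : smooth_on p r (fun _ y => y).
Proof.
apply (smooth_intro _ (fun _ _ => 0) (fun _ _ => 1)); try apply smooth_const; intros x y _.
- apply continuity_2d_pt_id2.
- auto_derive; auto.
- auto_derive; auto.
Qed.

(** The derivative [- f' / f^2] contains the reciprocal again, but one order lower, where the
    induction hypothesis applies. The same device works for the exponential. *)
Lemma smooth_inv f :
  (forall x y, box x y -> f x y <> 0) ->
  smooth_on p r f -> smooth_on p r (fun x y => / f x y).
Proof.
intros Hn Hf n; induction n as [|n IH].
- intros x y Hb; split; auto; apply continuity_2d_pt_inv; [apply smooth_cont|]; auto.
- apply smooth_to_S; split; [|split].
  + intros x y Hb; split; [|split].
    * apply continuity_2d_pt_inv; [apply smooth_cont|]; auto.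
    * apply (ex_derive_inv (fun z => f z y)); [apply smooth_ex1|]; auto.
    * apply (ex_derive_inv (fun z => f x z)); [apply smooth_ex2|]; auto.
  + apply (smooth_to_ext n (fun x y => (-1 * dx f x y) * (/ f x y * / f x y))).
    * intros x y Hb; symmetry; unfold dx.
      rewrite (Derive_inv (fun z => f z y)); [field|apply smooth_ex1|]; auto.
    * pose proof (smooth_dx _ Hf n); repeat apply smooth_to_mult; auto; apply (smooth_const (-1)).
  + apply (smooth_to_ext n (fun x y => (-1 * dy f x y) * (/ f x y * / f x y))).
    * intros x y Hb; symmetry; unfold dy.
      rewrite (Derive_inv (fun z => f x z)); [field|apply smooth_ex2|]; auto.
    * pose proof (smooth_dy _ Hf n); repeat apply smooth_to_mult; auto; apply (smooth_const (-1)).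
Qed.

Lemma smooth_div f g :
  (forall x y, box x y -> g x y <> 0) ->
  smooth_on p r f -> smooth_on p r g -> smooth_on p r (fun x y => f x y / g x y).
Proof. intros Hn Hf Hg; apply smooth_mult; [|apply smooth_inv]; assumption. Qed.

Lemma smooth_exp f : smooth_on p r f -> smooth_on p r (fun x y => exp (f x y)).
Proof.
assert (Hc : forall x y, smooth_on p r f -> box x y ->
  continuity_2d_pt (fun x y => exp (f x y)) x y).
{ intros x y Hf Hb; apply (continuity_1d_2d_pt_comp exp f).
  - apply derivable_continuous_pt, derivable_pt_exp.
  - apply smooth_cont; auto. }
intros Hf n; induction n as [|n IH].
- intros x y Hb; split; auto.
- apply smooth_to_S; split; [|split].
  + intros x y Hb; split; [|split]; auto.
    * pose proof (smooth_ex1 _ _ _ Hf Hb); auto_derive; auto.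
    * pose proof (smooth_ex2 _ _ _ Hf Hb); auto_derive; auto.
  + apply (smooth_to_ext n (fun x y => dx f x y * exp (f x y))).
    * intros x y Hb; symmetry; apply is_derive_unique.
      pose proof (smooth_ex1 _ _ _ Hf Hb); auto_derive; auto; unfold dx; ring.
    * pose proof (smooth_dx _ Hf n); apply smooth_to_mult; auto.
  + apply (smooth_to_ext n (fun x y => dy f x y * exp (f x y))).
    * intros x y Hb; symmetry; apply is_derive_unique.
      pose proof (smooth_ex2 _ _ _ Hf Hb); auto_derive; auto; unfold dy; ring.
    * pose proof (smooth_dy _ Hf n); apply smooth_to_mult; auto.
Qed.

(** The integrability conditions of the curvature part and the commutation of [DX] with [DY] all
    come from this equality. *)
Lemma smooth_schwarz f x y : smooth_on p r f -> box x y -> dx (dy f) x y = dy (dx f) x y.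
Proof.
intros Hf Hb; apply Schwarz.
- destruct (in_box_locally _ _ _ _ Hb) as [d Hd]; exists d; intros u v Hu Hv.
  specialize (Hd u v Hu Hv); repeat split.
  + apply smooth_ex1; auto.
  + apply smooth_ex2; auto.
  + apply (smooth_ex1 (dy f)); auto; apply smooth_dy; auto.
  + apply (smooth_ex2 (dx f)); auto; apply smooth_dx; auto.
- apply (smooth_cont (dx (dy f))); auto; apply smooth_dx, smooth_dy; auto.
- apply (smooth_cont (dy (dx f))); auto; apply smooth_dy, smooth_dx; auto.
Qed.

Lemma smooth_differentiable f x y :
  smooth_on p r f -> box x y -> differentiable_pt_lim f x y (dx f x y) (dy f x y).
Proof.
intros Hf Hb; apply filterdiff_differentiable_pt_lim.
apply (is_derive_filterdiff f x y (dx f)).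
- apply (locally_2d_locally (fun u v => is_derive (fun z => f z v) u (dx f u v))).
  destruct (in_box_locally _ _ _ _ Hb) as [d Hd]; exists d; intros u v Hu Hv.
  apply Derive_correct, smooth_ex1; auto.
- apply Derive_correct, smooth_ex2; auto.
- apply continuity_2d_pt_filterlim, smooth_cont; auto; apply smooth_dx; auto.
Qed.

Lemma smooth_chain f u v t du dv :
  smooth_on p r f -> box (u t) (v t) -> is_derive u t du -> is_derive v t dv ->
  is_derive (fun s => f (u s) (v s)) t
    (dx f (u t) (v t) * du + dy f (u t) (v t) * dv).
Proof.
intros Hf Hb Hu Hv; apply is_derive_Reals.
apply derivable_pt_lim_comp_2d; [apply smooth_differentiable| |]; auto;
  apply is_derive_Reals; assumption.
Qed.

End Smooth.

Lemma smooth_on_le p r r' f : r' <= r -> smooth_on p r f -> smooth_on p r' f.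
Proof. intros Hr H n x y Hb; apply H, (in_box_le p r'); auto. Qed.

Ltac smooth :=
  first [assumption | apply smooth_const |
  lazymatch goal with
  | |- smooth_on _ _ (fun x y => @?f x y + @?g x y) => apply (smooth_plus _ _ f g); smooth
  | |- smooth_on _ _ (fun x y => @?f x y - @?g x y) => apply (smooth_minus _ _ f g); smooth
  | |- smooth_on _ _ (fun x y => - @?f x y) => apply (smooth_opp _ _ f); smooth
  | |- smooth_on _ _ (fun x y => @?f x y * @?g x y) => apply (smooth_mult _ _ f g); smooth
  | |- smooth_on _ _ (fun x y => @?f x y / @?g x y) => apply (smooth_div _ _ f g); [ |smooth|smooth]
  | |- smooth_on _ _ (fun x y => / @?f x y) => apply (smooth_inv _ _ f); [ |smooth]
  | |- smooth_on _ _ (fun x y => @?f x y ^ ?n) => apply (smooth_pow _ _ f n); smooth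
  | |- smooth_on _ _ (fun x y => exp (@?f x y)) => apply (smooth_exp _ _ f); smooth
  | |- smooth_on _ _ (fun x y => dx ?f x y) => apply (smooth_dx _ _ f); smooth
  | |- smooth_on _ _ (fun x y => dy ?f x y) => apply (smooth_dy _ _ f); smooth
  | |- smooth_on _ _ (dx ?f) => apply (smooth_dx _ _ f); smooth
  | |- smooth_on _ _ (dy ?f) => apply (smooth_dy _ _ f); smooth
  | |- smooth_on _ _ (fun x y => x) => apply smooth_fst
  | |- smooth_on _ _ (fun x y => y) => apply smooth_snd
  | |- _ => idtac
  end].

(* Solves the existence conditions that [auto_derive] leaves for smooth
   functions of two variables. *)
Ltac smooth_side :=
  repeat match goal with |- _ /\ _ => split end; trivial;
  match goal with
  | Hb : in_box ?p ?r ?a ?b |- ex_derive (fun z => ?f z ?b) ?a =>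
      apply (smooth_ex1 p r f a b); [smooth|exact Hb]
  | Hb : in_box ?p ?r ?a ?b |- ex_derive (fun z => ?f ?a z) ?b =>
      apply (smooth_ex2 p r f a b); [smooth|exact Hb]
  | |- _ => idtac
  end.

Ltac fold_partials H :=
  repeat match type of H with
  | context [Derive (fun z => ?f z ?b) ?a] =>
      change (Derive (fun z => f z b) a) with (dx f a b) in H
  | context [Derive (fun z => ?f ?a z) ?b] =>
      change (Derive (fun z => f a z) b) with (dy f a b) in H
  end.

(* Computes the partial derivatives of explicit expressions in smooth functions
   that occur in the goal or in [H]; other side conditions must be assumptions. *)
Ltac expand_partial D tac :=
  let Hd := fresh in
  eassert (Hd : D = _)
    by (apply is_derive_unique; auto_derive; [smooth_side; auto | reflexivity]);
  fold_partials Hd; tac Hd; clear Hd.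
Ltac expand_partials_in H :=
  let tac Hd := (rewrite Hd in H) in
  repeat match type of H with
  | context [dx (fun u v => @?f u v) ?a ?b] => expand_partial (dx f a b) tac
  | context [dy (fun u v => @?f u v) ?a ?b] => expand_partial (dy f a b) tac
  end.
Ltac expand_partials :=
  let tac Hd := (rewrite Hd) in
  repeat match goal with
  | |- context [dx (fun u v => @?f u v) ?a ?b] => expand_partial (dx f a b) tac
  | |- context [dy (fun u v => @?f u v) ?a ?b] => expand_partial (dy f a b) tac
  end.

(** * Curvature identities *)

Section Covariants.
Variables (p : R * R) (r : R) (P Q R S A B f1 f2 Th : R -> R -> R).
Notation "'box'" := (in_box p r).
Hypotheses (sP : smooth_on p r P) (sQ : smooth_on p r Q) (sR : smooth_on p r R)
  (sS : smooth_on p r S) (sA : smooth_on p r A) (sB : smooth_on p r B)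
  (sf1 : smooth_on p r f1) (sf2 : smooth_on p r f2) (sTh : smooth_on p r Th).

Hypothesis AB_neq0 : forall x y, box x y -> A x y <> 0 \/ B x y <> 0.

(* [a = (A, B)] is parallel for the connection [Gam], as a covector of
   weight 1: the cases "A <> 0" and "B <> 0" lead to the same four equations. *)
Hypothesis dxA : forall x y, box x y ->
  dx A x y = Q x y * A x y - P x y * B x y - 5 / 3 * f1 x y * A x y.
Hypothesis dyA : forall x y, box x y ->
  dy A x y = R x y * A x y - Q x y * B x y - 1 / 3 * f1 x y * B x y - 4 / 3 * f2 x y * A x y.
Hypothesis dxB : forall x y, box x y ->
  dx B x y = R x y * A x y - Q x y * B x y - 4 / 3 * f1 x y * B x y - 1 / 3 * f2 x y * A x y.
Hypothesis dyB : forall x y, box x y ->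
  dy B x y = S x y * A x y - R x y * B x y - 5 / 3 * f2 x y * B x y.
Hypothesis dyf1 : forall x y, box x y -> dy f1 x y = dx f2 x y.

(** The products of connection coefficients in the curvature. They form the commutator of the
    matrices of [Gam] in the two directions, whose trace vanishes; hence the term [- quad11] in
    [rho22]. *)
Definition quad11 x y :=
  (R x y - 1 / 3 * f2 x y) * (- Q x y - 1 / 3 * f1 x y) + S x y * P x y.
Definition quad12 x y :=
  (Q x y - 2 / 3 * f1 x y) * S x y - (R x y - 1 / 3 * f2 x y) ^ 2
  + (R x y - 1 / 3 * f2 x y) * (- R x y - 2 / 3 * f2 x y)
  - S x y * (- Q x y - 1 / 3 * f1 x y).
Definition quad21 x y :=
  - P x y * (R x y - 1 / 3 * f2 x y)
  - (- Q x y - 1 / 3 * f1 x y) * (Q x y - 2 / 3 * f1 x y)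
  + (- Q x y - 1 / 3 * f1 x y) ^ 2 + (- R x y - 2 / 3 * f2 x y) * P x y.

Definition rho11 x y := dx R x y - 1 / 3 * dx f2 x y - dy Q x y + 2 / 3 * dy f1 x y + quad11 x y.
Definition rho12 x y := dx S x y - dy R x y + 1 / 3 * dy f2 x y + quad12 x y.
Definition rho21 x y := - dx Q x y - 1 / 3 * dx f1 x y + dy P x y + quad21 x y.
Definition rho22 x y := - dx R x y - 2 / 3 * dx f2 x y + dy Q x y + 1 / 3 * dy f1 x y - quad11 x y.

(** The trace of the curvature is [dy f1 - dx f2], that is [Omega] up to a factor. *)
Lemma rho_trace x y : box x y -> rho22 x y = - rho11 x y.
Proof. intros Hb; unfold rho11, rho22; rewrite dyf1 by exact Hb; ring. Qed.

(** Ricci identity: the curvature annihilates a parallel covector, since the weight only contributes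
    the curl of [(f1, f2)], which vanishes. It is the equality of the mixed derivatives of [A] here,
    and of [B] in [rho_col2]. *)
Lemma rho_col1 x y : box x y -> rho11 x y * A x y + rho21 x y * B x y = 0.
Proof.
intros Hb.
pose proof (smooth_schwarz p r A x y sA Hb) as HS.
rewrite (dx_eq p r _ _ dyA x y Hb), (dy_eq p r _ _ dxA x y Hb) in HS.
expand_partials_in HS; rewrite dxA, dyA, dxB, dyB, dyf1 in HS by exact Hb.
unfold rho11, rho21, quad11, quad21; rewrite dyf1 by exact Hb; lra.
Qed.

Lemma rho_col2 x y : box x y -> rho12 x y * A x y + rho22 x y * B x y = 0.
Proof.
intros Hb.
pose proof (smooth_schwarz p r B x y sB Hb) as HS.
rewrite (dx_eq p r _ _ dyB x y Hb), (dy_eq p r _ _ dxB x y Hb) in HS.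
expand_partials_in HS; rewrite dxA, dyA, dxB, dyB, dyf1 in HS by exact Hb.
unfold rho12, rho22, quad11, quad12; rewrite dyf1 by exact Hb; lra.
Qed.

(** With [alpha = (B, - A)] the three hypotheses say [rho^k_q = Th alpha^k a_q]: a trace-free matrix
    annihilated by [a] leaves only one free factor. *)
Hypothesis rho11_Th : forall x y, box x y -> rho11 x y = Th x y * A x y * B x y.
Hypothesis rho12_Th : forall x y, box x y -> rho12 x y = Th x y * B x y ^ 2.
Hypothesis rho21_Th : forall x y, box x y -> rho21 x y = - Th x y * A x y ^ 2.

Hypothesis defA : forall x y, box x y -> A x y =
    dy (dy P) x y - 2 * dy (dx Q) x y + dx (dx R) x y
    + 2 * P x y * dx S x y + S x y * dx P x y
    - 3 * P x y * dy R x y - 3 * R x y * dy P x y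
    - 3 * Q x y * dx R x y + 6 * Q x y * dy Q x y.
Hypothesis defB : forall x y, box x y -> B x y =
    dx (dx S) x y - 2 * dy (dx R) x y + dy (dy Q) x y
    - 2 * S x y * dy P x y - P x y * dy S x y
    + 3 * S x y * dx Q x y + 3 * Q x y * dx S x y
    + 3 * R x y * dy Q x y - 6 * R x y * dx R x y.

Definition th1 x y := dx Th x y - 2 * f1 x y * Th x y.
Definition th2 x y := dy Th x y - 2 * f2 x y * Th x y.

Lemma rho22_Th x y : box x y -> rho22 x y = - Th x y * A x y * B x y.
Proof. intros Hb; rewrite rho_trace, rho11_Th by exact Hb; ring. Qed.

(** Each curvature equation is solved for one first derivative of a coefficient. Once these
    derivatives are eliminated, the differential identities below follow by linear combination. *)
Lemma curvature_dxS x y : box x y ->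
  dx S x y = Th x y * B x y ^ 2 + dy R x y - 1 / 3 * dy f2 x y - quad12 x y.
Proof. intros Hb; pose proof (rho12_Th x y Hb) as H; unfold rho12 in H; lra. Qed.

Lemma curvature_dxR x y : box x y ->
  dx R x y = Th x y * A x y * B x y - 1 / 3 * dx f2 x y + dy Q x y - quad11 x y.
Proof.
intros Hb; pose proof (rho11_Th x y Hb) as H; unfold rho11 in H.
rewrite dyf1 in H by exact Hb; lra.
Qed.

Lemma curvature_dyP x y : box x y ->
  dy P x y = - Th x y * A x y ^ 2 + dx Q x y + 1 / 3 * dx f1 x y - quad21 x y.
Proof. intros Hb; pose proof (rho21_Th x y Hb) as H; unfold rho21 in H; lra. Qed.

(* [(A, B)] is the Cotton tensor of the connection: [B] arises from
   [d_x rho12 - d_y rho11], and [A] from [d_y rho21 - d_x rho22]. *)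
Lemma cotton_B x y : box x y -> B x y = B x y * (th1 x y * B x y - th2 x y * A x y).
Proof.
intros Hb.
pose proof (dx_eq p r _ _ rho12_Th x y Hb) as H12.
pose proof (dy_eq p r _ _ rho11_Th x y Hb) as H11.
pose proof (defB x y Hb) as HB.
unfold rho12, quad12 in H12; unfold rho11, quad11 in H11.
expand_partials_in H12; expand_partials_in H11.
rewrite (smooth_schwarz p r R x y sR Hb), (smooth_schwarz p r f2 x y sf2 Hb) in H12.
rewrite (dy_eq p r _ _ dyf1 x y Hb) in H11.
rewrite dxB, curvature_dxS, curvature_dxR in H12 by exact Hb.
rewrite dyA, dyB, dyf1, curvature_dyP in H11 by exact Hb.
rewrite curvature_dxS, curvature_dxR, curvature_dyP in HB by exact Hb.
unfold th1, th2; unfold quad11, quad12, quad21 in *; lra.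
Qed.

Lemma cotton_A x y : box x y -> A x y = A x y * (th1 x y * B x y - th2 x y * A x y).
Proof.
intros Hb.
pose proof (dy_eq p r _ _ rho21_Th x y Hb) as H21.
pose proof (dx_eq p r _ _ rho22_Th x y Hb) as H22.
pose proof (defA x y Hb) as HA.
unfold rho21, quad21 in H21; unfold rho22, quad11 in H22.
expand_partials_in H21; expand_partials_in H22.
rewrite (smooth_schwarz p r Q x y sQ Hb), (dx_eq p r _ _ dyf1 x y Hb) in H22.
rewrite <- (smooth_schwarz p r f1 x y sf1 Hb), (dx_eq p r _ _ dyf1 x y Hb) in H21.
rewrite dyA, dyf1, curvature_dyP in H21 by exact Hb.
rewrite dxA, dxB, curvature_dxS, curvature_dxR in H22 by exact Hb.
rewrite curvature_dxS, curvature_dxR, curvature_dyP in HA by exact Hb.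
unfold th1, th2; unfold quad11, quad12, quad21 in *; lra.
Qed.

(** By [cotton_A] and [cotton_B] the contraction [theta_i alpha^i] acts on the nonzero covector
    [(A, B)] as 1 does. It makes [theta] and [a] independent, and becomes the Jacobian of [(X, Y)]
    up to an exponential. *)
Lemma theta_alpha x y : box x y -> th1 x y * B x y - th2 x y * A x y = 1.
Proof.
intros Hb; destruct (AB_neq0 x y Hb) as [H|H].
- apply (Rmult_eq_reg_l (A x y)); [|exact H].
  rewrite <- cotton_A by exact Hb; ring.
- apply (Rmult_eq_reg_l (B x y)); [|exact H].
  rewrite <- cotton_B by exact Hb; ring.
Qed.

(** This is [qZ] for [C = th2] and [D = - th1]. Invariantly it is minus the covariant derivative of
    [theta], contracted twice with [theta^i], as [Zc_M] shows. *)
Definition Zc x y :=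
    th2 x y * - th1 x y * (- dy th1 x y - dx th2 x y)
    + th2 x y ^ 2 * - dx th1 x y - th1 x y ^ 2 * dy th2 x y
    - P x y * th2 x y ^ 3 + 3 * Q x y * th2 x y ^ 2 * th1 x y
    - 3 * R x y * th2 x y * th1 x y ^ 2 + S x y * th1 x y ^ 3.

Lemma smooth_th1 : smooth_on p r th1.
Proof. unfold th1; smooth. Qed.
Lemma smooth_th2 : smooth_on p r th2.
Proof. unfold th2; smooth. Qed.

(** [Mki] is the covariant derivative of [theta_k], taken with weight -2, in the direction [i]. *)
Definition M11 x y := dx th1 x y - 2 * f1 x y * th1 x y
  - (Q x y - 2 / 3 * f1 x y) * th1 x y + P x y * th2 x y.
Definition M12 x y := dy th1 x y - 2 * f2 x y * th1 x y
  - (R x y - 1 / 3 * f2 x y) * th1 x y + (Q x y + 1 / 3 * f1 x y) * th2 x y.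
Definition M21 x y := dx th2 x y - 2 * f1 x y * th2 x y
  - (R x y - 1 / 3 * f2 x y) * th1 x y + (Q x y + 1 / 3 * f1 x y) * th2 x y.
Definition M22 x y := dy th2 x y - 2 * f2 x y * th2 x y
  - S x y * th1 x y + (R x y + 2 / 3 * f2 x y) * th2 x y.

(** The covector [theta] is the weighted gradient of [Th], the connection has no torsion, and
    [(f1, f2)] is closed. *)
Lemma M_sym x y : box x y -> M12 x y = M21 x y.
Proof.
intros Hb; unfold M12, M21, th1 at 1, th2 at 2; expand_partials.
rewrite dyf1, (smooth_schwarz p r Th x y sTh Hb) by exact Hb; unfold th1, th2; ring.
Qed.

(** Differentiate the constant contraction [theta_alpha]: as [alpha] inherits parallelism from [a],
    only the derivative of [theta] is left. *)
Lemma M_alpha1 x y : box x y -> M11 x y * B x y - M21 x y * A x y = 0.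
Proof.
intros Hb; pose proof smooth_th1; pose proof smooth_th2.
pose proof (dx_eq p r _ _ theta_alpha x y Hb) as HS.
expand_partials_in HS; rewrite dxA, dxB in HS by exact Hb.
unfold M11, M21; lra.
Qed.

Lemma M_alpha2 x y : box x y -> M12 x y * B x y - M22 x y * A x y = 0.
Proof.
intros Hb; pose proof smooth_th1; pose proof smooth_th2.
pose proof (dy_eq p r _ _ theta_alpha x y Hb) as HS.
expand_partials_in HS; rewrite dyA, dyB in HS by exact Hb.
unfold M12, M22; lra.
Qed.

Lemma Zc_M x y : box x y ->
  Zc x y = - (M11 x y * th2 x y ^ 2 - 2 * M12 x y * th1 x y * th2 x y + M22 x y * th1 x y ^ 2).
Proof.
intros Hb; transitivity (- (M11 x y * th2 x y ^ 2 - M12 x y * th1 x y * th2 x y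
  - M21 x y * th1 x y * th2 x y + M22 x y * th1 x y ^ 2)).
- unfold Zc, M11, M12, M21, M22; field.
- rewrite <- (M_sym x y Hb); ring.
Qed.

(* A symmetric form annihilated by [alpha = (B, -A)] is a multiple of [a a];
   the multiple is read off by contraction with [theta]. *)
Lemma M_Z x y : box x y ->
  M11 x y = - Zc x y * A x y ^ 2 /\ M12 x y = - Zc x y * A x y * B x y /\ M21 x y = - Zc x y * A x y * B x y /\ M22 x y = - Zc x y * B x y ^ 2.
Proof.
intros Hb; rewrite (Zc_M x y Hb), <- (M_sym x y Hb).
pose proof (M_alpha1 x y Hb) as H1; pose proof (M_alpha2 x y Hb) as H2.
rewrite <- (M_sym x y Hb) in H1.
pose proof (theta_alpha x y Hb) as H.
set (m11 := M11 x y) in *; set (m12 := M12 x y) in *; set (m22 := M22 x y) in *.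
set (a := A x y) in *; set (b := B x y) in *; set (t1 := th1 x y) in *; set (t2 := th2 x y) in *.
clearbody m11 m12 m22 a b t1 t2.
assert (Hz : forall m, m = m * ((t1 * b - t2 * a) ^ 2)) by (intros m; rewrite H; ring).
assert (H1' : m11 * b = m12 * a) by lra.
assert (H2' : m12 * b = m22 * a) by lra.
repeat split; [rewrite (Hz m11) at 1|rewrite (Hz m12) at 1..|rewrite (Hz m22) at 1].
- replace (m11 * (t1 * b - t2 * a) ^ 2) with
    (t1 ^ 2 * b * (m11 * b) - 2 * t1 * t2 * a * (m11 * b) + t2 ^ 2 * a ^ 2 * m11) by ring.
  rewrite H1'; replace (t1 ^ 2 * b * (m12 * a)) with (t1 ^ 2 * a * (m12 * b)) by ring.
  rewrite H2'; ring.
- replace (m12 * (t1 * b - t2 * a) ^ 2) with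
    (t1 ^ 2 * b * (m12 * b) - 2 * t1 * t2 * b * a * m12 + t2 ^ 2 * a * (m12 * a)) by ring.
  rewrite H2', <- H1'; ring.
- replace (m12 * (t1 * b - t2 * a) ^ 2) with
    (t1 ^ 2 * b * (m12 * b) - 2 * t1 * t2 * b * a * m12 + t2 ^ 2 * a * (m12 * a)) by ring.
  rewrite H2', <- H1'; ring.
- replace (m22 * (t1 * b - t2 * a) ^ 2) with
    (t1 ^ 2 * b ^ 2 * m22 - 2 * t1 * t2 * b * (m22 * a) + t2 ^ 2 * a * (m22 * a)) by ring.
  rewrite <- H2'; replace (t2 ^ 2 * a * (m12 * b)) with (t2 ^ 2 * b * (m12 * a)) by ring.
  rewrite <- H1'; ring.
Qed.

Lemma dth x y : box x y ->
  dx th1 x y = 2 * f1 x y * th1 x y + (Q x y - 2 / 3 * f1 x y) * th1 x y - P x y * th2 x y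
    - Zc x y * A x y ^ 2 /\
  dy th1 x y = 2 * f2 x y * th1 x y + (R x y - 1 / 3 * f2 x y) * th1 x y
    - (Q x y + 1 / 3 * f1 x y) * th2 x y - Zc x y * A x y * B x y /\
  dx th2 x y = 2 * f1 x y * th2 x y + (R x y - 1 / 3 * f2 x y) * th1 x y
    - (Q x y + 1 / 3 * f1 x y) * th2 x y - Zc x y * A x y * B x y /\
  dy th2 x y = 2 * f2 x y * th2 x y + S x y * th1 x y - (R x y + 2 / 3 * f2 x y) * th2 x y
    - Zc x y * B x y ^ 2.
Proof.
intros Hb; destruct (M_Z x y Hb) as (H1 & H2 & H3 & H4); unfold M11, M12, M21, M22 in *.
repeat split; lra.
Qed.

Lemma smooth_Zc : smooth_on p r Zc.
Proof. pose proof smooth_th1; pose proof smooth_th2; unfold Zc; smooth. Qed.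

Definition Lc x y := Zc x y - 1 / 2 * Th x y ^ 2.

Lemma smooth_Lc : smooth_on p r Lc.
Proof. pose proof smooth_Zc; unfold Lc; smooth. Qed.

Definition dZ1 x y := dx Zc x y - 4 * f1 x y * Zc x y.
Definition dZ2 x y := dy Zc x y - 4 * f2 x y * Zc x y.

(** Ricci identity for [theta], whose covariant derivative is [- Z a a] with [a] parallel: commuting
    the derivatives leaves the derivative of [Z] along [alpha], times [a], against [Th] times [a]
    from the curvature. The components [HB] and [HA] carry the factors [B] and [A], one of which is
    nonzero. *)
Lemma alpha_Z x y : box x y -> B x y * dZ1 x y - A x y * dZ2 x y = Th x y.
Proof.
intros Hb; pose proof smooth_th1; pose proof smooth_th2; pose proof smooth_Zc.
destruct (dth x y Hb) as (D11 & D12 & D21 & D22).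
pose proof (theta_alpha x y Hb) as Hta.
assert (HB : B x y * (B x y * dZ1 x y - A x y * dZ2 x y) = B x y * Th x y).
{ pose proof (smooth_schwarz p r th2 x y smooth_th2 Hb) as HS.
  rewrite (dx_eq p r _ _ (fun x y Hb => proj2 (proj2 (proj2 (dth x y Hb)))) x y Hb),
    (dy_eq p r _ _ (fun x y Hb => proj1 (proj2 (proj2 (dth x y Hb)))) x y Hb) in HS.
  expand_partials_in HS.
  rewrite D11, D12, D21, D22, dyA, dxB, dyB, dyf1, curvature_dxS, curvature_dxR in HS by exact Hb.
  transitivity (Th x y * B x y * (th1 x y * B x y - th2 x y * A x y)); [|rewrite Hta; ring].
  unfold dZ1, dZ2; unfold quad11, quad12 in HS; lra. }
assert (HA : A x y * (B x y * dZ1 x y - A x y * dZ2 x y) = A x y * Th x y).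
{ pose proof (smooth_schwarz p r th1 x y smooth_th1 Hb) as HS.
  rewrite (dx_eq p r _ _ (fun x y Hb => proj1 (proj2 (dth x y Hb))) x y Hb),
    (dy_eq p r _ _ (fun x y Hb => proj1 (dth x y Hb)) x y Hb) in HS.
  expand_partials_in HS.
  rewrite D11, D12, D21, D22, dxA, dyA, dxB, dyf1, curvature_dxR, curvature_dyP in HS by exact Hb.
  transitivity (Th x y * A x y * (th1 x y * B x y - th2 x y * A x y)); [|rewrite Hta; ring].
  unfold dZ1, dZ2; unfold quad11, quad21 in HS; lra. }
destruct (AB_neq0 x y Hb) as [H'|H'];
  [apply (Rmult_eq_reg_l (A x y)) | apply (Rmult_eq_reg_l (B x y))]; assumption.
Qed.

(** The derivative of [Th] along [alpha] is 1, so that of [Th^2 / 2] is [Th] and cancels the one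
    found in [alpha_Z]. This is what makes [L], after rescaling, a function of [Y] alone. *)
Lemma alpha_L x y : box x y ->
  B x y * (dx Lc x y - 4 * f1 x y * Lc x y) - A x y * (dy Lc x y - 4 * f2 x y * Lc x y) = 0.
Proof.
intros Hb; pose proof smooth_Zc.
pose proof (alpha_Z x y Hb) as HZ; pose proof (theta_alpha x y Hb) as Ht.
unfold Lc; expand_partials.
unfold dZ1, dZ2 in HZ; unfold th1, th2 in Ht.
apply (Rmult_eq_compat_l (Th x y)) in Ht; lra.
Qed.

End Covariants.

(** * Potentials of closed one-forms *)

Lemma smooth_of_partials p r f g h :
  (forall x y, in_box p r x y -> is_derive (fun z => f z y) x (g x y)) ->
  (forall x y, in_box p r x y -> is_derive (fun z => f x z) y (h x y)) ->
  smooth_on p r g -> smooth_on p r h -> smooth_on p r f.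
Proof.
intros H1 H2 Hg Hh; apply (smooth_intro p r f g h); auto.
intros x y Hb; apply continuity_2d_pt_filterlim.
apply (filterdiff_continuous (fun u : R * R => f (fst u) (snd u))).
eexists; apply (is_derive_filterdiff f x y g).
- apply (locally_2d_locally (fun u v => is_derive (fun z => f z v) u (g u v))).
  destruct (in_box_locally _ _ _ _ Hb) as [d Hd]; exists d; intros; apply H1, Hd; auto.
- apply H2, Hb.
- apply continuity_2d_pt_filterlim, (smooth_cont p r); auto.
Qed.

Lemma in_box_between1 p r x y t :
  in_box p r x y -> Rmin (fst p) x <= t <= Rmax (fst p) x -> in_box p r t y.
Proof.
intros [H1 H2] Ht; split; auto.
revert H1 Ht; unfold Rmin, Rmax, Rabs.
destruct (Rle_dec (fst p) x); repeat destruct Rcase_abs; lra.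
Qed.

Lemma in_box_between2 p r x y t :
  in_box p r x y -> Rmin (snd p) y <= t <= Rmax (snd p) y -> in_box p r x t.
Proof.
intros [H1 H2] Ht; split; auto.
revert H2 Ht; unfold Rmin, Rmax, Rabs.
destruct (Rle_dec (snd p) y); repeat destruct Rcase_abs; lra.
Qed.

Lemma in_box_mid2 p r x y : in_box p r x y -> in_box p r x (snd p).
Proof.
intros H; apply (in_box_between2 p r x y); auto; unfold Rmin, Rmax;
  destruct (Rle_dec (snd p) y); lra.
Qed.

Lemma smooth_cont1 p r f x y :
  smooth_on p r f -> in_box p r x y -> continuous (fun z => f z y) x.
Proof.
intros Hf Hb; apply (ex_derive_continuous (fun z => f z y)), (smooth_ex1 p r); auto.
Qed.

Lemma smooth_cont2 p r f x y :
  smooth_on p r f -> in_box p r x y -> continuous (fun z => f x z) y.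
Proof.
intros Hf Hb; apply (ex_derive_continuous (fun z => f x z)), (smooth_ex2 p r); auto.
Qed.

(** The form is integrated from [p] along a horizontal and then a vertical segment. The vertical
    derivative is immediate. For the horizontal one, closedness turns the derivative under the
    integral into [dy g1], whose integral replaces [g1 x (snd p)] by [g1 x y]. *)
Lemma poincare p r g1 g2 :
  smooth_on p r g1 -> smooth_on p r g2 ->
  (forall x y, in_box p r x y -> dy g1 x y = dx g2 x y) ->
  exists f, smooth_on p r f /\
    forall x y, in_box p r x y -> dx f x y = g1 x y /\ dy f x y = g2 x y.
Proof.
intros H1 H2 Hc.
pose (f := fun x y => RInt (fun t => g1 t (snd p)) (fst p) x
                      + RInt (fun t => g2 x t) (snd p) y).
assert (I1 : forall x y, in_box p r x y ->
  ex_RInt (fun t => g1 t (snd p)) (fst p) x).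
{ intros x y Hb; apply (ex_RInt_continuous (V := R_CompleteNormedModule)); intros t Ht.
  apply (smooth_cont1 p r); auto.
  apply (in_box_between1 p r x); auto; apply (in_box_mid2 p r x y Hb). }
assert (I2 : forall x y, in_box p r x y -> ex_RInt (fun t => g2 x t) (snd p) y).
{ intros x y Hb; apply (ex_RInt_continuous (V := R_CompleteNormedModule)); intros t Ht.
  apply (smooth_cont2 p r); auto; apply (in_box_between2 p r x y); auto. }
assert (D1 : forall x y, in_box p r x y -> is_derive (fun z => f z y) x (g1 x y)).
{ intros x y Hb.
  assert (Ha : is_derive (fun z => RInt (fun t => g1 t (snd p)) (fst p) z) x (g1 x (snd p))).
  { apply (is_derive_RInt (fun t => g1 t (snd p)) _ (fst p)).
    - apply (filter_imp (fun z => in_box p r z y)); [|apply in_box_sect1, Hb].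
      intros z Hz; apply (RInt_correct (V := R_CompleteNormedModule)), (I1 z y Hz).
    - apply (smooth_cont1 p r); auto; apply (in_box_mid2 p r x y Hb). }
  assert (Hd : is_derive (fun z => RInt (fun t => g2 z t) (snd p) y) x
     (RInt (fun t => Derive (fun u => g2 u t) x) (snd p) y)).
  { apply is_derive_RInt_param.
    - apply (filter_imp (fun z => in_box p r z y)); [|apply in_box_sect1, Hb].
      intros z Hz t Ht; apply (smooth_ex1 p r); auto.
      apply (in_box_between2 p r z y); auto.
    - intros t Ht; apply (smooth_cont p r (dx g2)); [apply smooth_dx; auto|].
      apply (in_box_between2 p r x y); auto.
    - apply (filter_imp (fun z => in_box p r z y)); [|apply in_box_sect1, Hb].
      intros z Hz; apply I2; auto. }
  assert (E : RInt (fun t => Derive (fun u => g2 u t) x) (snd p) y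
    = g1 x y - g1 x (snd p)).
  { rewrite (RInt_ext _ (Derive (fun t => g1 x t))).
    - apply RInt_Derive.
      + intros t Ht; apply (smooth_ex2 p r); auto; apply (in_box_between2 p r x y); auto.
      + intros t Ht; apply (smooth_cont2 p r (dy g1)); [apply smooth_dy; auto|].
        apply (in_box_between2 p r x y); auto.
    - intros t Ht; symmetry; apply Hc, (in_box_between2 p r x y); auto; lra. }
  rewrite E in Hd.
  replace (g1 x y) with (g1 x (snd p) + (g1 x y - g1 x (snd p))) by ring.
  apply @is_derive_plus; assumption. }
assert (D2 : forall x y, in_box p r x y -> is_derive (fun z => f x z) y (g2 x y)).
{ intros x y Hb; unfold f.
  replace (g2 x y) with (0 + g2 x y) by ring.
  apply @is_derive_plus; [apply @is_derive_const|].
  apply (is_derive_RInt (fun t => g2 x t) _ (snd p)).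
  - apply (filter_imp (fun z => in_box p r x z)); [|apply in_box_sect2, Hb].
    intros z Hz; apply (RInt_correct (V := R_CompleteNormedModule)), (I2 x z Hz).
  - apply (smooth_cont2 p r); auto. }
exists f; split; [apply (smooth_of_partials p r f g1 g2); auto|].
intros x y Hb; split; apply is_derive_unique; auto.
Qed.

Definition jac (X Y : R -> R -> R) (x y : R) : R :=
  dx X x y * dy Y x y - dy X x y * dx Y x y.

(* The last four conditions say that the equation [E] reads
   [X' Y'' - Y' X'' = (X^2 / 2 + l) Y'^3] along parametrised curves. *)
Record normal_coordinates (E : equation) (p : R * R) (r : R)
    (X Y l K : R -> R -> R) : Prop := {
  nc_X : smooth_on p r X;
  nc_Y : smooth_on p r Y;
  nc_l : smooth_on p r l;
  nc_K : smooth_on p r K;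
  nc_jac : forall x y, in_box p r x y -> jac X Y x y <> 0;
  nc_dxl : forall x y, in_box p r x y -> dx l x y = K x y * dx Y x y;
  nc_dyl : forall x y, in_box p r x y -> dy l x y = K x y * dy Y x y;
  nc_P : forall x y, in_box p r x y ->
    dx X x y * dx (dx Y) x y - dx Y x y * dx (dx X) x y =
    - jac X Y x y * coefP E x y + (X x y ^ 2 / 2 + l x y) * dx Y x y ^ 3;
  nc_Q : forall x y, in_box p r x y ->
    2 * dx X x y * dy (dx Y) x y + dy X x y * dx (dx Y) x y
    - 2 * dx Y x y * dy (dx X) x y - dy Y x y * dx (dx X) x y =
    - 3 * jac X Y x y * coefQ E x y
    + 3 * (X x y ^ 2 / 2 + l x y) * dx Y x y ^ 2 * dy Y x y;
  nc_R : forall x y, in_box p r x y ->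
    dx X x y * dy (dy Y) x y + 2 * dy X x y * dy (dx Y) x y
    - dx Y x y * dy (dy X) x y - 2 * dy Y x y * dy (dx X) x y =
    - 3 * jac X Y x y * coefR E x y
    + 3 * (X x y ^ 2 / 2 + l x y) * dx Y x y * dy Y x y ^ 2;
  nc_S : forall x y, in_box p r x y ->
    dy X x y * dy (dy Y) x y - dy Y x y * dy (dy X) x y =
    - jac X Y x y * coefS E x y + (X x y ^ 2 / 2 + l x y) * dy Y x y ^ 3 }.

Lemma rho_rhos E p r k q x y :
  smooth_on p r (coefP E) -> smooth_on p r (coefQ E) ->
  smooth_on p r (coefR E) -> smooth_on p r (coefS E) ->
  smooth_on p r (phi1 E p) -> smooth_on p r (phi2 E p) -> in_box p r x y ->
  rho E p k q x y =
  match k, q with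
  | i1, i1 => rho11 (coefP E) (coefQ E) (coefR E) (coefS E) (phi1 E p) (phi2 E p) x y
  | i1, i2 => rho12 (coefQ E) (coefR E) (coefS E) (phi1 E p) (phi2 E p) x y
  | i2, i1 => rho21 (coefP E) (coefQ E) (coefR E) (phi1 E p) (phi2 E p) x y
  | i2, i2 => rho22 (coefP E) (coefQ E) (coefR E) (coefS E) (phi1 E p) (phi2 E p) x y
  end.
Proof.
intros HP HQ HR HS H1 H2 Hb.
destruct k, q; unfold rho, d, sum_index, Gam; expand_partials;
  unfold rho11, rho12, rho21, rho22, quad11, quad12, quad21; field.
Qed.

(** * The seventh case near a point *)

Lemma near_and p P1 P2 :
  near p P1 -> near p P2 -> near p (fun x y => P1 x y /\ P2 x y).
Proof.
rewrite !near_box; intros (r1 & H1 & H1') (r2 & H2 & H2').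
exists (Rmin r1 r2); split; [apply Rmin_glb_lt; auto|].
intros x y Hb; split; [apply H1'|apply H2'];
  apply (in_box_le p (Rmin r1 r2)); auto; [apply Rmin_l|apply Rmin_r].
Qed.

Lemma near_imp p (P1 P2 : R -> R -> Prop) :
  (forall x y, P1 x y -> P2 x y) -> near p P1 -> near p P2.
Proof. intros H [d Hd]; exists d; intros; apply H, Hd; auto. Qed.

Lemma near_neq0 p r f :
  0 < r -> smooth_on p r f -> f (fst p) (snd p) <> 0 -> near p (fun x y => f x y <> 0).
Proof.
intros Hr Hf Hn; apply continuity_2d_pt_neq_0; auto.
apply (smooth_cont p r); auto; apply in_box_center, Hr.
Qed.

Lemma smooth_qA E p r :
  smooth_on p r (coefP E) -> smooth_on p r (coefQ E) ->
  smooth_on p r (coefR E) -> smooth_on p r (coefS E) -> smooth_on p r (qA E).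
Proof. intros; unfold qA; smooth. Qed.

Lemma smooth_qB E p r :
  smooth_on p r (coefP E) -> smooth_on p r (coefQ E) ->
  smooth_on p r (coefR E) -> smooth_on p r (coefS E) -> smooth_on p r (qB E).
Proof. intros; unfold qB; smooth. Qed.

Lemma fifth_root_eq0 x : fifth_root x = 0 -> x = 0.
Proof. intros H; rewrite <- (fifth_root_spec x), H; ring. Qed.

(** The common outcome of the two branches of [select]: parallelism of [(A, B)], closedness of
    [phi], and the shape of the curvature. No later argument looks at the branches again. *)
Record seventh_on (E : equation) (p : R * R) (r : R) : Prop := {
  so_r : 0 < r;
  so_P : smooth_on p r (coefP E);
  so_Q : smooth_on p r (coefQ E);
  so_R : smooth_on p r (coefR E);
  so_S : smooth_on p r (coefS E);
  so_phi1 : smooth_on p r (phi1 E p);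
  so_phi2 : smooth_on p r (phi2 E p);
  so_Th : smooth_on p r (qTheta E p);
  so_AB : forall x y, in_box p r x y -> qA E x y <> 0 \/ qB E x y <> 0;
  so_dxA : forall x y, in_box p r x y -> dx (qA E) x y =
    coefQ E x y * qA E x y - coefP E x y * qB E x y - 5 / 3 * phi1 E p x y * qA E x y;
  so_dyA : forall x y, in_box p r x y -> dy (qA E) x y =
    coefR E x y * qA E x y - coefQ E x y * qB E x y - 1 / 3 * phi1 E p x y * qB E x y
    - 4 / 3 * phi2 E p x y * qA E x y;
  so_dxB : forall x y, in_box p r x y -> dx (qB E) x y =
    coefR E x y * qA E x y - coefQ E x y * qB E x y - 4 / 3 * phi1 E p x y * qB E x y
    - 1 / 3 * phi2 E p x y * qA E x y;
  so_dyB : forall x y, in_box p r x y -> dy (qB E) x y =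
    coefS E x y * qA E x y - coefR E x y * qB E x y - 5 / 3 * phi2 E p x y * qB E x y;
  so_phi : forall x y, in_box p r x y -> dy (phi1 E p) x y = dx (phi2 E p) x y;
  so_11 : forall x y, in_box p r x y ->
    rho E p i1 i1 x y = qTheta E p x y * qA E x y * qB E x y;
  so_12 : forall x y, in_box p r x y -> rho E p i1 i2 x y = qTheta E p x y * qB E x y ^ 2;
  so_21 : forall x y, in_box p r x y -> rho E p i2 i1 x y = - qTheta E p x y * qA E x y ^ 2 }.

Lemma smooth_rho E p r k q :
  smooth_on p r (coefP E) -> smooth_on p r (coefQ E) ->
  smooth_on p r (coefR E) -> smooth_on p r (coefS E) ->
  smooth_on p r (phi1 E p) -> smooth_on p r (phi2 E p) -> smooth_on p r (rho E p k q).
Proof.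
intros HP HQ HR HS H1 H2.
apply (smooth_ext p r (match k, q with
  | i1, i1 => rho11 (coefP E) (coefQ E) (coefR E) (coefS E) (phi1 E p) (phi2 E p)
  | i1, i2 => rho12 (coefQ E) (coefR E) (coefS E) (phi1 E p) (phi2 E p)
  | i2, i1 => rho21 (coefP E) (coefQ E) (coefR E) (phi1 E p) (phi2 E p)
  | i2, i2 => rho22 (coefP E) (coefQ E) (coefR E) (coefS E) (phi1 E p) (phi2 E p)
  end)).
- intros x y Hb; rewrite (rho_rhos E p r); auto; destruct k, q; reflexivity.
- destruct k, q; [unfold rho11|unfold rho12|unfold rho21|unfold rho22]; unfold quad11, quad12, quad21; smooth.
Qed.

(* At each point, one of the curvature equations implies the others. *)
Lemma seventh_on_intro E p r :
  0 < r -> smooth_on p r (coefP E) -> smooth_on p r (coefQ E) ->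
  smooth_on p r (coefR E) -> smooth_on p r (coefS E) ->
  smooth_on p r (phi1 E p) -> smooth_on p r (phi2 E p) -> smooth_on p r (qTheta E p) ->
  (forall x y, in_box p r x y ->
    (qA E x y <> 0 /\ rho E p i2 i1 x y = - qTheta E p x y * qA E x y ^ 2) \/
    (qB E x y <> 0 /\ rho E p i1 i2 x y = qTheta E p x y * qB E x y ^ 2)) ->
  (forall x y, in_box p r x y -> dx (qA E) x y =
    coefQ E x y * qA E x y - coefP E x y * qB E x y - 5 / 3 * phi1 E p x y * qA E x y) ->
  (forall x y, in_box p r x y -> dy (qA E) x y =
    coefR E x y * qA E x y - coefQ E x y * qB E x y - 1 / 3 * phi1 E p x y * qB E x y
    - 4 / 3 * phi2 E p x y * qA E x y) ->
  (forall x y, in_box p r x y -> dx (qB E) x y =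
    coefR E x y * qA E x y - coefQ E x y * qB E x y - 4 / 3 * phi1 E p x y * qB E x y
    - 1 / 3 * phi2 E p x y * qA E x y) ->
  (forall x y, in_box p r x y -> dy (qB E) x y =
    coefS E x y * qA E x y - coefR E x y * qB E x y - 5 / 3 * phi2 E p x y * qB E x y) ->
  (forall x y, in_box p r x y -> dy (phi1 E p) x y = dx (phi2 E p) x y) ->
  seventh_on E p r.
Proof.
intros Hr sP sQ sR sS s1 s2 sTh Hcase dA1 dA2 dB1 dB2 HO.
pose proof (smooth_qA _ _ _ sP sQ sR sS) as sA.
pose proof (smooth_qB _ _ _ sP sQ sR sS) as sB.
assert (Hrho : forall x y, in_box p r x y ->
  rho E p i1 i1 x y = qTheta E p x y * qA E x y * qB E x y /\
  rho E p i1 i2 x y = qTheta E p x y * qB E x y ^ 2 /\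
  rho E p i2 i1 x y = - qTheta E p x y * qA E x y ^ 2).
{ intros x y Hb.
  pose proof (rho_col1 p r (coefP E) (coefQ E) (coefR E) (coefS E) (qA E) (qB E)
    (phi1 E p) (phi2 E p) sP sQ sR sA sB s1 s2 dA1 dA2 dB1 dB2 HO x y Hb) as H1.
  pose proof (rho_col2 p r (coefP E) (coefQ E) (coefR E) (coefS E) (qA E) (qB E)
    (phi1 E p) (phi2 E p) sQ sR sS sA sB s1 s2 dA1 dA2 dB1 dB2 HO x y Hb) as H2.
  rewrite (rho_trace p r) in H2 by auto; specialize (Hcase x y Hb).
  rewrite !(rho_rhos E p r) in * by auto.
  destruct Hcase as [(Hn & E0)|(Hn & E0)]; rewrite E0 in *.
  - assert (E1 : rho11 (coefP E) (coefQ E) (coefR E) (coefS E) (phi1 E p) (phi2 E p) x y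
      = qTheta E p x y * qA E x y * qB E x y) by (apply (Rmult_eq_reg_r (qA E x y)); auto; lra).
    rewrite E1 in *; split; [reflexivity|split; [|reflexivity]].
    apply (Rmult_eq_reg_r (qA E x y)); auto; lra.
  - assert (E1 : rho11 (coefP E) (coefQ E) (coefR E) (coefS E) (phi1 E p) (phi2 E p) x y
      = qTheta E p x y * qA E x y * qB E x y) by (apply (Rmult_eq_reg_r (qB E x y)); auto; lra).
    rewrite E1 in *; split; [reflexivity|split; [reflexivity|]].
    apply (Rmult_eq_reg_r (qB E x y)); auto; lra. }
constructor; auto; intros x y Hb; try apply (Hrho x y Hb).
destruct (Hcase x y Hb) as [(Hn & _)|(Hn & _)]; auto.
Qed.

(** Four conditions give the four first derivatives of [A] and [B]. For [A <> 0], the definition of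
    [phi1] is the equation for [dx A], the condition [H = 0] together with [phi1] and [phi2] yields
    [dy A] and [dx B], and [F = 0] yields [dy B]. For [B <> 0] the coordinates exchange roles, with
    [G] in place of [H]. *)
Lemma seventh_case_on E p :
  smooth_equation E p -> seventh_case E p -> exists r, seventh_on E p r.
Proof.
intros (HP & HQ & HR & HS) (Hab & HF & HN & HO); unfold qOmega in HO.
assert (Hsm : exists r, 0 < r /\ smooth_on p r (coefP E) /\ smooth_on p r (coefQ E) /\
  smooth_on p r (coefR E) /\ smooth_on p r (coefS E)).
{ assert (H := near_and _ _ _ (near_and _ _ _ HP HQ) (near_and _ _ _ HR HS)).
  apply near_box in H; destruct H as (r & Hr & H); exists r.
  repeat split; auto; intros n x y Hb; apply (H x y Hb). }
destruct Hsm as (r0 & Hr0 & sP & sQ & sR & sS).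
assert (Hn0 : near p (fun x y =>
  if Req_dec_T (qB E (fst p) (snd p)) 0 then qA E x y <> 0 else qB E x y <> 0)).
{ destruct (Req_dec_T (qB E (fst p) (snd p)) 0) as [HB|HB];
    apply (near_neq0 p r0); auto; [apply smooth_qA; auto| |apply smooth_qB; auto].
  intros HA; apply Hab; rewrite HA, HB; reflexivity. }
destruct (proj1 (near_box p _) (near_and _ _ _ Hn0 (near_and _ _ _ HF (near_and _ _ _ HN HO))))
  as (r1 & Hr1 & H1).
set (r := Rmin r0 r1).
assert (Hr : 0 < r) by (apply Rmin_glb_lt; auto).
assert (H2 : forall x y, in_box p r x y -> in_box p r1 x y)
  by (intros; apply (in_box_le p r); auto; apply Rmin_r).
assert (Hle : r <= r0) by apply Rmin_l.
apply (smooth_on_le p r0 r) in sP, sQ, sR, sS; auto.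
pose proof (smooth_qA _ _ _ sP sQ sR sS) as sA.
pose proof (smooth_qB _ _ _ sP sQ sR sS) as sB.
assert (HF5 : forall x y, in_box p r x y ->
      qA E x y * qB E x y * dy (qA E) x y + qB E x y * qA E x y * dx (qB E) x y
       - qA E x y ^ 2 * dy (qB E) x y - qB E x y ^ 2 * dx (qA E) x y
       - coefP E x y * qB E x y ^ 3 + 3 * coefQ E x y * qA E x y * qB E x y ^ 2
       - 3 * coefR E x y * qA E x y ^ 2 * qB E x y + coefS E x y * qA E x y ^ 3 = 0)
  by (intros x y Hb; apply fifth_root_eq0, (H1 x y (H2 x y Hb))).
assert (HO' : forall x y, in_box p r x y -> dy (phi1 E p) x y = dx (phi2 E p) x y)
  by (intros x y Hb; destruct (H1 x y (H2 x y Hb)) as (_ & _ & _ & H3); lra).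
assert (Hsel : forall fB fA, select E p fB fA =
    if Req_dec_T (qB E (fst p) (snd p)) 0 then fA else fB) by reflexivity.
exists r; destruct (Req_dec_T (qB E (fst p) (snd p)) 0) as [HB|HB].
- assert (nA : forall x y, in_box p r x y -> qA E x y <> 0)
    by (intros x y Hb; apply (H1 x y (H2 x y Hb))).
  assert (s1 : smooth_on p r (phi1 E p)).
  { unfold phi1; rewrite Hsel; smooth; intros x y Hb; pose proof (nA x y Hb);
     repeat apply Rmult_integral_contrapositive_currified; auto; lra. }
  assert (s2 : smooth_on p r (phi2 E p)).
  { unfold phi2; rewrite Hsel; smooth; intros x y Hb; pose proof (nA x y Hb);
     repeat apply Rmult_integral_contrapositive_currified; auto; lra. }
  pose proof (smooth_rho E p r i2 i1 sP sQ sR sS s1 s2).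
  assert (HH : forall x y, in_box p r x y -> qH E x y / qA E x y = 0).
  { intros x y Hb; destruct (H1 x y (H2 x y Hb)) as (_ & _ & H3 & _).
    unfold qN in H3; rewrite Hsel in H3.
    replace (qH E x y / qA E x y) with (-3 * - (qH E x y / (3 * qA E x y))) by (field; auto).
    rewrite H3; ring. }
  apply seventh_on_intro; auto; try (intros x y Hb; pose proof (nA x y Hb)).
  + unfold qTheta; rewrite Hsel; unfold omega1; rewrite Hsel; smooth; auto.
  + left; split; [auto|]; unfold qTheta; rewrite Hsel; unfold omega1; rewrite Hsel; field; auto.
  + unfold phi1; rewrite Hsel; field; auto.
  (* The equations for [dy A] and [dx B] fail by a fifth of [H / A], with opposite signs, so [N = 0]
     settles both. *)
  + apply Rminus_diag_uniq; transitivity (- (1 / 5) * (qH E x y / qA E x y));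
      [|rewrite HH by auto; ring].
    unfold phi1, phi2, qH; rewrite !Hsel; field; auto.
  + apply Rminus_diag_uniq; transitivity ((1 / 5) * (qH E x y / qA E x y));
      [|rewrite HH by auto; ring].
    unfold phi1, phi2, qH; rewrite !Hsel; field; auto.
  + apply Rminus_diag_uniq; match type of (HF5 x y Hb) with ?F = 0 =>
      transitivity (- F / qA E x y ^ 2); [|rewrite HF5 by auto; field; auto] end.
    unfold phi2; rewrite Hsel; field; auto.
- assert (nB : forall x y, in_box p r x y -> qB E x y <> 0)
    by (intros x y Hb; apply (H1 x y (H2 x y Hb))).
  assert (s1 : smooth_on p r (phi1 E p)).
  { unfold phi1; rewrite Hsel; smooth; intros x y Hb; pose proof (nB x y Hb);
     repeat apply Rmult_integral_contrapositive_currified; auto; lra. }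
  assert (s2 : smooth_on p r (phi2 E p)).
  { unfold phi2; rewrite Hsel; smooth; intros x y Hb; pose proof (nB x y Hb);
     repeat apply Rmult_integral_contrapositive_currified; auto; lra. }
  pose proof (smooth_rho E p r i1 i2 sP sQ sR sS s1 s2).
  assert (HG : forall x y, in_box p r x y -> qG E x y / qB E x y = 0).
  { intros x y Hb; destruct (H1 x y (H2 x y Hb)) as (_ & _ & H3 & _).
    unfold qN in H3; rewrite Hsel in H3.
    replace (qG E x y / qB E x y) with (3 * (qG E x y / (3 * qB E x y))) by (field; auto).
    rewrite H3; ring. }
  apply seventh_on_intro; auto; try (intros x y Hb; pose proof (nB x y Hb)).
  + unfold qTheta; rewrite Hsel; unfold omega2; rewrite Hsel; smooth; auto.
  + right; split; [auto|]; unfold qTheta; rewrite Hsel; unfold omega2; rewrite Hsel; field; auto.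
  + apply Rminus_diag_uniq; match type of (HF5 x y Hb) with ?F = 0 =>
      transitivity (- F / qB E x y ^ 2); [|rewrite HF5 by auto; field; auto] end.
    unfold phi1; rewrite Hsel; field; auto.
  + apply Rminus_diag_uniq; transitivity ((1 / 5) * (qG E x y / qB E x y));
      [|rewrite HG by auto; ring].
    unfold phi1, phi2, qG; rewrite !Hsel; field; auto.
  + apply Rminus_diag_uniq; transitivity (- (1 / 5) * (qG E x y / qB E x y));
      [|rewrite HG by auto; ring].
    unfold phi1, phi2, qG; rewrite !Hsel; field; auto.
  + unfold phi2; rewrite Hsel; field; auto.
Qed.

(** * Normal coordinates *)

(* [f] is a potential of [phi], so that multiplication by [exp (m f)] turns a
   pseudotensor of weight [-m] into a tensor; [X] is the rescaled [Theta], and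
   [dY] the rescaled covector [(A, B)]. *)
Lemma exists_normal_coordinates E p :
  smooth_equation E p -> seventh_case E p ->
  exists r X Y l K e, 0 < r /\ normal_coordinates E p r X Y l K /\
    forall x y, in_box p r x y -> 0 < e x y /\
      qL E p x y = e x y ^ 4 * l x y /\ nabla_theta_L E p x y = - e x y ^ 5 * K x y.
Proof.
intros HE H7; destruct (seventh_case_on E p HE H7) as (r & H).
destruct H as [Hr sP sQ sR sS s1 s2 sTh nAB dA1 dA2 dB1 dB2 HO R11 R12 R21].
pose proof (smooth_qA _ _ _ sP sQ sR sS) as sA.
pose proof (smooth_qB _ _ _ sP sQ sR sS) as sB.
assert (R11' : forall x y, in_box p r x y ->
  rho11 (coefP E) (coefQ E) (coefR E) (coefS E) (phi1 E p) (phi2 E p) x y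
  = qTheta E p x y * qA E x y * qB E x y)
  by (intros; rewrite <- R11, (rho_rhos E p r) by auto; auto).
assert (R12' : forall x y, in_box p r x y ->
  rho12 (coefQ E) (coefR E) (coefS E) (phi1 E p) (phi2 E p) x y
  = qTheta E p x y * qB E x y ^ 2)
  by (intros; rewrite <- R12, (rho_rhos E p r) by auto; auto).
assert (R21' : forall x y, in_box p r x y ->
  rho21 (coefP E) (coefQ E) (coefR E) (phi1 E p) (phi2 E p) x y
  = - qTheta E p x y * qA E x y ^ 2)
  by (intros; rewrite <- R21, (rho_rhos E p r) by auto; auto).
assert (Z1 : forall x y, qL E p x y = Lc (coefP E) (coefQ E) (coefR E) (coefS E) 
   (phi1 E p) (phi2 E p) (qTheta E p) x y).
{ intros x y; unfold qL, Lc, qZ, Zc.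
  assert (Ha : dx (theta_upper E p i2) x y = - dx (th1 (phi1 E p) (qTheta E p)) x y)
    by apply Derive_opp.
  assert (Hb : dy (theta_upper E p i2) x y = - dy (th1 (phi1 E p) (qTheta E p)) x y)
    by apply Derive_opp.
  rewrite Ha, Hb.
  change (dx (theta_upper E p i1) x y) with (dx (th2 (phi2 E p) (qTheta E p)) x y).
  change (dy (theta_upper E p i1) x y) with (dy (th2 (phi2 E p) (qTheta E p)) x y).
  change (theta_upper E p i1 x y) with (th2 (phi2 E p) (qTheta E p) x y).
  change (theta_upper E p i2 x y) with (- th1 (phi1 E p) (qTheta E p) x y).
  ring. }
assert (Z2 : forall x y, dx (qL E p) x y = dx (Lc (coefP E) (coefQ E) (coefR E) (coefS E) 
   (phi1 E p) (phi2 E p) (qTheta E p)) x y) by (intros; apply Derive_ext; auto).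
assert (Z3 : forall x y, dy (qL E p) x y = dy (Lc (coefP E) (coefQ E) (coefR E) (coefS E) 
   (phi1 E p) (phi2 E p) (qTheta E p)) x y) by (intros; apply Derive_ext; auto).
(* The last two arguments are [defA] and [defB], which hold by computation because [qA] and [qB] are
   defined by these formulas. *)
assert (Hta := theta_alpha p r (coefP E) (coefQ E) (coefR E) (coefS E) (qA E) (qB E)
  (phi1 E p) (phi2 E p) (qTheta E p) sP sQ sR sS sA sB s1 s2 sTh nAB dA1 dA2 dB1 dB2 HO
  R11' R12' R21' (fun x y _ => eq_refl) (fun x y _ => eq_refl)).
assert (HaL := alpha_L p r (coefP E) (coefQ E) (coefR E) (coefS E) (qA E) (qB E)
  (phi1 E p) (phi2 E p) (qTheta E p) sP sQ sR sS sA sB s1 s2 sTh nAB dA1 dA2 dB1 dB2 HO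
  R11' R12' R21' (fun x y _ => eq_refl) (fun x y _ => eq_refl)).
assert (Hdth := dth p r (coefP E) (coefQ E) (coefR E) (coefS E) (qA E) (qB E)
  (phi1 E p) (phi2 E p) (qTheta E p) sP sQ sR sS sA sB s1 s2 sTh nAB dA1 dA2 dB1 dB2 HO
  R11' R12' R21' (fun x y _ => eq_refl) (fun x y _ => eq_refl)).
assert (sL := smooth_Lc p r (coefP E) (coefQ E) (coefR E) (coefS E) 
  (phi1 E p) (phi2 E p) (qTheta E p) sP sQ sR sS s1 s2 sTh).
assert (st1 := smooth_th1 p r _ _ s1 sTh).
assert (st2 := smooth_th2 p r _ _ s2 sTh).
assert (Hnab : forall x y, nabla_theta_L E p x y =
   th2 (phi2 E p) (qTheta E p) x y * (dx (qL E p) x y - 4 * phi1 E p x y * qL E p x y)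
   - th1 (phi1 E p) (qTheta E p) x y * (dy (qL E p) x y - 4 * phi2 E p x y * qL E p x y)).
{ intros x y; unfold nabla_theta_L.
  change (theta_upper E p i1 x y) with (th2 (phi2 E p) (qTheta E p) x y).
  change (theta_upper E p i2 x y) with (- th1 (phi1 E p) (qTheta E p) x y).
  ring. }
assert (HZL : forall x y, Zc (coefP E) (coefQ E) (coefR E) (coefS E) 
   (phi1 E p) (phi2 E p) (qTheta E p) x y = Lc (coefP E) (coefQ E) (coefR E) (coefS E) 
   (phi1 E p) (phi2 E p) (qTheta E p) x y + 1 / 2 * qTheta E p x y ^ 2)
  by (intros; unfold Lc; ring).
set (P := coefP E) in *; set (Q := coefQ E) in *; set (RR := coefR E) in *;
set (S := coefS E) in *; set (A := qA E) in *; set (B := qB E) in *;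
set (f1 := phi1 E p) in *; set (f2 := phi2 E p) in *; set (Th := qTheta E p) in *.
set (L := Lc P Q RR S f1 f2 Th) in *; set (Z := Zc P Q RR S f1 f2 Th) in *.
assert (dT1 : forall x y, dx Th x y = th1 f1 Th x y + 2 * f1 x y * Th x y)
  by (intros; unfold th1; ring).
assert (dT2 : forall x y, dy Th x y = th2 f2 Th x y + 2 * f2 x y * Th x y)
  by (intros; unfold th2; ring).
set (t1 := th1 f1 Th) in *; set (t2 := th2 f2 Th) in *.
clearbody A B f1 f2 Th L Z t1 t2.
destruct (poincare p r f1 f2 s1 s2 HO) as (f & sf & Hf).
assert (df1 : forall x y, in_box p r x y -> dx f x y = f1 x y) by apply Hf.
assert (df2 : forall x y, in_box p r x y -> dy f x y = f2 x y) by apply Hf.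
(* The weight of [(A, B)] cancels against the exponential: both cross derivatives equal [exp f]
   times [R A - Q B - (f1 B + f2 A) / 3]. *)
assert (HY : exists Y, smooth_on p r Y /\ forall x y, in_box p r x y ->
  dx Y x y = exp (f x y) * A x y /\ dy Y x y = exp (f x y) * B x y).
{ apply poincare; try smooth; intros x y Hb.
  expand_partials; rewrite df1, df2, dA2, dB1 by auto; field. }
destruct HY as (Y & sY & HY).
assert (dY1 : forall x y, in_box p r x y -> dx Y x y = exp (f x y) * A x y) by apply HY.
assert (dY2 : forall x y, in_box p r x y -> dy Y x y = exp (f x y) * B x y) by apply HY.
(* All exponentials are expressed through [w = exp (- f)], which is made opaque later, so that
   [field] sees rational functions with the single condition [w <> 0]. *)
assert (Hew : forall x y, exp (f x y) = / exp (- f x y)) by (intros; rewrite exp_Ropp, Rinv_inv; auto).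
assert (sw : smooth_on p r (fun x y => exp (- f x y))) by smooth.
pose (w := fun x y => exp (- f x y)); fold w in sw.
change (forall x y, exp (f x y) = / w x y) in Hew.
assert (nw : forall x y, w x y <> 0) by (intros; apply Rgt_not_eq, exp_pos).
assert (dw1 : forall x y, in_box p r x y -> dx w x y = - f1 x y * w x y).
{ intros x y Hb; rewrite <- df1 by auto; unfold w; expand_partials; ring. }
assert (dw2 : forall x y, in_box p r x y -> dy w x y = - f2 x y * w x y).
{ intros x y Hb; rewrite <- df2 by auto; unfold w; expand_partials; ring. }
assert (dYxx : forall x y, in_box p r x y -> dx (dx Y) x y = (f1 x y * A x y + dx A x y) / w x y).
{ intros x y Hb; rewrite (dx_eq p r _ _ dY1 x y Hb); expand_partials.
  rewrite df1, Hew by auto; field; apply nw. }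
assert (dYxy : forall x y, in_box p r x y -> dy (dx Y) x y = (f2 x y * A x y + dy A x y) / w x y).
{ intros x y Hb; rewrite (dy_eq p r _ _ dY1 x y Hb); expand_partials.
  rewrite df2, Hew by auto; field; apply nw. }
assert (dYyy : forall x y, in_box p r x y -> dy (dy Y) x y = (f2 x y * B x y + dy B x y) / w x y).
{ intros x y Hb; rewrite (dy_eq p r _ _ dY2 x y Hb); expand_partials.
  rewrite df2, Hew by auto; field; apply nw. }
clearbody w.
set (X := fun x y => Th x y * w x y ^ 2).
assert (sX : smooth_on p r X) by (unfold X; smooth).
assert (dX1 : forall x y, in_box p r x y -> dx X x y = t1 x y * w x y ^ 2).
{ intros x y Hb; unfold X; expand_partials; rewrite dT1, dw1 by auto; ring. }
assert (dX2 : forall x y, in_box p r x y -> dy X x y = t2 x y * w x y ^ 2).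
{ intros x y Hb; unfold X; expand_partials; rewrite dT2, dw2 by auto; ring. }
assert (dXxx : forall x y, in_box p r x y -> dx (dx X) x y = (dx t1 x y - 2 * f1 x y * t1 x y) * w x y ^ 2).
{ intros x y Hb; rewrite (dx_eq p r _ _ dX1 x y Hb); expand_partials; rewrite dw1 by auto; ring. }
assert (dXxy : forall x y, in_box p r x y -> dy (dx X) x y = (dy t1 x y - 2 * f2 x y * t1 x y) * w x y ^ 2).
{ intros x y Hb; rewrite (dy_eq p r _ _ dX1 x y Hb); expand_partials; rewrite dw2 by auto; ring. }
assert (dXyy : forall x y, in_box p r x y -> dy (dy X) x y = (dy t2 x y - 2 * f2 x y * t2 x y) * w x y ^ 2).
{ intros x y Hb; rewrite (dy_eq p r _ _ dX2 x y Hb); expand_partials; rewrite dw2 by auto; ring. }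
set (l := fun x y => w x y ^ 4 * L x y).
assert (sl : smooth_on p r l) by (unfold l; smooth).
(* By [alpha_L] the weighted gradient of [L] is a multiple of [a]. Contraction with [theta] reads
   off the factor, which is minus [nabla_theta_L]; the power of [w] removes the weight. *)
set (K := fun x y => w x y ^ 5 *
   (t1 x y * (dy L x y - 4 * f2 x y * L x y) - t2 x y * (dx L x y - 4 * f1 x y * L x y))).
assert (sK : smooth_on p r K) by (unfold K; smooth).
assert (HJ : forall x y, in_box p r x y -> jac X Y x y = w x y).
{ intros x y Hb; unfold jac; rewrite dX1, dX2, dY1, dY2, !Hew by auto.
  transitivity (w x y * (t1 x y * B x y - t2 x y * A x y)); [field; auto|].
  rewrite Hta by auto; ring. }
(* This is the origin of [X^2 / 2] in the normal equation: [Z] exceeds [L] by half the square of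
   [Th], and [X] is [Th] rescaled. *)
assert (Hz : forall x y, X x y ^ 2 / 2 + l x y = w x y ^ 4 * Z x y).
{ intros x y; rewrite HZL; unfold X, l; field. }
exists r, X, Y, l, K, (fun x y => exp (f x y)); split; [exact Hr|split].
- constructor; auto; intros x y Hb.
  + rewrite HJ; auto.
  + unfold l; expand_partials; rewrite dw1, dY1, Hew by auto.
    transitivity (w x y ^ 4 * (t1 x y * B x y - t2 x y * A x y) * (dx L x y - 4 * f1 x y * L x y));
      [rewrite Hta by auto; ring|].
    apply Rminus_diag_uniq; unfold K.
    transitivity (w x y ^ 4 * t1 x y * (B x y * (dx L x y - 4 * f1 x y * L x y) -
      A x y * (dy L x y - 4 * f2 x y * L x y))); [field; auto|rewrite HaL by auto; ring].
  + unfold l; expand_partials; rewrite dw2, dY2, Hew by auto.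
    transitivity (w x y ^ 4 * (t1 x y * B x y - t2 x y * A x y) * (dy L x y - 4 * f2 x y * L x y));
      [rewrite Hta by auto; ring|].
    apply Rminus_diag_uniq; unfold K.
    transitivity (w x y ^ 4 * t2 x y * (B x y * (dx L x y - 4 * f1 x y * L x y) -
      A x y * (dy L x y - 4 * f2 x y * L x y))); [field; auto|rewrite HaL by auto; ring].
  (* In each of the four coefficient identities the two sides differ by a multiple of
     [1 - (t1 B - t2 A)], which [theta_alpha] makes 0. *)
  + destruct (Hdth x y Hb) as (Ha1 & Ha2 & Ha3 & Ha4).
    rewrite Hz, dXxx, dYxx, HJ, dX1, dY1, Ha1, dA1, Hew by auto; fold P.
    apply Rminus_diag_uniq.
    transitivity (w x y * P x y * (1 - (t1 x y * B x y - t2 x y * A x y)));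
      [field; auto|rewrite Hta by auto; ring].
  + destruct (Hdth x y Hb) as (Ha1 & Ha2 & Ha3 & Ha4).
    rewrite Hz, dXxx, dXxy, dYxx, dYxy, HJ, dX1, dX2, dY1, dY2, Ha1, Ha2, dA1, dA2, Hew by auto; fold Q.
    apply Rminus_diag_uniq.
    transitivity (3 * w x y * Q x y * (1 - (t1 x y * B x y - t2 x y * A x y)));
      [field; auto|rewrite Hta by auto; ring].
  + destruct (Hdth x y Hb) as (Ha1 & Ha2 & Ha3 & Ha4).
    rewrite Hz, dXyy, dXxy, dYyy, dYxy, HJ, dX1, dX2, dY1, dY2, Ha2, Ha4, dB2, dA2, Hew by auto; fold RR.
    apply Rminus_diag_uniq.
    transitivity (3 * w x y * RR x y * (1 - (t1 x y * B x y - t2 x y * A x y)));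
      [field; auto|rewrite Hta by auto; ring].
  + destruct (Hdth x y Hb) as (Ha1 & Ha2 & Ha3 & Ha4).
    rewrite Hz, dXyy, dYyy, HJ, dX2, dY2, Ha4, dB2, Hew by auto; fold S.
    apply Rminus_diag_uniq.
    transitivity (w x y * S x y * (1 - (t1 x y * B x y - t2 x y * A x y)));
      [field; auto|rewrite Hta by auto; ring].
- intros x y Hb; split; [apply exp_pos|split].
  + rewrite Hew; unfold l; rewrite Z1; field; auto.
  + rewrite Hnab, Hew, Z1, Z2, Z3; unfold K; field; auto.
Qed.

(** * Implicit and inverse functions *)

Lemma Rabs_comb_le a b x y N :
  Rabs a <= N -> Rabs b <= N -> Rabs (a * x - b * y) <= N * (Rabs x + Rabs y).
Proof.
intros Ha Hb; unfold Rminus.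
eapply Rle_trans; [apply Rabs_triang|].
rewrite Rabs_Ropp, !Rabs_mult, Rmult_plus_distr_l.
apply Rplus_le_compat; apply Rmult_le_compat_r; auto; apply Rabs_pos.
Qed.

Section ImplicitDerive.
Variables (X Y : R -> R -> R) (u v : R -> R) (t0 lx ly mx my a b : R).
Hypotheses (dX : differentiable_pt_lim X (u t0) (v t0) lx ly)
  (dY : differentiable_pt_lim Y (u t0) (v t0) mx my)
  (HJ : lx * my - ly * mx <> 0)
  (cu : continuous u t0) (cv : continuous v t0)
  (da : is_derive (fun t => X (u t) (v t)) t0 a)
  (db : is_derive (fun t => Y (u t) (v t)) t0 b).

(** In the linearised system the remainders are small relative to [m], the larger of the two
    increments, which is not yet known to be of order [h]. A first use of the estimate gives
    [m <= 2 * c * M * Rabs h], and a second one gives the derivative. *)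
Lemma implicit_derive_small (eps : R) : 0 < eps ->
  exists d : posreal, forall h, h <> 0 -> Rabs h < d ->
    Rabs ((u (t0 + h) - u t0) / h - (my * a - ly * b) / (lx * my - ly * mx)) < eps /\
    Rabs ((v (t0 + h) - v t0) / h - (lx * b - mx * a) / (lx * my - ly * mx)) < eps.
Proof.
intros Heps.
set (J := lx * my - ly * mx) in *.
set (N := Rabs lx + Rabs ly + Rabs mx + Rabs my).
pose proof (Rabs_pos lx); pose proof (Rabs_pos ly); pose proof (Rabs_pos mx);
pose proof (Rabs_pos my).
assert (HN : 0 <= N) by (unfold N; lra).
assert (Hlx : Rabs lx <= N) by (unfold N; lra).
assert (Hly : Rabs ly <= N) by (unfold N; lra).
assert (Hmx : Rabs mx <= N) by (unfold N; lra).
assert (Hmy : Rabs my <= N) by (unfold N; lra).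
assert (Hj : 0 < / Rabs J) by (apply Rinv_0_lt_compat, Rabs_pos_lt, HJ).
set (c := N * / Rabs J).
assert (Hc : 0 <= c) by (apply Rmult_le_pos; lra).
set (M := Rabs a + Rabs b + 2).
assert (HM : 0 < M) by (pose proof (Rabs_pos a); pose proof (Rabs_pos b); unfold M; lra).
(* The first bound absorbs half of [m] in the proof of [Hm]; the second makes the remaining error at
   most [eps / 2 * Rabs h] in [F]. *)
assert (He1 : exists e1, 0 < e1 /\ 2 * c * e1 <= 1 / 2 /\ 2 * c * e1 * (2 * c * M) <= eps / 2).
{ assert (Hk : 0 < 4 * (c + 1) * (1 + 2 * c * M / eps)).
  { assert (0 <= 2 * c * M / eps) by (apply Rmult_le_pos; [|apply Rlt_le, Rinv_0_lt_compat; lra];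
      repeat apply Rmult_le_pos; lra). nra. }
  exists (/ (4 * (c + 1) * (1 + 2 * c * M / eps))); split; [apply Rinv_0_lt_compat, Hk|].
  assert (Hw0 : 0 <= 2 * c * M / eps) by (apply Rmult_le_pos; [|apply Rlt_le, Rinv_0_lt_compat; lra];
      repeat apply Rmult_le_pos; lra).
  set (w := 2 * c * M / eps) in *.
  assert (Ew : 2 * c * M = w * eps) by (unfold w; field; lra).
  rewrite Ew; split.
  - apply (Rmult_le_reg_r _ _ _ Hk); rewrite Rmult_assoc, Rinv_l by lra; nra.
  - apply (Rmult_le_reg_r _ _ _ Hk).
    replace (2 * c * / (4 * (c + 1) * (1 + w)) * (w * eps) * (4 * (c + 1) * (1 + w)))
      with (2 * c * (w * eps)) by (field; split; lra).
    assert (0 <= w * eps) by nra.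
    assert (0 <= c * (w * eps)) by nra. nra. }
destruct He1 as (e1 & He1 & Hc1 & Hc2).
assert (He2 : exists e2, 0 < e2 /\ e2 <= 1 /\ 2 * c * e2 < eps / 2).
{ exists (Rmin 1 (eps / (4 * (c + 1)) / 2)); split; [|split].
  - abs_lra.
  - apply Rmin_l.
  - eapply Rle_lt_trans; [apply Rmult_le_compat_l; [lra|apply Rmin_r]|].
    replace (2 * c * (eps / (4 * (c + 1)) / 2)) with (eps / 4 * (c / (c + 1))) by (field; lra).
    assert (c / (c + 1) <= 1) by (apply Rle_div_l; lra). nra. }
destruct He2 as (e2 & He2 & He21 & Hc3).
destruct (dX (mkposreal e1 He1)) as (d1 & Hd1); destruct (dY (mkposreal e1 He1)) as (d2 & Hd2).
simpl in Hd1, Hd2.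
apply is_derive_Reals in da; apply is_derive_Reals in db.
destruct (da e2 He2) as (d3 & Hd3); destruct (db e2 He2) as (d4 & Hd4).
set (d := mkposreal _ (Rmin_stable_in_posreal d1 d2)).
destruct (proj1 (filterlim_locally _ _) cu d) as (d5 & Hd5).
destruct (proj1 (filterlim_locally _ _) cv d) as (d6 & Hd6).
set (dd := mkposreal _ (Rmin_stable_in_posreal (mkposreal _ (Rmin_stable_in_posreal d3 d4))
  (mkposreal _ (Rmin_stable_in_posreal d5 d6)))).
exists dd; intros h Hh Hhd.
assert (Hh3 : Rabs h < d3 /\ Rabs h < d4 /\ Rabs h < d5 /\ Rabs h < d6).
{ simpl in Hhd; unfold Rmin in Hhd; repeat destruct Rle_dec; repeat split; lra. }
destruct Hh3 as (Hh3 & Hh4 & Hh5 & Hh6).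
specialize (Hd3 h Hh Hh3); specialize (Hd4 h Hh Hh4).
assert (Hbu : Rabs (u (t0 + h) - u t0) < d).
{ apply (Hd5 (t0 + h)); unfold ball; simpl; unfold AbsRing_ball, abs, minus, plus, opp; simpl.
  abs_lra. }
assert (Hbv : Rabs (v (t0 + h) - v t0) < d).
{ apply (Hd6 (t0 + h)); unfold ball; simpl; unfold AbsRing_ball, abs, minus, plus, opp; simpl.
  abs_lra. }
assert (Hdd : d <= d1 /\ d <= d2) by (split; [apply Rmin_l|apply Rmin_r]).
destruct Hdd as (Hdd1 & Hdd2).
specialize (Hd1 (u (t0 + h)) (v (t0 + h))); specialize (Hd2 (u (t0 + h)) (v (t0 + h))).
assert (Hx1 := Hd1 ltac:(lra) ltac:(lra)); assert (Hx2 := Hd2 ltac:(lra) ltac:(lra)).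
clear Hd1 Hd2 Hd5 Hd6 Hbu Hbv.
set (du := u (t0 + h) - u t0) in *; set (dv := v (t0 + h) - v t0) in *.
set (m := Rmax (Rabs du) (Rabs dv)) in *.
set (DA := X (u (t0 + h)) (v (t0 + h)) - X (u t0) (v t0)) in *.
set (DB := Y (u (t0 + h)) (v (t0 + h)) - Y (u t0) (v t0)) in *.
assert (Hhp : 0 < Rabs h) by (apply Rabs_pos_lt; auto).
assert (E1 : exists q1, DA = lx * du + ly * dv + q1 /\ Rabs q1 <= e1 * m)
  by (exists (DA - (lx * du + ly * dv)); split; [ring|exact Hx1]).
assert (E2 : exists q2, DB = mx * du + my * dv + q2 /\ Rabs q2 <= e1 * m)
  by (exists (DB - (mx * du + my * dv)); split; [ring|exact Hx2]).
assert (E3 : exists s1, DA = (a + s1) * h /\ Rabs s1 < e2)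
  by (exists (DA / h - a); split; [field; auto|exact Hd3]).
assert (E4 : exists s2, DB = (b + s2) * h /\ Rabs s2 < e2)
  by (exists (DB / h - b); split; [field; auto|exact Hd4]).
destruct E1 as (q1 & E1 & Q1); destruct E2 as (q2 & E2 & Q2);
destruct E3 as (s1 & E3 & S1); destruct E4 as (s2 & E4 & S2).
clearbody DA DB du dv.
assert (Du : du = (my * DA - ly * DB) * / J - (my * q1 - ly * q2) * / J)
  by (rewrite E1, E2; unfold J; field; exact HJ).
assert (Dv : dv = (lx * DB - mx * DA) * / J - (lx * q2 - mx * q1) * / J)
  by (rewrite E1, E2; unfold J; field; exact HJ).
assert (Hm0 : 0 <= m) by (eapply Rle_trans; [apply Rabs_pos|apply Rmax_l]).
assert (B1 : Rabs ((my * q1 - ly * q2) * / J) <= c * (2 * e1 * m)).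
{ rewrite Rabs_mult, Rabs_inv; unfold c; rewrite (Rmult_comm N), Rmult_assoc, (Rmult_comm _ (/ Rabs J)).
  apply Rmult_le_compat_l; [lra|].
  eapply Rle_trans; [apply (Rabs_comb_le _ _ _ _ N); auto|].
  apply Rmult_le_compat_l; lra. }
assert (B2 : Rabs ((lx * q2 - mx * q1) * / J) <= c * (2 * e1 * m)).
{ rewrite Rabs_mult, Rabs_inv; unfold c; rewrite (Rmult_comm N), Rmult_assoc, (Rmult_comm _ (/ Rabs J)).
  apply Rmult_le_compat_l; [lra|].
  eapply Rle_trans; [apply (Rabs_comb_le _ _ _ _ N); auto|].
  apply Rmult_le_compat_l; lra. }
assert (BA : Rabs DA <= (Rabs a + 1) * Rabs h).
{ rewrite E3, Rabs_mult; apply Rmult_le_compat_r; [lra|].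
  abs_lra. }
assert (BB : Rabs DB <= (Rabs b + 1) * Rabs h).
{ rewrite E4, Rabs_mult; apply Rmult_le_compat_r; [lra|].
  abs_lra. }
assert (C1 : Rabs ((my * DA - ly * DB) * / J) <= c * (M * Rabs h)).
{ rewrite Rabs_mult, Rabs_inv; unfold c; rewrite (Rmult_comm N), Rmult_assoc, (Rmult_comm _ (/ Rabs J)).
  apply Rmult_le_compat_l; [lra|].
  eapply Rle_trans; [apply (Rabs_comb_le _ _ _ _ N); auto|].
  apply Rmult_le_compat_l; [lra|]; unfold M.
  abs_lra. }
assert (C2 : Rabs ((lx * DB - mx * DA) * / J) <= c * (M * Rabs h)).
{ rewrite Rabs_mult, Rabs_inv; unfold c; rewrite (Rmult_comm N), Rmult_assoc, (Rmult_comm _ (/ Rabs J)).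
  apply Rmult_le_compat_l; [lra|].
  eapply Rle_trans; [apply (Rabs_comb_le _ _ _ _ N); auto|].
  apply Rmult_le_compat_l; [lra|]; unfold M.
  abs_lra. }
assert (Hm : m <= 2 * c * M * Rabs h).
{ assert (Hm : m <= c * (M * Rabs h) + c * (2 * e1 * m)).
  { apply Rmax_lub.
    - abs_lra.
    - abs_lra. }
  pose proof (Rmult_le_compat_r m _ _ Hm0 Hc1); lra. }
assert (F : c * (2 * e1 * m) <= eps / 2 * Rabs h).
{ apply Rle_trans with (2 * c * e1 * (2 * c * M * Rabs h)).
  - replace (c * (2 * e1 * m)) with (2 * c * e1 * m) by ring.
    apply Rmult_le_compat_l; auto; repeat apply Rmult_le_pos; lra.
  - rewrite <- Rmult_assoc; apply Rmult_le_compat_r; lra. }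
assert (G : forall x, Rabs x <= c * (2 * e1 * m) -> Rabs (x / h) <= eps / 2).
{ intros x Hx; unfold Rdiv; rewrite Rabs_mult, Rabs_inv.
  apply (Rmult_le_reg_r (Rabs h)); auto; rewrite Rmult_assoc, Rinv_l, Rmult_1_r by lra; lra. }
assert (K : forall n1 n2 s1 s2, Rabs n1 <= N -> Rabs n2 <= N -> Rabs s1 < e2 -> Rabs s2 < e2 ->
   Rabs ((n1 * s1 - n2 * s2) * / J) <= 2 * c * e2).
{ intros n1 n2 r1 r2 Hn1 Hn2 Hr1 Hr2; rewrite Rabs_mult, Rabs_inv; unfold c.
  replace (2 * (N * / Rabs J) * e2) with (N * (2 * e2) * / Rabs J) by ring.
  apply Rmult_le_compat_r; [lra|].
  eapply Rle_trans; [apply (Rabs_comb_le _ _ _ _ N); auto|].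
  apply Rmult_le_compat_l; lra. }
split.
- replace (du / h - (my * a - ly * b) / J)
    with ((my * s1 - ly * s2) * / J + - ((my * q1 - ly * q2) * / J / h))
    by (rewrite Du, E3, E4; unfold J; field; split; auto).
  eapply Rle_lt_trans; [apply Rabs_triang|]; rewrite Rabs_Ropp.
  pose proof (G _ B1); pose proof (K my ly s1 s2 Hmy Hly S1 S2); lra.
- replace (dv / h - (lx * b - mx * a) / J)
    with ((lx * s2 - mx * s1) * / J + - ((lx * q2 - mx * q1) * / J / h))
    by (rewrite Dv, E3, E4; unfold J; field; split; auto).
  eapply Rle_lt_trans; [apply Rabs_triang|]; rewrite Rabs_Ropp.
  pose proof (G _ B2); pose proof (K lx mx s2 s1 Hlx Hmx S2 S1); lra.
Qed.

(** The curve [(u, v)] is only assumed continuous; differentiability of [X] and [Y] along it passes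
    to it by Cramer's rule. This serves curves seen through the inverse coordinates, and inverse
    functions of one variable. *)
Lemma implicit_derive :
  is_derive u t0 ((my * a - ly * b) / (lx * my - ly * mx)) /\
  is_derive v t0 ((lx * b - mx * a) / (lx * my - ly * mx)).
Proof.
split; apply is_derive_Reals; intros eps Heps;
  destruct (implicit_derive_small eps Heps) as (d & Hd); exists d; intros h Hh Hh';
  apply (Hd h Hh Hh').
Qed.
End ImplicitDerive.

(* [D x y c] stands for "the distance from [x] to [y] is at most [c]"; a
   relation avoids suprema when the points are functions. *)
Lemma contraction_fixpoint (T : Type) (D : T -> T -> R -> Prop) (ok : T -> Prop)
    (F : T -> T) (x0 : T) (s : R) :
  0 < s ->
  (forall x y a b, a <= b -> D x y a -> D x y b) ->
  (forall x y a, D x y a -> D y x a) ->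
  (forall x y z a b, D x y a -> D y z b -> D x z (a + b)) ->
  (forall x, D x x 0) ->
  ok x0 -> (forall x, ok x -> D x0 x s -> ok (F x)) ->
  (forall x y c, ok x -> ok y -> D x0 x s -> D x0 y s -> D x y c -> D (F x) (F y) (c / 2)) ->
  D x0 (F x0) (s / 2) ->
  (forall u : nat -> T, (forall n, ok (u n)) ->
     (forall n m, (n <= m)%nat -> D (u n) (u m) (s / 2 ^ n)) ->
     exists l, ok l /\ forall n, D (u n) l (s / 2 ^ n)) ->
  exists l, ok l /\ D x0 l s /\ forall n, D l (F l) (s / 2 ^ n).
Proof.
intros Hs Dmono Dsym Dtri Drefl ok0 okF HF H0 Hcomp.
pose (u := fun n => Nat.iter n F x0).
assert (P2 : forall n, 0 < 2 ^ n) by (intros; apply pow_lt; lra).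
assert (Hle : forall n, 0 <= s / 2 ^ n) by (intros; apply Rlt_le, Rdiv_lt_0_compat; auto).
(* The steps are bounded by [s / 2], [s / 4] and so on, hence the iterates never leave the ball of
   radius [s], where [F] contracts. *)
assert (Hu : forall n, ok (u n) /\ D x0 (u n) (s - s / 2 ^ n) /\
   D (u n) (u (S n)) (s / 2 ^ S n)).
{ induction n as [|n (IH1 & IH2 & IH3)].
  - split; [exact ok0|split].
    + apply (Dmono _ _ 0); [simpl; lra|apply Drefl].
    + apply (Dmono _ _ (s / 2)); [simpl; right; field|exact H0].
  - assert (Hin : D x0 (u n) s) by (apply (Dmono _ _ (s - s / 2 ^ n)); auto; specialize (Hle n); lra).
    assert (Hin2 : D x0 (u (S n)) (s - s / 2 ^ S n)).
    { apply (Dmono _ _ (s - s / 2 ^ n + s / 2 ^ S n)).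
      - right; simpl; field; apply Rgt_not_eq, P2.
      - apply (Dtri _ (u n)); auto. }
    assert (Hok : ok (u (S n))) by (apply okF; auto).
    split; [exact Hok|split]; [exact Hin2|].
    apply (Dmono _ _ (s / 2 ^ S n / 2)); [simpl; right; field; apply Rgt_not_eq, P2|].
    apply HF; auto.
    apply (Dmono _ _ (s - s / 2 ^ S n)); auto; specialize (Hle (S n)); lra. }
assert (Hc : forall n k, D (u n) (u (n + k)%nat) (s / 2 ^ n - s / 2 ^ (n + k))).
{ intros n; induction k as [|k IH].
  - rewrite Nat.add_0_r; apply (Dmono _ _ 0); [lra|apply Drefl].
  - rewrite Nat.add_succ_r.
    apply (Dmono _ _ (s / 2 ^ n - s / 2 ^ (n + k) + s / 2 ^ S (n + k))).
    + right; simpl; field; split; apply Rgt_not_eq, P2.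
    + apply (Dtri _ (u (n + k)%nat)); auto; apply Hu. }
destruct (Hcomp u) as (l & okl & Hl).
- intros n; apply Hu.
- intros n m Hnm; replace m with (n + (m - n))%nat by lia.
  eapply Dmono; [|apply Hc]; specialize (Hle (n + (m - n))%nat); lra.
- assert (D0l : D x0 l s).
  { apply (Dmono _ _ (s / 2 ^ 0)); [simpl; right; field|apply (Hl 0%nat)]. }
  exists l; split; [exact okl|split]; [exact D0l|].
  intros n.
  (* A relation need not separate points, so instead of [l = F l] the distance is bounded by every
     [s / 2 ^ n], through the iterate [u (S n) = F (u n)]. *)
  apply (Dmono _ _ (s / 2 ^ S n + s / 2 ^ n / 2));
    [right; simpl; field; apply Rgt_not_eq, P2|].
  apply (Dtri _ (u (S n))); [apply Dsym, Hl|].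
  apply HF; auto; [apply Hu|].
  destruct (Hu n) as (_ & Hd & _); apply (Dmono _ _ (s - s / 2 ^ n)); auto.
  specialize (Hle n); lra.
Qed.

Lemma le_geometric_0 a s : (forall n, a <= s / 2 ^ n) -> a <= 0.
Proof.
intros H; apply (is_lim_seq_le (fun _ => a) (fun n => s * (/ 2) ^ n) a 0).
- intros n; eapply Rle_trans; [apply H|]; right; unfold Rdiv; rewrite pow_inv; reflexivity.
- apply is_lim_seq_const.
- replace (Finite 0) with (Rbar_mult s 0) by (simpl; apply f_equal; ring).
  apply is_lim_seq_scal_l, is_lim_seq_geom; rewrite Rabs_right; lra.
Qed.

Lemma cauchy_geometric (u : nat -> R) s :
  (forall n m, (n <= m)%nat -> Rabs (u n - u m) <= s / 2 ^ n) ->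
  exists l : R, forall n, Rabs (u n - l) <= s / 2 ^ n.
Proof.
intros H.
assert (Hc : ex_lim_seq_cauchy u).
{ intros eps.
  assert (Hg : is_lim_seq (fun n => s * (/ 2) ^ n) 0).
  { replace (Finite 0) with (Rbar_mult s 0) by (simpl; apply f_equal; ring).
    apply is_lim_seq_scal_l, is_lim_seq_geom; rewrite Rabs_right; lra. }
  apply is_lim_seq_spec in Hg; destruct (Hg eps) as [N HN]; exists N.
  assert (Hb : forall n m, (N <= n)%nat -> (n <= m)%nat -> Rabs (u n - u m) < eps).
  { intros n m Hn Hm; eapply Rle_lt_trans; [apply H; auto|].
    specialize (HN n Hn); rewrite Rminus_0_r in HN; rewrite pow_inv in HN.
    abs_lra. }
  intros n m Hn Hm; destruct (Nat.le_ge_cases n m); [auto|rewrite Rabs_minus_sym; auto]. }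
apply ex_lim_seq_cauchy_corr in Hc; destruct Hc as [l Hl].
exists l; intros n.
assert (Hl2 : is_lim_seq (fun m => Rabs (u n - u m)) (Rabs (u n - l))).
{ apply (is_lim_seq_abs _ (u n - l)).
  apply is_lim_seq_minus'; [apply is_lim_seq_const|exact Hl]. }
apply (is_lim_seq_le_loc (fun m => Rabs (u n - u m)) (fun _ => s / 2 ^ n) _ (s / 2 ^ n)) in Hl2;
  [exact Hl2| |apply is_lim_seq_const].
exists n; intros m Hm; apply H, Hm.
Qed.

(** The sum distance is chosen because it makes the triangle inequality and the Lipschitz estimates
    linear in absolute values. *)
Definition dist1 (x y x' y' : R) : R := Rabs (x - x') + Rabs (y - y').

Lemma dist1_tri x y x' y' x'' y'' : dist1 x y x'' y'' <= dist1 x y x' y' + dist1 x' y' x'' y''.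
Proof.
unfold dist1; replace (x - x'') with ((x - x') + (x' - x'')) by ring.
replace (y - y'') with ((y - y') + (y' - y'')) by ring.
pose proof (Rabs_triang (x - x') (x' - x'')); pose proof (Rabs_triang (y - y') (y' - y'')); lra.
Qed.

Lemma dist1_in_box p r x y : dist1 (fst p) (snd p) x y < r -> in_box p r x y.
Proof.
unfold dist1; intros H; pose proof (Rabs_pos (fst p - x)); pose proof (Rabs_pos (snd p - y)).
split; rewrite Rabs_minus_sym; lra.
Qed.

Lemma dist1_pos x y x' y' : 0 <= dist1 x y x' y'.
Proof. unfold dist1; pose proof (Rabs_pos (x - x')); pose proof (Rabs_pos (y - y')); lra. Qed.

Lemma dist1_sym x y x' y' : dist1 x y x' y' = dist1 x' y' x y.
Proof. unfold dist1; rewrite (Rabs_minus_sym x), (Rabs_minus_sym y); reflexivity. Qed.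

Lemma dist1_refl x y : dist1 x y x y = 0.
Proof. unfold dist1; unfold Rminus; rewrite !Rplus_opp_r, Rabs_R0; ring. Qed.

Lemma abs_between a b t e r : Rabs (a - e) < r -> Rabs (b - e) < r ->
  Rmin a b <= t <= Rmax a b -> Rabs (t - e) < r.
Proof.
unfold Rmin, Rmax, Rabs; destruct (Rle_dec a b); repeat destruct Rcase_abs; lra.
Qed.

(** Mean value theorem along two sides of the rectangle with corner [(x', y)], which lies in the
    box. With [la], [lb] the derivatives at [p] it measures closeness to a linear map; with zeros it
    is a Lipschitz bound. *)
Lemma increment_bound p r X la lb e :
  smooth_on p r X ->
  (forall x y, in_box p r x y -> Rabs (dx X x y - la) <= e /\ Rabs (dy X x y - lb) <= e) ->
  forall x y x' y', in_box p r x y -> in_box p r x' y' ->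
  Rabs (X x y - X x' y' - (la * (x - x') + lb * (y - y'))) <= e * dist1 x y x' y'.
Proof.
intros HX Hd x y x' y' Hb Hb'.
assert (Hmid : in_box p r x' y) by (split; [apply Hb'|apply Hb]).
destruct (MVT_gen (fun z => X z y) x' x (fun z => dx X z y)) as (c1 & Hc1 & E1).
{ intros t Ht; apply Derive_correct, (smooth_ex1 p r); auto.
  split; [apply (abs_between x' x); [apply Hb'|apply Hb|lra]|apply Hb]. }
{ intros t Ht; apply continuity_pt_filterlim, (smooth_cont1 p r); auto.
  split; [apply (abs_between x' x); [apply Hb'|apply Hb|lra]|apply Hb]. }
destruct (MVT_gen (fun z => X x' z) y' y (fun z => dy X x' z)) as (c2 & Hc2 & E2).
{ intros t Ht; apply Derive_correct, (smooth_ex2 p r); auto.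
  split; [apply Hb'|apply (abs_between y' y); [apply Hb'|apply Hb|lra]]. }
{ intros t Ht; apply continuity_pt_filterlim, (smooth_cont2 p r); auto.
  split; [apply Hb'|apply (abs_between y' y); [apply Hb'|apply Hb|lra]]. }
simpl in E1, E2.
assert (B1 : in_box p r c1 y)
  by (split; [apply (abs_between x' x); [apply Hb'|apply Hb|lra]|apply Hb]).
assert (B2 : in_box p r x' c2)
  by (split; [apply Hb'|apply (abs_between y' y); [apply Hb'|apply Hb|lra]]).
replace (X x y - X x' y' - (la * (x - x') + lb * (y - y'))) with
  ((dx X c1 y - la) * (x - x') + (dy X x' c2 - lb) * (y - y')) by lra.
eapply Rle_trans; [apply Rabs_triang|]; rewrite !Rabs_mult; unfold dist1.
rewrite Rmult_plus_distr_l; apply Rplus_le_compat; apply Rmult_le_compat_r; try apply Rabs_pos.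
- apply Hd, B1.
- apply (proj2 (Hd _ _ B2)).
Qed.

(** The bound with [C] gives injectivity on the box and continuity of the inverse. Together with
    [implicit_derive] this is all the regularity of the inverse that is used. *)
Lemma local_inverse p r X Y :
  0 < r -> smooth_on p r X -> smooth_on p r Y -> jac X Y (fst p) (snd p) <> 0 ->
  exists r1 rho C (PX PY : R -> R -> R), 0 < r1 /\ r1 < r /\ 0 < rho /\ 0 < C /\
  (forall x y x' y', in_box p r1 x y -> in_box p r1 x' y' ->
     dist1 x y x' y' <= C * dist1 (X x y) (Y x y) (X x' y') (Y x' y')) /\
  (forall a b, Rabs (a - X (fst p) (snd p)) < rho -> Rabs (b - Y (fst p) (snd p)) < rho ->
     in_box p r1 (PX a b) (PY a b) /\
     X (PX a b) (PY a b) = a /\ Y (PX a b) (PY a b) = b).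
Proof.
intros Hr sX sY HJ.
set (x0 := fst p) in *; set (y0 := snd p) in *.
set (lx := dx X x0 y0); set (ly := dy X x0 y0); set (mx := dx Y x0 y0); set (my := dy Y x0 y0).
set (J := lx * my - ly * mx).
assert (HJ' : J <> 0) by exact HJ.
set (N := Rabs lx + Rabs ly + Rabs mx + Rabs my).
pose proof (Rabs_pos lx); pose proof (Rabs_pos ly); pose proof (Rabs_pos mx);
pose proof (Rabs_pos my).
assert (HN : 0 <= N) by (unfold N; lra).
assert (Hlx : Rabs lx <= N) by (unfold N; lra).
assert (Hly : Rabs ly <= N) by (unfold N; lra).
assert (Hmx : Rabs mx <= N) by (unfold N; lra).
assert (Hmy : Rabs my <= N) by (unfold N; lra).
assert (Hj : 0 < / Rabs J) by (apply Rinv_0_lt_compat, Rabs_pos_lt, HJ').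
set (c := N * / Rabs J).
assert (Hc : 0 <= c) by (apply Rmult_le_pos; lra).
(* An iteration step contracts by [4 * c * e]: two components, each with two remainders of size [e]
   times the distance. *)
set (e := / (8 * (c + 1))).
assert (He : 0 < e) by (apply Rinv_0_lt_compat; lra).
assert (Hce : 4 * c * e <= 1 / 2).
{ unfold e; apply (Rmult_le_reg_r (8 * (c + 1))); [lra|].
  rewrite Rmult_assoc, Rinv_l by lra; lra. }
assert (Hp : in_box p r x0 y0) by (apply in_box_center, Hr).
assert (Hnear : forall f, smooth_on p r f -> near p (fun x y => Rabs (f x y - f x0 y0) < e)).
{ intros f Hf; apply (smooth_cont p r f x0 y0 Hf Hp (mkposreal e He)). }
assert (Hn := near_and _ _ _
  (near_and _ _ _ (Hnear _ (smooth_dx p r X sX)) (Hnear _ (smooth_dy p r X sX)))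
  (near_and _ _ _ (Hnear _ (smooth_dx p r Y sY)) (Hnear _ (smooth_dy p r Y sY)))).
apply near_box in Hn; destruct Hn as (r2 & Hr2 & Hn).
set (r1 := Rmin (r / 2) r2).
assert (Hr1 : 0 < r1) by (apply Rmin_glb_lt; lra).
assert (Hr1r : r1 < r) by (pose proof (Rmin_l (r / 2) r2); fold r1 in H3; lra).
assert (Hb2 : forall x y, in_box p r1 x y -> in_box p r2 x y)
  by (intros; apply (in_box_le p r1); auto; apply Rmin_r).
assert (Hbr : forall x y, in_box p r1 x y -> in_box p r x y)
  by (intros; apply (in_box_le p r1); auto; lra).
assert (IX : forall x y x' y', in_box p r1 x y -> in_box p r1 x' y' ->
  Rabs (X x y - X x' y' - (lx * (x - x') + ly * (y - y'))) <= e * dist1 x y x' y').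
{ apply increment_bound; [apply (smooth_on_le p r); auto; lra|].
  intros x y Hb; destruct (Hn x y (Hb2 _ _ Hb)) as ((Ha & Hb') & _); split; apply Rlt_le; auto. }
assert (IY : forall x y x' y', in_box p r1 x y -> in_box p r1 x' y' ->
  Rabs (Y x y - Y x' y' - (mx * (x - x') + my * (y - y'))) <= e * dist1 x y x' y').
{ apply increment_bound; [apply (smooth_on_le p r); auto; lra|].
  intros x y Hb; destruct (Hn x y (Hb2 _ _ Hb)) as (_ & (Ha & Hb')); split; apply Rlt_le; auto. }
(* Newton's iteration with the derivative frozen at [p]; its fixed points solve [X = a], [Y = b]. *)
pose (Fx := fun a b x y => x - (my * (X x y - a) - ly * (Y x y - b)) * / J).
pose (Fy := fun a b x y => y - (lx * (Y x y - b) - mx * (X x y - a)) * / J).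
assert (Hcomb : forall n1 n2 s1 s2 w, Rabs n1 <= N -> Rabs n2 <= N -> Rabs s1 + Rabs s2 <= w ->
   Rabs ((n1 * s1 - n2 * s2) * / J) <= c * w).
{ intros n1 n2 s1 s2 w Hn1 Hn2 Hw; rewrite Rabs_mult, Rabs_inv; unfold c.
  replace (N * / Rabs J * w) with (N * w * / Rabs J) by ring.
  apply Rmult_le_compat_r; [lra|].
  eapply Rle_trans; [apply (Rabs_comb_le _ _ _ _ N); auto|].
  apply Rmult_le_compat_l; lra. }
assert (Hcontr : forall a b x y x' y', in_box p r1 x y -> in_box p r1 x' y' ->
  dist1 (Fx a b x y) (Fy a b x y) (Fx a b x' y') (Fy a b x' y') <= dist1 x y x' y' / 2).
{ intros a b x y x' y' Hb Hb'.
  specialize (IX _ _ _ _ Hb Hb'); specialize (IY _ _ _ _ Hb Hb').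
  set (q1 := X x y - X x' y' - (lx * (x - x') + ly * (y - y'))) in *.
  set (q2 := Y x y - Y x' y' - (mx * (x - x') + my * (y - y'))) in *.
  set (w := e * dist1 x y x' y') in *.
  assert (E1 : Fx a b x y - Fx a b x' y' = - ((my * q1 - ly * q2) * / J))
    by (unfold Fx, q1, q2, J; field; exact HJ').
  assert (E2 : Fy a b x y - Fy a b x' y' = - ((lx * q2 - mx * q1) * / J))
    by (unfold Fy, q1, q2, J; field; exact HJ').
  unfold dist1 at 1; rewrite E1, E2, !Rabs_Ropp.
  pose proof (Hcomb my ly q1 q2 (2 * w) Hmy Hly ltac:(lra)).
  pose proof (Hcomb lx mx q2 q1 (2 * w) Hlx Hmx ltac:(lra)).
  pose proof (Rmult_le_compat_r _ _ _ (dist1_pos x y x' y') Hce).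
  unfold w in *; lra. }
assert (Hshift : forall a b x y, dist1 x y (Fx a b x y) (Fy a b x y) <=
   2 * c * dist1 (X x y) (Y x y) a b).
{ intros a b x y; unfold dist1 at 1.
  replace (x - Fx a b x y) with ((my * (X x y - a) - ly * (Y x y - b)) * / J) by (unfold Fx; ring).
  replace (y - Fy a b x y) with ((lx * (Y x y - b) - mx * (X x y - a)) * / J) by (unfold Fy; ring).
  pose proof (Hcomb my ly (X x y - a) (Y x y - b) _ Hmy Hly (Rle_refl _)).
  pose proof (Hcomb lx mx (Y x y - b) (X x y - a) _ Hlx Hmx (Rle_refl _)).
  unfold dist1; lra. }
(* The point [(x', y')] is fixed by the iteration aimed at its own image, so the distance is at most
   the displacement of [(x, y)] plus half of itself. Taking [c + 1] instead of [c] makes the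
   constant positive. *)
assert (Hlip : forall x y x' y', in_box p r1 x y -> in_box p r1 x' y' ->
     dist1 x y x' y' <= 4 * (c + 1) * dist1 (X x y) (Y x y) (X x' y') (Y x' y')).
{ intros x y x' y' Hb Hb'.
  assert (Ex : x' = Fx (X x' y') (Y x' y') x' y') by (unfold Fx; ring).
  assert (Ey : y' = Fy (X x' y') (Y x' y') x' y') by (unfold Fy; ring).
  pose proof (Hcontr (X x' y') (Y x' y') _ _ _ _ Hb Hb') as H4; rewrite <- Ex, <- Ey in H4.
  pose proof (Hshift (X x' y') (Y x' y') x y) as H5.
  pose proof (dist1_tri x y (Fx (X x' y') (Y x' y') x y) (Fy (X x' y') (Y x' y') x y) x' y').
  pose proof (dist1_pos (X x y) (Y x y) (X x' y') (Y x' y')); lra. }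
(* The first step from [p] then has length at most [2 * c * (2 * rho) <= r1 / 4], half of the radius
   [r1 / 2] allowed to the iteration. *)
set (rho := r1 / (16 * (c + 1))).
assert (Hrho : 0 < rho) by (apply Rdiv_lt_0_compat; lra).
assert (Hex : forall a b, Rabs (a - X x0 y0) < rho -> Rabs (b - Y x0 y0) < rho ->
  exists z : R * R, in_box p r1 (fst z) (snd z) /\ X (fst z) (snd z) = a /\ Y (fst z) (snd z) = b).
{ intros a b Ha Hb.
  destruct (contraction_fixpoint (R * R)
    (fun z z' d => dist1 (fst z) (snd z) (fst z') (snd z') <= d) (fun _ => True)
    (fun z => (Fx a b (fst z) (snd z), Fy a b (fst z) (snd z))) p (r1 / 2)) as (z & _ & Hz & HF).
  - lra.
  - intros; lra.
  - intros z z' d; rewrite dist1_sym; auto.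
  - intros u v w d1 d2 H4 H5; simpl in *.
    pose proof (dist1_tri (fst u) (snd u) (fst v) (snd v) (fst w) (snd w)); lra.
  - intros z; rewrite dist1_refl; lra.
  - exact I.
  - auto.
  - intros u v d _ _ Hu Hv Huv; simpl.
    eapply Rle_trans; [apply Hcontr; apply dist1_in_box; lra|lra].
  - simpl; eapply Rle_trans; [apply Hshift|]; fold x0 y0.
    assert (dist1 (X x0 y0) (Y x0 y0) a b <= 2 * rho)
      by (unfold dist1; rewrite (Rabs_minus_sym _ a), (Rabs_minus_sym _ b); lra).
    apply Rle_trans with (2 * c * (2 * rho)); [apply Rmult_le_compat_l; lra|].
    unfold rho; replace (2 * c * (2 * (r1 / (16 * (c + 1))))) with (r1 / 4 * (c / (c + 1)))
      by (field; lra).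
    assert (c / (c + 1) <= 1) by (apply Rle_div_l; lra). nra.
  - intros u _ Hu.
    destruct (cauchy_geometric (fun n => fst (u n)) (r1 / 2)) as (l1 & Hl1).
    { intros n m Hnm; eapply Rle_trans; [|apply (Hu n m Hnm)]; unfold dist1.
      abs_lra. }
    destruct (cauchy_geometric (fun n => snd (u n)) (r1 / 2)) as (l2 & Hl2).
    { intros n m Hnm; eapply Rle_trans; [|apply (Hu n m Hnm)]; unfold dist1.
      abs_lra. }
    exists (l1, l2); split; [exact I|]; intros n; simpl.
    (* Pass to the limit in [dist1] itself: coordinatewise bounds lose a factor 2. *)
    apply Rnot_lt_le; intros Hlt.
    set (g := dist1 (fst (u n)) (snd (u n)) l1 l2 - r1 / 2 / 2 ^ n) in *.
    assert (Hg : g <= 0).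
    { apply (le_geometric_0 g (2 * (r1 / 2))); intros m; set (k := Nat.max n m).
      assert (HP : 0 < 2 ^ m) by (apply pow_lt; lra).
      assert (r1 / 2 / 2 ^ k <= r1 / 2 / 2 ^ m).
      { apply Rmult_le_compat_l; [lra|]; apply Rinv_le_contravar; auto.
        apply Rle_pow; [lra|unfold k; lia]. }
      specialize (Hl1 k); specialize (Hl2 k); specialize (Hu n k ltac:(unfold k; lia)).
      pose proof (dist1_tri (fst (u n)) (snd (u n)) (fst (u k)) (snd (u k)) l1 l2) as Htri.
      unfold dist1 at 3 in Htri; unfold g.
      abs_lra. }
    unfold g in Hg; lra.
  - exists z.
    assert (HF0 : dist1 (fst z) (snd z) (Fx a b (fst z) (snd z)) (Fy a b (fst z) (snd z)) <= 0)
      by (apply (le_geometric_0 _ (r1 / 2)), HF).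
    set (x := fst z) in *; set (y := snd z) in *.
    assert (G1 : x = Fx a b x y /\ y = Fy a b x y).
    { unfold dist1 in HF0.
      abs_lra. }
    destruct G1 as (G1 & G2).
    assert (K1 : my * (X x y - a) - ly * (Y x y - b) = 0).
    { apply (Rmult_eq_reg_r (/ J)); [|apply Rinv_neq_0_compat, HJ'].
      unfold Fx in G1; lra. }
    assert (K2 : lx * (Y x y - b) - mx * (X x y - a) = 0).
    { apply (Rmult_eq_reg_r (/ J)); [|apply Rinv_neq_0_compat, HJ'].
      unfold Fy in G2; lra. }
    split; [apply dist1_in_box; eapply Rle_lt_trans; [exact Hz|lra]|].
    split; apply Rminus_diag_uniq; apply (Rmult_eq_reg_l J); auto; rewrite Rmult_0_r.
    + replace (J * (X x y - a)) with
       (lx * (my * (X x y - a) - ly * (Y x y - b)) + ly * (lx * (Y x y - b) - mx * (X x y - a)))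
       by (unfold J; ring); rewrite K1, K2; ring.
    + replace (J * (Y x y - b)) with
       (mx * (my * (X x y - a) - ly * (Y x y - b)) + my * (lx * (Y x y - b) - mx * (X x y - a)))
       by (unfold J; ring); rewrite K1, K2; ring. }
assert (Hch : exists Psi : R -> R -> R * R, forall a b,
  Rabs (a - X x0 y0) < rho -> Rabs (b - Y x0 y0) < rho ->
  in_box p r1 (fst (Psi a b)) (snd (Psi a b)) /\
  X (fst (Psi a b)) (snd (Psi a b)) = a /\ Y (fst (Psi a b)) (snd (Psi a b)) = b).
{ exists (fun a b => epsilon (inhabits p) (fun z =>
    in_box p r1 (fst z) (snd z) /\ X (fst z) (snd z) = a /\ Y (fst z) (snd z) = b)).
  intros a b Ha Hb; apply epsilon_spec, Hex; auto. }
destruct Hch as (Psi & HPsi).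
exists r1, rho, (4 * (c + 1)), (fun a b => fst (Psi a b)), (fun a b => snd (Psi a b)).
split; [exact Hr1|split; [exact Hr1r|split; [exact Hrho|split; [lra|split]]]]; auto.
Qed.

(** * Local solutions of the normal equation *)

Lemma mvt_bound f df M a b :
  (forall t, Rmin a b <= t <= Rmax a b -> is_derive f t (df t)) ->
  (forall t, Rmin a b <= t <= Rmax a b -> Rabs (df t) <= M) ->
  Rabs (f b - f a) <= M * Rabs (b - a).
Proof.
intros Hd Hm; destruct (MVT_gen f a b df) as (c & Hc & E).
- intros; apply Hd; lra.
- intros t Ht; apply continuity_pt_filterlim, (ex_derive_continuous f); eexists; apply Hd, Ht.
- rewrite E, Rabs_mult; apply Rmult_le_compat_r; [apply Rabs_pos|auto].
Qed.

(** Retraction of the line onto [[- r, r]]. Composition with it makes a function controlled only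
    there continuous everywhere, so that integrals can be differentiated without care at the end
    points. *)
Definition clamp (r t : R) : R := Rmax (- r) (Rmin r t).

Lemma clamp_lip r t s : Rabs (clamp r t - clamp r s) <= Rabs (t - s).
Proof.
unfold clamp, Rmax, Rmin, Rabs; repeat destruct Rle_dec; repeat destruct Rcase_abs; lra.
Qed.

Lemma clamp_in r t : 0 <= r -> Rabs (clamp r t) <= r.
Proof.
unfold clamp, Rmax, Rmin, Rabs; repeat destruct Rle_dec; repeat destruct Rcase_abs; lra.
Qed.

Lemma clamp_id r t : Rabs t <= r -> clamp r t = t.
Proof.
unfold clamp, Rmax, Rmin, Rabs; repeat destruct Rle_dec; repeat destruct Rcase_abs; lra.
Qed.

Lemma continuous_lipschitz (f : R -> R) L x :
  (forall y, Rabs (f y - f x) <= L * Rabs (y - x)) -> continuous f x.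
Proof.
intros H; apply filterlim_locally; intros eps.
assert (HL : 0 < Rabs L + 1) by (pose proof (Rabs_pos L); lra).
exists (mkposreal _ (Rdiv_lt_0_compat _ _ (cond_pos eps) HL)); intros y Hy.
change (Rabs (f y - f x) < eps); change (Rabs (y - x) < eps / (Rabs L + 1)) in Hy.
eapply Rle_lt_trans; [apply H|].
apply Rle_lt_trans with ((Rabs L + 1) * Rabs (y - x)).
- apply Rmult_le_compat_r; [apply Rabs_pos|pose proof (Rle_abs L); lra].
- apply Rlt_div_r in Hy; lra.
Qed.

Lemma continuous_abs_near (f : R -> R) x e : continuous f x -> 0 < e ->
  exists d, 0 < d /\ forall y, Rabs (y - x) < d -> Rabs (f y - f x) < e.
Proof.
intros Hf He; destruct (proj1 (filterlim_locally _ _) Hf (mkposreal e He)) as (d & Hd).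
exists d; split; [apply cond_pos|]; intros y Hy; apply (Hd y), Hy.
Qed.

(** Contraction in the uniform distance on [[- r, r]], with [q] merely continuous. The bound [k]
    will keep the solution inside the domain of the inverse coordinates. *)
Lemma picard (q : R -> R) (r0 h0 h1 k : R) :
  0 < r0 -> 0 < k -> (forall t, Rabs t <= r0 -> continuous q t) ->
  exists r (H H1 : R -> R), 0 < r /\ r <= r0 /\ H 0 = h0 /\ H1 0 = h1 /\
    forall t, Rabs t <= r -> is_derive H t (H1 t) /\
      is_derive H1 t (- (H t ^ 2 / 2 + q t)) /\ Rabs (H t - h0) <= k.
Proof.
intros Hr0 Hk cq.
destruct (continuous_abs_near q 0 1) as (d & Hd & Hq); [apply cq; rewrite Rabs_R0; lra|lra|].
set (M := (Rabs h0 + 1) ^ 2 / 2 + Rabs (q 0) + 1).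
pose proof (Rabs_pos h0) as P0; pose proof (Rabs_pos h1) as P1; pose proof (Rabs_pos (q 0)) as P2.
assert (HM : 0 < M) by (assert (0 <= (Rabs h0 + 1) ^ 2) by apply pow2_ge_0; unfold M; lra).
set (Lam := Rabs h1 + M).
assert (HLam : 0 < Lam) by (unfold Lam; lra).
set (s := Rmin k 1).
assert (Hs : 0 < s) by (apply Rmin_glb_lt; lra).
assert (Hs1 : s <= 1) by apply Rmin_r.
(* The bound [s / (2 * Lam)] keeps the first iterate within [s / 2], and [/ (2 * (Rabs h0 + 1))]
   yields the contraction factor 1/2. As [s <= 1], the functions considered stay below
   [Rabs h0 + 1], where [h^2 / 2] has that Lipschitz constant. *)
set (r := Rmin (Rmin r0 (d / 2)) (Rmin 1 (Rmin (s / (2 * Lam)) (/ (2 * (Rabs h0 + 1)))))).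
assert (Hr : 0 < r).
{ repeat apply Rmin_glb_lt; try lra.
  - apply Rdiv_lt_0_compat; lra.
  - apply Rinv_0_lt_compat; lra. }
assert (Hrr : r <= r0 /\ r <= d / 2 /\ r <= 1 /\ r <= s / (2 * Lam) /\ r <= / (2 * (Rabs h0 + 1))).
{ unfold r; abs_lra. }
destruct Hrr as (Hrr0 & Hrd & Hr1 & Hrs & HrL).
assert (Hrs' : Lam * r <= s / 2).
{ apply (Rmult_le_compat_l Lam) in Hrs; [|lra].
  replace (Lam * (s / (2 * Lam))) with (s / 2) in Hrs by (field; lra); lra. }
assert (HrL' : (Rabs h0 + 1) * r <= / 2).
{ apply (Rmult_le_compat_l (Rabs h0 + 1)) in HrL; [|lra].
  replace ((Rabs h0 + 1) * / (2 * (Rabs h0 + 1))) with (/ 2) in HrL by (field; lra); lra. }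
clearbody r.
pose (G := fun (f : R -> R) t => - (f (clamp r t) ^ 2 / 2 + q (clamp r t))).
pose (Gi := fun (f : R -> R) (t : R) => RInt (G f) 0 t : R).
pose (Si := fun (f : R -> R) (t : R) => RInt (fun u => u * G f u) 0 t : R).
(* The double primitive, that is the integral of [(t - u) * G f u] from 0 to [t], split so that in
   its derivative the two terms [t * G f t] cancel. *)
pose (F := fun f t => h0 + h1 * t + t * Gi f t - Si f t).
pose (ok := fun f : R -> R => forall t u, Rabs t <= r -> Rabs u <= r ->
   Rabs (f t - f u) <= Lam * Rabs (t - u)).
pose (D := fun (f g : R -> R) c => forall t, Rabs t <= r -> Rabs (f t - g t) <= c).
assert (Hcl : forall t, Rabs (clamp r t) <= r) by (intros; apply clamp_in; lra).
assert (cG : forall f, ok f -> forall t, continuous (G f) t).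
{ intros f Hf t; unfold G.
  apply (continuous_opp (fun t => f (clamp r t) ^ 2 / 2 + q (clamp r t))).
  apply (continuous_plus (fun t => f (clamp r t) ^ 2 / 2) (fun t => q (clamp r t))).
  - assert (Hc : continuous (fun t => f (clamp r t)) t).
    { apply (continuous_lipschitz _ Lam); intros u; eapply Rle_trans; [apply Hf; auto|].
      apply Rmult_le_compat_l; [lra|apply clamp_lip]. }
    apply (continuous_mult (fun t => f (clamp r t) ^ 2) (fun _ => / 2)); [|apply continuous_const].
    simpl; apply (continuous_mult (fun t => f (clamp r t)) (fun t => f (clamp r t) * 1)); auto.
    apply (continuous_mult (fun t => f (clamp r t)) (fun t => 1)); auto; apply continuous_const.
  - apply (continuous_comp (clamp r) q); [|apply cq; eapply Rle_trans; [apply Hcl|lra]].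
    apply (continuous_lipschitz _ 1); intros u; rewrite Rmult_1_l; apply clamp_lip. }
assert (dGi : forall f, ok f -> forall t, is_derive (Gi f) t (G f t)).
{ intros f Hf t; apply (is_derive_RInt (G f) _ 0); [|apply cG; auto].
  apply filter_forall; intros u; apply (RInt_correct (V := R_CompleteNormedModule)).
  apply (ex_RInt_continuous (V := R_CompleteNormedModule)); intros; apply cG; auto. }
assert (dSi : forall f, ok f -> forall t, is_derive (Si f) t (t * G f t)).
{ intros f Hf t.
  assert (Hc : forall u, continuous (fun u => u * G f u) u)
    by (intros u; apply (continuous_mult (fun u => u) (G f)); [apply continuous_id|apply cG; auto]).
  apply (is_derive_RInt (fun u => u * G f u) _ 0); [|apply Hc].
  apply filter_forall; intros u; apply (RInt_correct (V := R_CompleteNormedModule)).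
  apply (ex_RInt_continuous (V := R_CompleteNormedModule)); intros; apply Hc. }
assert (dF : forall f, ok f -> forall t, is_derive (F f) t (h1 + Gi f t)).
{ intros f Hf t; pose proof (dGi f Hf t) as H1; pose proof (dSi f Hf t) as H2; unfold F.
  replace (h1 + Gi f t) with ((0 + h1 * 1) + (1 * Gi f t + t * G f t) - t * G f t) by ring.
  apply (is_derive_minus (fun t => h0 + h1 * t + t * Gi f t) (Si f)); [|exact H2].
  apply (is_derive_plus (fun t => h0 + h1 * t) (fun t => t * Gi f t)).
  - apply (is_derive_plus (fun _ => h0) (fun t => h1 * t)); [apply @is_derive_const|].
    apply (is_derive_scal (fun t => t) t h1 1); apply @is_derive_id.
  - apply (is_derive_mult (fun t => t) (Gi f)); [apply @is_derive_id|exact H1|apply Rmult_comm]. }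
assert (Gi0 : forall f, Gi f 0 = 0) by (intros f; exact (RInt_point 0 (G f))).
assert (Si0 : forall f, Si f 0 = 0) by (intros f; exact (RInt_point 0 (fun u => u * G f u))).
assert (F0 : forall f, F f 0 = h0) by (intros; unfold F; rewrite Gi0, Si0; ring).
assert (Hf1 : forall f t, D (fun _ => h0) f s -> Rabs (f (clamp r t)) <= Rabs h0 + 1).
{ intros f t Hf; specialize (Hf (clamp r t) (Hcl t)).
  abs_lra. }
assert (BG : forall f, D (fun _ => h0) f s -> forall t, Rabs (G f t) <= M).
{ intros f Hf t; unfold G; rewrite Rabs_Ropp.
  eapply Rle_trans; [apply Rabs_triang|].
  specialize (Hf1 f t Hf).
  assert (Rabs (f (clamp r t) ^ 2 / 2) <= (Rabs h0 + 1) ^ 2 / 2).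
  { unfold Rdiv; rewrite Rabs_mult, (Rabs_right (/ 2)) by lra.
    apply Rmult_le_compat_r; [lra|]; rewrite <- RPow_abs; apply pow_incr; split; auto; apply Rabs_pos. }
  assert (Rabs (q (clamp r t)) <= Rabs (q 0) + 1).
  { replace (q (clamp r t)) with (q 0 + (q (clamp r t) - q 0)) by ring.
    eapply Rle_trans; [apply Rabs_triang|].
    apply Rplus_le_compat_l, Rlt_le, Hq; rewrite Rminus_0_r.
    eapply Rle_lt_trans; [apply Hcl|lra]. }
  unfold M; lra. }
assert (Hint : forall t u, Rabs t <= r -> Rmin 0 t <= u <= Rmax 0 t -> Rabs u <= r).
{ intros t u; unfold Rmin, Rmax, Rabs; destruct (Rle_dec 0 t); repeat destruct Rcase_abs; lra. }
assert (BGi : forall f, ok f -> D (fun _ => h0) f s -> forall t, Rabs t <= r ->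
   Rabs (h1 + Gi f t) <= Lam).
{ intros f Hf Hf' t Ht.
  pose proof (mvt_bound (Gi f) (G f) M 0 t (fun u _ => dGi f Hf u) (fun u _ => BG f Hf' u)) as Hb.
  rewrite Gi0, !Rminus_0_r in Hb.
  eapply Rle_trans; [apply Rabs_triang|]; unfold Lam.
  assert (M * Rabs t <= M * 1) by (apply Rmult_le_compat_l; lra); lra. }
destruct (contraction_fixpoint (R -> R) D ok F (fun _ => h0) s) as (l & okl & Hl & HlF).
- exact Hs.
- intros f g a b Hab H t Ht; specialize (H t Ht); lra.
- intros f g a H t Ht; rewrite Rabs_minus_sym; auto.
- intros f g h a b H1 H2 t Ht; replace (f t - h t) with ((f t - g t) + (g t - h t)) by ring.
  eapply Rle_trans; [apply Rabs_triang|]; specialize (H1 t Ht); specialize (H2 t Ht); lra.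
- intros f t Ht; rewrite Rminus_diag, Rabs_R0; lra.
- intros t u Ht Hu; rewrite Rminus_diag, Rabs_R0; apply Rmult_le_pos; [lra|apply Rabs_pos].
- intros f Hf Hf' t u Ht Hu; apply (mvt_bound (F f) (fun t => h1 + Gi f t)).
  + intros; apply dF, Hf.
  + intros w Hw; apply BGi; auto.
    replace w with (w - 0) by ring; destruct (Rle_lt_dec (Rabs (w - 0)) r) as [Hle|Hlt]; auto.
    exfalso; revert Hw Ht Hu Hlt; unfold Rmin, Rmax, Rabs; destruct (Rle_dec u t);
      repeat destruct Rcase_abs; lra.
- intros f g c Hf Hg Hf' Hg' Hfg.
  assert (Hc : 0 <= c) by (eapply Rle_trans; [apply Rabs_pos|apply (Hfg 0); rewrite Rabs_R0; lra]).
  assert (B1 : forall t, Rabs (G f t - G g t) <= (Rabs h0 + 1) * c).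
  { intros t; unfold G.
    replace (- (f (clamp r t) ^ 2 / 2 + q (clamp r t)) - - (g (clamp r t) ^ 2 / 2 + q (clamp r t)))
      with (- ((f (clamp r t) + g (clamp r t)) / 2 * (f (clamp r t) - g (clamp r t)))) by field.
    rewrite Rabs_Ropp, Rabs_mult; apply Rmult_le_compat; try apply Rabs_pos; [|apply Hfg, Hcl].
    pose proof (Hf1 f t Hf'); pose proof (Hf1 g t Hg').
    abs_lra. }
  assert (B2 : forall t, Rabs t <= r -> Rabs (Gi f t - Gi g t) <= c / 2).
  { intros t Ht.
    pose proof (mvt_bound (fun t => Gi f t - Gi g t) (fun t => G f t - G g t) _ 0 t
      (fun u _ => is_derive_minus _ _ _ _ _ (dGi f Hf u) (dGi g Hg u)) (fun u _ => B1 u)) as Hb.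
    simpl in Hb; rewrite !Gi0, !Rminus_0_r in Hb.
    eapply Rle_trans; [apply Hb|].
    apply Rle_trans with ((Rabs h0 + 1) * c * r).
    - apply Rmult_le_compat_l; auto; apply Rmult_le_pos; lra.
    - replace ((Rabs h0 + 1) * c * r) with ((Rabs h0 + 1) * r * c) by ring.
      replace (c / 2) with (/ 2 * c) by field; apply Rmult_le_compat_r; auto. }
  intros t Ht.
  assert (Hd3 : forall u, is_derive (fun t => F f t - F g t) u (Gi f u - Gi g u)).
  { intros u; replace (Gi f u - Gi g u) with ((h1 + Gi f u) - (h1 + Gi g u)) by ring.
    apply @is_derive_minus; apply dF; auto. }
  pose proof (mvt_bound (fun t => F f t - F g t) (fun t => Gi f t - Gi g t) (c / 2) 0 t
    (fun u _ => Hd3 u) (fun u Hu => B2 u (Hint t u Ht Hu))) as Hb.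
  simpl in Hb; rewrite !F0, Rminus_diag, !Rminus_0_r in Hb.
  eapply Rle_trans; [apply Hb|].
  assert (c / 2 * Rabs t <= c / 2 * 1) by (apply Rmult_le_compat_l; lra); lra.
- intros t Ht.
  assert (ok0 : ok (fun _ => h0)).
  { intros u w _ _; rewrite Rminus_diag, Rabs_R0; apply Rmult_le_pos; [lra|apply Rabs_pos]. }
  assert (D0 : D (fun _ => h0) (fun _ => h0) s) by (intros u _; rewrite Rminus_diag, Rabs_R0; lra).
  pose proof (mvt_bound (F (fun _ => h0)) (fun t => h1 + Gi (fun _ => h0) t) Lam 0 t
    (fun u _ => dF _ ok0 u) (fun u Hu => BGi _ ok0 D0 u (Hint t u Ht Hu))) as Hb.
  rewrite F0, Rminus_0_r in Hb; rewrite Rabs_minus_sym.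
  eapply Rle_trans; [apply Hb|].
  apply Rle_trans with (Lam * r); [apply Rmult_le_compat_l; lra|exact Hrs'].
- intros u Hok Hu.
  assert (Hlim : forall t, exists l : R, Rabs t <= r -> forall n, Rabs (u n t - l) <= s / 2 ^ n).
  { intros t; destruct (Rle_dec (Rabs t) r) as [Ht|Ht]; [|exists 0; contradiction].
    destruct (cauchy_geometric (fun n => u n t) s) as (l & Hl);
      [intros n m Hnm; apply (Hu n m Hnm t Ht)|exists l; auto]. }
  assert (Hl : exists l : R -> R, forall t, Rabs t <= r -> forall n, Rabs (u n t - l t) <= s / 2 ^ n).
  { exists (fun t => proj1_sig (constructive_indefinite_description _ (Hlim t))).
    intros t; destruct (constructive_indefinite_description _ (Hlim t)); auto. }
  destruct Hl as (l & Hl); exists l.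
  split; [|intros n t Ht; apply Hl, Ht].
  intros t w Ht Hw; apply Rminus_le; apply (le_geometric_0 _ (2 * s)); intros n.
  pose proof (Hl t Ht n) as A1; pose proof (Hl w Hw n) as A2; pose proof (Hok n t w Ht Hw) as A3.
  replace (l t - l w) with (- (u n t - l t) + (u n t - u n w) + (u n w - l w)) by ring.
  pose proof (Rabs_triang (- (u n t - l t) + (u n t - u n w)) (u n w - l w)) as A4.
  pose proof (Rabs_triang (- (u n t - l t)) (u n t - u n w)) as A5; rewrite Rabs_Ropp in A5.
  abs_lra.
- assert (Heq : forall t, Rabs t <= r -> l t = F l t).
  { intros t Ht; apply Rminus_diag_uniq, Rabs_eq_0, Rle_antisym; [|apply Rabs_pos].
    apply (le_geometric_0 _ s); intros n; apply (HlF n t Ht). }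
  exists r, (F l), (fun t => h1 + Gi l t); split; [exact Hr|split; [exact Hrr0|split; [apply F0|split]]].
  + rewrite Gi0; ring.
  + intros t Ht; split; [apply dF, okl|split].
    * rewrite <- (Heq t Ht).
      replace (- (l t ^ 2 / 2 + q t)) with (0 + G l t)
        by (unfold G; rewrite clamp_id by exact Ht; ring).
      apply @is_derive_plus; [apply @is_derive_const|apply dGi, okl].
    * rewrite <- (Heq t Ht), Rabs_minus_sym; eapply Rle_trans; [apply (Hl t Ht)|apply Rmin_l].
Qed.

(** * Graphs, variations and flows *)

Lemma ivt_between f a b y : a < b ->
  (forall t, a <= t <= b -> continuous f t) -> f a < y < f b ->
  exists t, a < t < b /\ f t = y.
Proof.
intros Hab Hf Hy.
destruct (Ranalysis5.IVT_interv (fun t => f t - y) a b) as (z & Hz & E); auto; try lra.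
- intros t Ht; apply continuity_pt_filterlim.
  apply (continuous_minus f (fun _ => y)); [apply Hf, Ht|apply continuous_const].
- exists z; split; [|lra].
  assert (z <> a) by (intros ->; lra); assert (z <> b) by (intros ->; lra); lra.
Qed.

Lemma sign_const f a b : a < b ->
  (forall t, a <= t <= b -> continuous f t) -> (forall t, a <= t <= b -> f t <> 0) ->
  (forall t, a <= t <= b -> 0 < f t) \/ (forall t, a <= t <= b -> f t < 0).
Proof.
intros Hab cf nf.
assert (Ha : f a <> 0) by (apply nf; lra).
destruct (Rdichotomy _ _ Ha) as [H|H]; [right|left]; intros t Ht;
  (destruct (Req_dec t a) as [->|Hta]; [assumption|]);
  apply Rnot_le_lt; intros Hle; specialize (nf t Ht) as Hn.
- destruct (ivt_between f a t 0) as (z & Hz & E); [lra|intros; apply cf; lra|lra|].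
  apply (nf z); [lra|exact E].
- destruct (ivt_between (fun t => - f t) a t 0) as (z & Hz & E); [lra| |lra|].
  + intros u Hu; apply (continuous_opp f), cf; lra.
  + apply (nf z); [lra|lra].
Qed.

Lemma increasing_of_derive f df a b :
  (forall t, a <= t <= b -> is_derive f t (df t)) -> (forall t, a <= t <= b -> 0 < df t) ->
  forall s t, a <= s -> s < t -> t <= b -> f s < f t.
Proof.
intros Hd Hp s t Hs Hst Ht.
destruct (MVT_gen f s t df) as (c & Hc & E); rewrite ?Rmin_left, ?Rmax_right in * by lra.
- intros; apply Hd; lra.
- intros u Hu; apply continuity_pt_filterlim, (ex_derive_continuous f); eexists; apply Hd; lra.
- assert (0 < df c * (t - s)) by (apply Rmult_lt_0_compat; [apply Hp|]; lra); lra.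
Qed.

Section CurveGraph.
Variables (U V U1 V1 U2 V2 : R -> R).

Definition graph_of_curve (a b : R) : Prop :=
  exists c d g, c < d /\
  (forall x, c < x < d <-> exists t, a < t < b /\ x = U t) /\
  (forall t, a < t < b -> g (U t) = V t /\ is_derive g (U t) (V1 t / U1 t) /\
     is_derive (Derive g) (U t) ((U1 t * V2 t - V1 t * U2 t) / U1 t ^ 3)).

(** The inverse [T] of the increasing function [U] turns the curve into the graph of [V] composed
    with [T]. The closed interval in the hypothesis supplies the end points [U a] and [U b] of the
    domain. *)
Lemma curve_graph_pos a b : a < b ->
  (forall t, a <= t <= b -> is_derive U t (U1 t) /\ is_derive V t (V1 t) /\
     is_derive U1 t (U2 t) /\ is_derive V1 t (V2 t) /\ 0 < U1 t) ->
  graph_of_curve a b.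
Proof.
intros Hab H.
assert (Hinc := increasing_of_derive U U1 a b (fun t Ht => proj1 (H t Ht))
  (fun t Ht => proj2 (proj2 (proj2 (proj2 (H t Ht)))))).
assert (cU : forall t, a <= t <= b -> continuous U t)
  by (intros t Ht; apply (ex_derive_continuous U); exists (U1 t); exact (proj1 (H t Ht))).
pose (T := fun x => epsilon (inhabits 0) (fun t => a < t < b /\ U t = x)).
assert (TU : forall t, a < t < b -> T (U t) = t).
{ intros t Ht.
  destruct (epsilon_spec (inhabits 0) (fun s => a < s < b /\ U s = U t)) as (H1 & H2);
    [exists t; auto|].
  fold (T (U t)) in H1, H2.
  destruct (Rtotal_order (T (U t)) t) as [Hl|[He|Hl]]; auto; exfalso.
  - specialize (Hinc (T (U t)) t); lra.
  - specialize (Hinc t (T (U t))); lra. }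
assert (Himg : forall x, U a < x < U b <-> exists t, a < t < b /\ x = U t).
{ intros x; split.
  - intros Hx; destruct (ivt_between U a b x) as (t & Ht & E); auto; exists t; auto.
  - intros (t & Ht & ->); split; apply Hinc; lra. }
assert (cT : forall t, a < t < b -> continuous T (U t)).
{ intros t Ht; apply filterlim_locally; intros eps.
  set (e := Rmin (eps / 2) (Rmin ((t - a) / 2) ((b - t) / 2))).
  assert (He : 0 < e) by (pose proof (cond_pos eps); repeat apply Rmin_glb_lt; lra).
  assert (He1 : e <= eps / 2) by apply Rmin_l.
  assert (He2 : e <= (t - a) / 2) by (unfold e; abs_lra).
  assert (He3 : e <= (b - t) / 2) by (unfold e; abs_lra).
  assert (H1 : U (t - e) < U t) by (apply Hinc; lra).
  assert (H2 : U t < U (t + e)) by (apply Hinc; lra).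
  assert (Hd : 0 < Rmin (U t - U (t - e)) (U (t + e) - U t)) by (apply Rmin_glb_lt; lra).
  exists (mkposreal _ Hd); intros x Hx.
  change (Rabs (x - U t) < Rmin (U t - U (t - e)) (U (t + e) - U t)) in Hx.
  pose proof (Rmin_l (U t - U (t - e)) (U (t + e) - U t)).
  pose proof (Rmin_r (U t - U (t - e)) (U (t + e) - U t)).
  apply Rabs_def2 in Hx.
  destruct (ivt_between U (t - e) (t + e) x) as (s & Hs & <-); [lra|intros; apply cU; lra|lra|].
  change (Rabs (T (U s) - T (U t)) < eps); rewrite !TU by lra.
  abs_lra. }
assert (dT : forall t, a < t < b -> is_derive T (U t) (/ U1 t)).
{ intros t Ht; destruct (H t) as (dU & _ & _ & _ & Hp); [lra|].
  (* With a constant second coordinate the rule reduces to the derivative of an inverse function. *)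
  destruct (implicit_derive (fun x _ => U x) (fun _ y => y) T (fun _ => 0) (U t)
    (U1 t) 0 0 1 1 0) as (Hd & _).
  - rewrite TU by exact Ht.
    apply differentiable_pt_lim_proj1_0, is_derive_Reals, dU.
  - intros eps; exists (mkposreal 1 Rlt_0_1); intros u v _ _.
    replace (v - 0 - (0 * (u - T (U t)) + 1 * (v - 0))) with 0 by ring.
    rewrite Rabs_R0; apply Rmult_le_pos; [apply Rlt_le, cond_pos|].
    eapply Rle_trans; [apply Rabs_pos|apply Rmax_l].
  - lra.
  - apply cT, Ht.
  - apply continuous_const.
  - apply (is_derive_ext_loc (fun x => x)); [|apply @is_derive_id].
    assert (Hx : U a < U t < U b) by (apply Himg; exists t; auto).
    apply (filter_imp (fun x => U a < x < U b)).
    + intros x Hx'; apply Himg in Hx'; destruct Hx' as (s & Hs & ->); rewrite TU; auto.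
    + apply filter_and; [apply (open_gt (U a))|apply (open_lt (U b))]; lra.
  - apply @is_derive_const.
  - replace (/ U1 t) with ((1 * 1 - 0 * 0) / (U1 t * 1 - 0 * 0)) by (field; lra); exact Hd. }
exists (U a), (U b), (fun x => V (T x)); split; [apply Hinc; lra|split; [exact Himg|]].
assert (dg : forall t, a < t < b -> is_derive (fun x => V (T x)) (U t) (V1 t / U1 t)).
{ intros t Ht; destruct (H t) as (_ & dV & _ & _ & Hp); [lra|].
  replace (V1 t / U1 t) with (scal (/ U1 t) (V1 t)) by (unfold scal; simpl; unfold mult; simpl; field; lra).
  apply (is_derive_comp V T); [rewrite TU by exact Ht; exact dV|apply dT, Ht]. }
intros t Ht; split; [rewrite TU; auto|split; [apply dg, Ht|]].
destruct (H t) as (_ & _ & dU1 & dV1 & Hp); [lra|].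
apply (is_derive_ext_loc (fun x => V1 (T x) / U1 (T x))).
- assert (Hx : U a < U t < U b) by (apply Himg; exists t; auto).
  apply (filter_imp (fun x => U a < x < U b)).
  + intros x Hx'; apply Himg in Hx'; destruct Hx' as (s & Hs & ->); rewrite TU by auto.
    symmetry; apply is_derive_unique, dg, Hs.
  + apply filter_and; [apply (open_gt (U a))|apply (open_lt (U b))]; lra.
- replace ((U1 t * V2 t - V1 t * U2 t) / U1 t ^ 3)
    with (scal (/ U1 t) ((V2 t * U1 t - V1 t * U2 t) / U1 t ^ 2))
    by (unfold scal; simpl; unfold mult; simpl; field; lra).
  apply (is_derive_comp (fun s => V1 s / U1 s) T); [rewrite TU by exact Ht|apply dT, Ht].
  apply is_derive_div; auto; lra.
Qed.
End CurveGraph.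

(** When [U1] is negative the parameter is reversed, which changes neither the image nor the two
    quotients. *)
Lemma curve_graph U V U1 V1 U2 V2 a b : a < b ->
  (forall t, a <= t <= b -> is_derive U t (U1 t) /\ is_derive V t (V1 t) /\
     is_derive U1 t (U2 t) /\ is_derive V1 t (V2 t) /\ U1 t <> 0) ->
  graph_of_curve U V U1 V1 U2 V2 a b.
Proof.
intros Hab H.
destruct (sign_const U1 a b Hab) as [Hp|Hn].
- intros t Ht; apply (ex_derive_continuous U1); exists (U2 t).
  exact (proj1 (proj2 (proj2 (H t Ht)))).
- intros t Ht; exact (proj2 (proj2 (proj2 (proj2 (H t Ht))))).
- apply curve_graph_pos; auto; intros t Ht; destruct (H t Ht) as (dU & dV & dU1 & dV1 & _).
  exact (conj dU (conj dV (conj dU1 (conj dV1 (Hp t Ht))))).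
- assert (dopp : forall f df s, is_derive f (- s) df -> is_derive (fun t => f (- t)) s (- df)).
  { intros f df s Hf; replace (- df) with (scal (-1) df)
      by (unfold scal; simpl; unfold mult; simpl; ring).
    apply (is_derive_comp f Ropp); [exact Hf|].
    apply (is_derive_opp (fun t => t) s 1); apply @is_derive_id. }
  assert (dopp' : forall f df s, is_derive f (- s) df -> is_derive (fun t => - f (- t)) s df).
  { intros f df s Hf; rewrite <- (Ropp_involutive df).
    apply (is_derive_opp (fun t => f (- t))), dopp, Hf. }
  destruct (curve_graph_pos (fun t => U (- t)) (fun t => V (- t)) (fun t => - U1 (- t))
    (fun t => - V1 (- t)) (fun t => U2 (- t)) (fun t => V2 (- t)) (- b) (- a))
    as (c & d & g & Hcd & Himg & Hg).
  + lra.
  + intros t Ht; destruct (H (- t)) as (? & ? & ? & ? & _); [lra|].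
    specialize (Hn (- t) ltac:(lra)).
    split; [|split; [|split; [|split]]]; auto; lra.
  + exists c, d, g; split; [exact Hcd|split].
    * intros x; rewrite Himg; split; intros (t & Ht & ->); exists (- t);
        (split; [lra|]); rewrite ?Ropp_involutive; reflexivity.
    * intros t Ht; destruct (Hg (- t)) as (E & D1 & D2); [lra|].
      rewrite Ropp_involutive in *; specialize (Hn t ltac:(lra)).
      split; [exact E|split].
      -- replace (V1 t / U1 t) with (- V1 t / - U1 t) by (field; lra); exact D1.
      -- replace ((U1 t * V2 t - V1 t * U2 t) / U1 t ^ 3)
           with ((- U1 t * V2 t - - V1 t * U2 t) / (- U1 t) ^ 3) by (field; lra); exact D2.
Qed.

(** Continuation in time: [P] at [s] itself has to be derived from strictly earlier times, which is
    what a mean value theorem with interior intermediate point can use. *)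
Lemma real_induction (P : R -> Prop) (T : R) :
  (forall s, 0 <= s < T -> (forall u, 0 <= u < s -> P u) ->
     exists d, 0 < d /\ forall u, 0 <= u < s + d -> u < T -> P u) ->
  forall s, 0 <= s < T -> P s.
Proof.
intros H s Hs.
pose (S := fun x => 0 <= x <= s /\ forall u, 0 <= u < x -> P u).
destruct (completeness S) as (m & Hub & Hlub).
- exists s; intros x Hx; apply Hx.
- exists 0; split; [lra|intros; lra].
- assert (H0m : 0 <= m) by (apply Hub; split; [lra|intros; lra]).
  assert (Hms : m <= s) by (apply Hlub; intros x Hx; apply Hx).
  assert (Hbelow : forall u, 0 <= u < m -> P u).
  { intros u Hu; destruct (classic (exists x, S x /\ u < x)) as [(x & Hx & Hux)|Hn].
    - apply Hx; lra.
    - exfalso; assert (m <= u); [|lra].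
      apply Hlub; intros x Hx; apply Rnot_lt_le; intros Hlt; apply Hn; exists x; auto. }
  destruct (H m) as (d & Hd & Hd2); [lra|exact Hbelow|].
  destruct (Rle_lt_dec s (m + d / 2)) as [Hle|Hlt].
  + apply Hd2; lra.
  + exfalso; assert (m + d / 2 <= m); [|lra].
    apply Hub; split; [lra|intros u Hu; apply Hd2; lra].
Qed.

(** Mean value theorem for [D (Y0 + s) + D (Y0 - s) - A * s ^ 2], whose derivative is the bounded
    quantity. It serves the limit [w] and the difference quotients alike. *)
Lemma second_difference_bound (D D1 : R -> R) (Y0 A e k : R) : 0 <= k -> 0 <= e ->
  (forall y, Rabs (y - Y0) <= k -> is_derive D y (D1 y)) ->
  (forall s, 0 <= s <= k -> Rabs (D1 (Y0 + s) - D1 (Y0 - s) - 2 * A * s) <= e * s) ->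
  Rabs (D (Y0 + k) - 2 * D Y0 + D (Y0 - k) - A * k ^ 2) <= e * k ^ 2.
Proof.
intros Hk He HD HD1.
pose proof (mvt_bound (fun s => D (Y0 + s) + D (Y0 - s) - A * s ^ 2)
  (fun s => D1 (Y0 + s) - D1 (Y0 - s) - 2 * A * s) (e * k) 0 k) as Hm.
cbv beta in Hm; rewrite Rmin_left, Rmax_right in Hm by lra.
replace (D (Y0 + k) - 2 * D Y0 + D (Y0 - k) - A * k ^ 2) with
  (D (Y0 + k) + D (Y0 - k) - A * k ^ 2 - (D (Y0 + 0) + D (Y0 - 0) - A * 0 ^ 2))
  by (rewrite Rplus_0_r, Rminus_0_r; ring).
replace (e * k ^ 2) with (e * k * Rabs (k - 0)) by (rewrite Rminus_0_r, Rabs_right by lra; ring).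
apply Hm.
- intros s Hs.
  assert (E1 : is_derive (fun s => D (Y0 + s)) s (D1 (Y0 + s))).
  { replace (D1 (Y0 + s)) with (scal 1 (D1 (Y0 + s))) by (unfold scal; simpl; unfold mult; simpl; ring).
    apply (is_derive_comp D (fun s => Y0 + s)).
    - apply HD; replace (Y0 + s - Y0) with s by ring; rewrite Rabs_right; lra.
    - replace 1 with (0 + 1) by ring.
      apply (is_derive_plus (fun _ => Y0) (fun s => s)); [apply @is_derive_const|apply @is_derive_id]. }
  assert (E2 : is_derive (fun s => D (Y0 - s)) s (- D1 (Y0 - s))).
  { replace (- D1 (Y0 - s)) with (scal (-1) (D1 (Y0 - s)))
      by (unfold scal; simpl; unfold mult; simpl; ring).
    apply (is_derive_comp D (fun s => Y0 - s)).
    - apply HD; replace (Y0 - s - Y0) with (- s) by ring; rewrite Rabs_Ropp, Rabs_right; lra.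
    - replace (-1) with (0 - 1) by ring.
      apply (is_derive_minus (fun _ => Y0) (fun s => s)); [apply @is_derive_const|apply @is_derive_id]. }
  apply (is_derive_minus (fun s => D (Y0 + s) + D (Y0 - s)) (fun s => A * s ^ 2)).
  + apply (is_derive_plus (fun s => D (Y0 + s)) (fun s => D (Y0 - s)) s _ _ E1 E2).
  + auto_derive; [trivial|ring].
- intros s Hs; eapply Rle_trans; [apply HD1; lra|apply Rmult_le_compat_l; lra].
Qed.

(* A difference quotient of solutions of [h'' = - (h^2 / 2 + q)] solves
   [D'' = - ((h_t + h) / 2) D]; its locally uniform limit [w] therefore solves
   [w'' = - h w].  No derivative of [h_t] with respect to [t] is needed: the
   second differences of [w] are limits of those of [D]. *)
Lemma variation_equation (k0 Y0 W2 : R) (h q w w1 : R -> R) (ht : R -> R -> R) (t0 : R) :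
  0 < k0 -> 0 < t0 ->
  (forall y, Rabs (y - Y0) < k0 -> ex_derive h y /\ is_derive (Derive h) y (- (h y ^ 2 / 2 + q y))) ->
  (forall t, 0 < t < t0 -> forall y, Rabs (y - Y0) < k0 ->
     ex_derive (ht t) y /\ is_derive (Derive (ht t)) y (- (ht t y ^ 2 / 2 + q y))) ->
  (forall y1, Rabs (y1 - Y0) < k0 -> forall e, 0 < e -> exists d, 0 < d /\
     forall t y, 0 < t < d -> Rabs (y - y1) < d -> Rabs ((ht t y - h y) / t - w y1) < e) ->
  (forall y, Rabs (y - Y0) < k0 -> is_derive w y (w1 y)) -> is_derive w1 Y0 W2 ->
  W2 = - h Y0 * w Y0.
Proof.
intros Hk0 Ht0 Hh Hht Hlim Hw Hw1.
set (A := - h Y0 * w Y0).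
apply Rminus_diag_uniq; apply cond_eq; intros e0 He0; rewrite Rminus_0_r.
(* The second difference of [w] with step [k] is [W2 * k ^ 2] up to [2 * e * k ^ 2] by [B2], and
   [A * k ^ 2] up to [5 * e * k ^ 2] by [B3]; the total [7 * e] is below [e0]. *)
set (e := e0 / 8); assert (He : 0 < e) by (unfold e; lra).
assert (HY0 : Rabs (Y0 - Y0) < k0) by (rewrite Rminus_diag, Rabs_R0; lra).
assert (ch : continuous h Y0) by (apply (ex_derive_continuous h), (Hh Y0 HY0)).
set (M := Rabs (w Y0) + Rabs (h Y0) + 2).
assert (HM : 2 <= M) by (pose proof (Rabs_pos (w Y0)); pose proof (Rabs_pos (h Y0)); unfold M; lra).
set (e1 := Rmin 1 (e / M)).
assert (He1 : 0 < e1) by (apply Rmin_glb_lt; [lra|apply Rdiv_lt_0_compat; lra]).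
assert (He1M : e1 * M <= e).
{ apply Rle_trans with (e / M * M); [apply Rmult_le_compat_r; [lra|apply Rmin_r]|right; field; lra]. }
assert (He11 : e1 <= 1) by apply Rmin_l.
destruct (continuous_abs_near h Y0 (e1 / 2) ch) as (d1 & Hd1 & N1); [lra|].
destruct (Hlim Y0 HY0 e1 He1) as (d2 & Hd2 & N2).
apply is_derive_Reals in Hw1; destruct (Hw1 e He) as (d3 & N3).
set (k := Rmin (Rmin d1 d2) (Rmin d3 k0) / 2).
assert (Hmin : 0 < Rmin (Rmin d1 d2) (Rmin d3 k0))
  by (repeat apply Rmin_glb_lt; auto; apply cond_pos).
assert (Hk : 0 < k) by (unfold k; lra).
assert (Hkk : k < d1 /\ k < d2 /\ k < d3 /\ k < k0).
{ unfold k in *; abs_lra. }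
destruct Hkk as (K1 & K2 & K3 & K4).
assert (B2 : Rabs (w (Y0 + k) - 2 * w Y0 + w (Y0 - k) - W2 * k ^ 2) <= 2 * e * k ^ 2).
{ apply (second_difference_bound w w1); [lra|lra| |].
  - intros y Hy; apply Hw; lra.
  - intros s Hs; destruct (Req_dec s 0) as [->|Hs0].
    + rewrite Rplus_0_r, Rminus_0_r, Rminus_diag, !Rmult_0_r, Rminus_0_r, Rabs_R0; lra.
    + assert (As : Rabs s < d3) by (rewrite Rabs_right; lra).
      pose proof (N3 s Hs0 As) as P1.
      assert (As' : Rabs (- s) < d3) by (rewrite Rabs_Ropp; exact As).
      pose proof (N3 (- s) (Ropp_neq_0_compat _ Hs0) As') as P2.
      replace (Y0 - s) with (Y0 + - s) by ring.
      replace (w1 (Y0 + s) - w1 (Y0 + - s) - 2 * W2 * s) with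
        (s * (((w1 (Y0 + s) - w1 Y0) / s - W2) + ((w1 (Y0 + - s) - w1 Y0) / - s - W2)))
        by (field; lra).
      rewrite Rabs_mult, (Rabs_right s) by lra; rewrite (Rmult_comm _ s).
      apply Rmult_le_compat_l; [lra|].
      abs_lra. }
(* The step [k] is fixed and the estimate is uniform in [t], so that [t] can tend to 0
   afterwards. *)
assert (B1 : forall t, 0 < t -> t < d2 -> t < t0 -> t * M < e1 / 2 ->
  Rabs ((ht t (Y0 + k) - h (Y0 + k)) / t - 2 * ((ht t Y0 - h Y0) / t)
    + (ht t (Y0 - k) - h (Y0 - k)) / t - A * k ^ 2) <= 4 * e * k ^ 2).
{ intros t Hta Htb Htc Htd.
  assert (HDD : forall y, Rabs (y - Y0) <= k ->
    Rabs (- ((ht t y + h y) / 2) * ((ht t y - h y) / t) - A) <= 2 * e).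
  { intros y Hy; specialize (N1 y ltac:(lra)); specialize (N2 t y (conj Hta Htb) ltac:(lra)).
    set (Dy := (ht t y - h y) / t) in *.
    assert (Eht : ht t y = h y + t * Dy) by (unfold Dy; field; lra).
    assert (BD : Rabs Dy <= M - 1).
    { replace Dy with ((Dy - w Y0) + w Y0) by ring; eapply Rle_trans; [apply Rabs_triang|].
      pose proof (Rabs_pos (h Y0)); unfold M; lra. }
    replace (- ((ht t y + h y) / 2) * Dy - A) with
      (- ((h y - h Y0) + t * Dy / 2) * Dy - h Y0 * (Dy - w Y0)) by (rewrite Eht; unfold A; field).
    assert (T1 : Rabs ((h y - h Y0) + t * Dy / 2) <= e1).
    { eapply Rle_trans; [apply Rabs_triang|].
      assert (Rabs (t * Dy / 2) <= e1 / 2); [|lra].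
      unfold Rdiv at 1; rewrite !Rabs_mult, (Rabs_right t), (Rabs_right (/ 2)) by lra.
      assert (t * Rabs Dy <= t * M) by (apply Rmult_le_compat_l; lra).
      abs_lra. }
    unfold Rminus at 1; eapply Rle_trans; [apply Rabs_triang|].
    rewrite Rabs_Ropp, !Rabs_mult, Rabs_Ropp.
    assert (T2 : Rabs (h y - h Y0 + t * Dy / 2) * Rabs Dy <= e1 * M)
      by (apply Rmult_le_compat; try apply Rabs_pos; lra).
    assert (T3 : Rabs (h Y0) * Rabs (Dy - w Y0) <= M * e1).
    { apply Rmult_le_compat; try apply Rabs_pos; [|lra].
      pose proof (Rabs_pos (w Y0)); unfold M; lra. }
    lra. }
  apply (second_difference_bound (fun y => (ht t y - h y) / t)
    (fun y => (Derive (ht t) y - Derive h y) / t)); [lra|lra| |].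
  - intros y Hy; destruct (Hh y ltac:(lra)) as (D1 & _).
    destruct (Hht t ltac:(lra) y ltac:(lra)) as (D2 & _).
    unfold Rdiv; rewrite (Rmult_comm _ (/ t)).
    apply (is_derive_ext (fun y => / t * (ht t y - h y))); [intros; apply Rmult_comm|].
    apply is_derive_scal, @is_derive_minus; apply Derive_correct; assumption.
  - intros s Hs.
    pose proof (mvt_bound (fun y => (Derive (ht t) y - Derive h y) / t - A * y)
      (fun y => - ((ht t y + h y) / 2) * ((ht t y - h y) / t) - A) (2 * e) (Y0 - s) (Y0 + s)) as Hm.
    cbv beta in Hm.
    replace ((Derive (ht t) (Y0 + s) - Derive h (Y0 + s)) / t
      - (Derive (ht t) (Y0 - s) - Derive h (Y0 - s)) / t - 2 * A * s) with
     ((Derive (ht t) (Y0 + s) - Derive h (Y0 + s)) / t - A * (Y0 + s) -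
      ((Derive (ht t) (Y0 - s) - Derive h (Y0 - s)) / t - A * (Y0 - s))) by ring.
    replace (4 * e * s) with (2 * e * Rabs (Y0 + s - (Y0 - s)))
      by (replace (Y0 + s - (Y0 - s)) with (2 * s) by ring; rewrite Rabs_right; lra).
    rewrite Rmin_left, Rmax_right in Hm by lra.
    assert (Hin : forall y, Y0 - s <= y <= Y0 + s -> Rabs (y - Y0) <= k)
      by (intros y Hy; apply Rabs_le; lra).
    apply Hm; [|intros; apply HDD, Hin; auto].
    intros y Hy; specialize (Hin y Hy).
    destruct (Hh y ltac:(lra)) as (_ & D1); destruct (Hht t ltac:(lra) y ltac:(lra)) as (_ & D2).
    apply (is_derive_minus (fun y => (Derive (ht t) y - Derive h y) / t) (fun y => A * y)).
    + replace (- ((ht t y + h y) / 2) * ((ht t y - h y) / t)) with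
        (/ t * (- (ht t y ^ 2 / 2 + q y) - - (h y ^ 2 / 2 + q y))) by (field; lra).
      apply (is_derive_ext (fun y => / t * (Derive (ht t) y - Derive h y))); [intros; apply Rmult_comm|].
      apply is_derive_scal; exact (is_derive_minus _ _ _ _ _ D2 D1).
    + auto_derive; [trivial|ring]. }
assert (Hek : 0 < e * k ^ 2) by (apply Rmult_lt_0_compat; [lra|apply pow_lt; lra]).
(* The limit in [t] is taken at three points only. Tolerance [e * k ^ 2 / 4] with weights 1, 2, 1
   adds one [e * k ^ 2] to the bound of [B1]. *)
assert (B3 : Rabs (w (Y0 + k) - 2 * w Y0 + w (Y0 - k) - A * k ^ 2) <= 5 * (e * k ^ 2)).
{ assert (e4 : 0 < e * k ^ 2 / 4) by lra.
  destruct (Hlim (Y0 + k)) with (e := e * k ^ 2 / 4) as (c1 & Hc1 & L1);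
    [replace (Y0 + k - Y0) with k by ring; rewrite Rabs_right; lra|lra|].
  destruct (Hlim (Y0 - k)) with (e := e * k ^ 2 / 4) as (c2 & Hc2 & L2);
    [replace (Y0 - k - Y0) with (- k) by ring; rewrite Rabs_Ropp, Rabs_right; lra|lra|].
  destruct (Hlim Y0 HY0) with (e := e * k ^ 2 / 4) as (c3 & Hc3 & L3); [lra|].
  set (t := Rmin (Rmin (Rmin c1 c2) (Rmin c3 d2)) (Rmin t0 (e1 / (2 * M))) / 2).
  assert (Hmm : 0 < Rmin (Rmin (Rmin c1 c2) (Rmin c3 d2)) (Rmin t0 (e1 / (2 * M))))
    by (repeat apply Rmin_glb_lt; auto; apply Rdiv_lt_0_compat; lra).
  assert (Ht : 0 < t) by (unfold t; lra).
  assert (Hts : t < c1 /\ t < c2 /\ t < c3 /\ t < d2 /\ t < t0 /\ t < e1 / (2 * M)).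
  { unfold t in *; abs_lra. }
  destruct Hts as (T1 & T2 & T3 & T4 & T5 & T6).
  assert (T7 : t * M < e1 / 2).
  { apply (Rmult_lt_compat_r M) in T6; [|lra].
    replace (e1 / (2 * M) * M) with (e1 / 2) in T6 by (field; lra); exact T6. }
  specialize (B1 t Ht T4 T5 T7).
  specialize (L1 t (Y0 + k) (conj Ht T1)); specialize (L2 t (Y0 - k) (conj Ht T2));
  specialize (L3 t Y0 (conj Ht T3)).
  rewrite Rminus_diag, Rabs_R0 in L1, L2, L3.
  abs_lra. }
apply Rabs_le_between in B2; apply Rabs_le_between in B3.
assert (Hk2 : 0 < k ^ 2) by (apply pow_lt; lra).
assert (B4 : Rabs ((W2 - A) * k ^ 2) <= 7 * e * k ^ 2) by (apply Rabs_le; lra).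
rewrite Rabs_mult, (Rabs_right (k ^ 2)) in B4 by lra.
apply Rmult_le_reg_r in B4; [|exact Hk2]; unfold e in B4; lra.
Qed.

(** * Estimates for local flows *)

Definition fint (f : R -> R -> R) (x y u v : R) : R := dx f x y * u + dy f x y * v.

Lemma smooth_lipschitz p r f : 0 < r -> smooth_on p r f ->
  exists R0 N, 0 < R0 /\ R0 <= r /\ 0 < N /\
   (forall x y, in_box p R0 x y -> Rabs (f x y) <= N) /\
   (forall x y x' y', in_box p R0 x y -> in_box p R0 x' y' ->
     Rabs (f x y - f x' y') <= N * dist1 x y x' y').
Proof.
intros Hr sf.
assert (Hp : in_box p r (fst p) (snd p)) by (apply in_box_center, Hr).
assert (Hnear : forall g, smooth_on p r g ->
  near p (fun x y => Rabs (g x y) <= Rabs (g (fst p) (snd p)) + 1)).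
{ intros g sg; destruct (smooth_cont p r g _ _ sg Hp (mkposreal 1 Rlt_0_1)) as (d & Hd).
  exists d; intros x y Hx Hy; specialize (Hd x y Hx Hy); simpl in Hd.
  abs_lra. }
assert (Hn := near_and _ _ _ (Hnear f sf)
  (near_and _ _ _ (Hnear _ (smooth_dx p r f sf)) (Hnear _ (smooth_dy p r f sf)))).
apply near_box in Hn; destruct Hn as (r2 & Hr2 & Hn).
set (N := Rabs (f (fst p) (snd p)) + Rabs (dx f (fst p) (snd p)) + Rabs (dy f (fst p) (snd p)) + 1).
pose proof (Rabs_pos (f (fst p) (snd p))); pose proof (Rabs_pos (dx f (fst p) (snd p)));
pose proof (Rabs_pos (dy f (fst p) (snd p))).
exists (Rmin r r2), N; split; [apply Rmin_glb_lt; auto|split; [apply Rmin_l|split; [unfold N; lra|]]].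
assert (Hb : forall x y, in_box p (Rmin r r2) x y -> in_box p r2 x y)
  by (intros; apply (in_box_le p (Rmin r r2)); auto; apply Rmin_r).
split.
- intros x y Hxy; destruct (Hn x y (Hb _ _ Hxy)) as (H2 & _); unfold N; lra.
- intros x y x' y' Hxy Hxy'.
  replace (f x y - f x' y') with (f x y - f x' y' - (0 * (x - x') + 0 * (y - y'))) by ring.
  apply (increment_bound p (Rmin r r2)); auto; [apply (smooth_on_le p r); auto; apply Rmin_l|].
  intros a b Hab; destruct (Hn a b (Hb _ _ Hab)) as (_ & H2 & H3); rewrite !Rminus_0_r.
  unfold N; split; lra.
Qed.

Section Flow.
Variables (p : R * R) (xi eta : R -> R -> R) (eps : R) (u v : R -> R -> R -> R) (R0 M : R).
Hypotheses (Hflow : local_flow p xi eta eps u v) (HR0 : 0 < R0) (HR0e : R0 <= eps) (HM : 0 < M).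
Hypothesis BM : forall x y, in_box p R0 x y -> Rabs (xi x y) <= M /\ Rabs (eta x y) <= M.
Hypothesis LM : forall x y x' y', in_box p R0 x y -> in_box p R0 x' y' ->
   Rabs (xi x y - xi x' y') <= M * dist1 x y x' y' /\
   Rabs (eta x y - eta x' y') <= M * dist1 x y x' y'.

Let half_eps x y : in_box p (R0 / 2) x y -> in_box p eps x y.
Proof. apply in_box_le; lra. Qed.

Lemma flow_start x y : in_box p (R0 / 2) x y -> u 0 x y = x /\ v 0 x y = y.
Proof. intros H; destruct (Hflow x y (half_eps x y H)) as (H1 & H2 & _); auto. Qed.

Lemma flow_d x y t : in_box p (R0 / 2) x y -> 0 <= t < eps ->
  is_derive (fun s => u s x y) t (xi (u t x y) (v t x y)) /\
  is_derive (fun s => v s x y) t (eta (u t x y) (v t x y)).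
Proof.
intros H Ht; destruct (Hflow x y (half_eps x y H)) as (_ & _ & H3).
apply H3; rewrite Rabs_right; lra.
Qed.

Lemma mvt_interior (f df : R -> R) t : 0 < t ->
  (forall s, 0 <= s <= t -> is_derive f s (df s)) ->
  exists c, 0 < c < t /\ f t - f 0 = t * df c.
Proof.
intros Ht H; destruct (MVT_cor2 f df 0 t Ht) as (c & E & Hc).
- intros s Hs; apply is_derive_Reals, H, Hs.
- exists c; split; [exact Hc|rewrite E; ring].
Qed.

(** At speed at most [M], leaving the box from its half takes at least the time [R0 / (2 * M)]. The
    speed bound holds only inside the box, hence the induction on time. *)
Lemma flow_stays x y t : in_box p (R0 / 2) x y -> 0 <= t < Rmin eps (R0 / (2 * M)) ->
  in_box p R0 (u t x y) (v t x y) /\ Rabs (u t x y - x) <= M * t /\ Rabs (v t x y - y) <= M * t.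
Proof.
intros Hb Ht.
assert (Hm1 := Rmin_l eps (R0 / (2 * M))); assert (Hm2 := Rmin_r eps (R0 / (2 * M))).
destruct (flow_start x y Hb) as (Eu & Ev).
assert (Hstep : forall s, 0 <= s < Rmin eps (R0 / (2 * M)) ->
  (forall w, 0 <= w < s -> in_box p R0 (u w x y) (v w x y)) ->
  in_box p R0 (u s x y) (v s x y) /\ Rabs (u s x y - x) <= M * s /\ Rabs (v s x y - y) <= M * s).
{ intros s Hs Hin.
  assert (Hd : Rabs (u s x y - x) <= M * s /\ Rabs (v s x y - y) <= M * s).
  { destruct (Req_dec s 0) as [->|Hs0].
    - abs_lra.
    - destruct (mvt_interior (fun s => u s x y) (fun s => xi (u s x y) (v s x y)) s) as (c1 & Hc1 & E1);
        [lra|intros w Hw; apply (flow_d x y w Hb); lra|].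
      destruct (mvt_interior (fun s => v s x y) (fun s => eta (u s x y) (v s x y)) s) as (c2 & Hc2 & E2);
        [lra|intros w Hw; apply (flow_d x y w Hb); lra|].
      rewrite Eu in E1; rewrite Ev in E2; rewrite E1, E2, !Rabs_mult, (Rabs_right s), !(Rmult_comm s) by lra.
      split; apply Rmult_le_compat_r; try lra; apply BM, Hin; lra. }
  split; [|exact Hd].
  assert (HMs : M * s < R0 / 2).
  { apply Rlt_le_trans with (M * (R0 / (2 * M))); [apply Rmult_lt_compat_l; lra|right; field; lra]. }
  destruct Hb as (B1 & B2); destruct Hd as (D1 & D2); split.
  - abs_lra.
  - abs_lra. }
assert (Hall : forall s, 0 <= s < Rmin eps (R0 / (2 * M)) -> in_box p R0 (u s x y) (v s x y)).
{ apply real_induction; intros s Hs Hin.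
  destruct (Hstep s Hs Hin) as (Hbs & _).
  destruct (in_box_open _ _ _ _ Hbs) as (e & He & Hopen).
  destruct (flow_d x y s Hb ltac:(lra)) as (D1 & D2).
  destruct (continuous_abs_near (fun s => u s x y) s e) as (d1 & Hd1 & N1);
    [apply (ex_derive_continuous (fun s => u s x y)); eexists; exact D1|exact He|].
  destruct (continuous_abs_near (fun s => v s x y) s e) as (d2 & Hd2 & N2);
    [apply (ex_derive_continuous (fun s => v s x y)); eexists; exact D2|exact He|].
  exists (Rmin d1 d2); split; [apply Rmin_glb_lt; auto|].
  intros w Hw _; destruct (Rlt_le_dec w s) as [Hlt|Hle]; [apply Hin; lra|].
  pose proof (Rmin_l d1 d2); pose proof (Rmin_r d1 d2).
  apply Hopen; [apply N1|apply N2]; rewrite Rabs_right; lra. }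
apply Hstep; auto; intros w Hw; apply Hall; lra.
Qed.

(** A bootstrap in place of an exponential estimate: as long as the distance is below twice its
    initial value [d0], it grows at rate at most [4 * M * d0], which cannot double it before time
    [/ (4 * M)]. *)
Lemma flow_close x y x' y' t : in_box p (R0 / 2) x y -> in_box p (R0 / 2) x' y' ->
  0 <= t < Rmin (Rmin eps (R0 / (2 * M))) (/ (4 * M)) ->
  dist1 (u t x y) (v t x y) (u t x' y') (v t x' y') <= 2 * dist1 x y x' y'.
Proof.
intros Hb Hb' Ht.
set (T := Rmin (Rmin eps (R0 / (2 * M))) (/ (4 * M))) in *.
assert (HT1 : T <= Rmin eps (R0 / (2 * M))) by apply Rmin_l.
assert (HT2 : T <= / (4 * M)) by apply Rmin_r.
assert (HT3 : T <= eps) by (eapply Rle_trans; [exact HT1|apply Rmin_l]).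
destruct (flow_start x y Hb) as (Eu & Ev); destruct (flow_start x' y' Hb') as (Eu' & Ev').
set (d0 := dist1 x y x' y').
destruct (Req_dec d0 0) as [Hd0|Hd0].
{ assert (x = x' /\ y = y') as (-> & ->).
  { unfold d0, dist1 in Hd0; pose proof (Rabs_pos (x - x')); pose proof (Rabs_pos (y - y')).
    abs_lra. }
  rewrite dist1_refl; pose proof (dist1_pos x' y' x' y'); unfold d0; lra. }
assert (Hd0p : 0 < d0) by (pose proof (dist1_pos x y x' y'); unfold d0 in *; lra).
apply Rlt_le; revert t Ht.
apply (real_induction (fun t => dist1 (u t x y) (v t x y) (u t x' y') (v t x' y') < 2 * d0)).
intros s Hs Hin.
destruct (flow_d x y s Hb ltac:(lra)) as (D1 & D2).
destruct (flow_d x' y' s Hb' ltac:(lra)) as (D1' & D2').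
assert (Hlt : dist1 (u s x y) (v s x y) (u s x' y') (v s x' y') < 2 * d0).
{ destruct (Req_dec s 0) as [->|Hs0]; [rewrite Eu, Ev, Eu', Ev'; fold d0; lra|].
  destruct (mvt_interior (fun s => u s x y - u s x' y')
    (fun s => xi (u s x y) (v s x y) - xi (u s x' y') (v s x' y')) s) as (c1 & Hc1 & E1); [lra| |].
  { intros w Hw; apply @is_derive_minus; [apply (flow_d x y w Hb)|apply (flow_d x' y' w Hb')]; lra. }
  destruct (mvt_interior (fun s => v s x y - v s x' y')
    (fun s => eta (u s x y) (v s x y) - eta (u s x' y') (v s x' y')) s) as (c2 & Hc2 & E2); [lra| |].
  { intros w Hw; apply @is_derive_minus; [apply (flow_d x y w Hb)|apply (flow_d x' y' w Hb')]; lra. }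
  rewrite Eu, Eu' in E1; rewrite Ev, Ev' in E2.
  assert (Hstay : forall w, 0 <= w < T -> in_box p R0 (u w x y) (v w x y) /\
     in_box p R0 (u w x' y') (v w x' y')).
  { intros w Hw; split; [apply (flow_stays x y)|apply (flow_stays x' y')]; auto; lra. }
  assert (F1 : Rabs (u s x y - u s x' y' - (x - x')) <= s * (M * (2 * d0))).
  { rewrite E1, Rabs_mult, (Rabs_right s) by lra; apply Rmult_le_compat_l; [lra|].
    destruct (Hstay c1 ltac:(lra)) as (S1 & S2).
    eapply Rle_trans; [apply (LM _ _ _ _ S1 S2)|].
    apply Rmult_le_compat_l; [lra|apply Rlt_le, Hin; lra]. }
  assert (F2 : Rabs (v s x y - v s x' y' - (y - y')) <= s * (M * (2 * d0))).
  { rewrite E2, Rabs_mult, (Rabs_right s) by lra; apply Rmult_le_compat_l; [lra|].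
    destruct (Hstay c2 ltac:(lra)) as (S1 & S2).
    eapply Rle_trans; [apply (LM _ _ _ _ S1 S2)|].
    apply Rmult_le_compat_l; [lra|apply Rlt_le, Hin; lra]. }
  assert (Hsm : s * (4 * M) < 1).
  { apply Rlt_le_trans with (/ (4 * M) * (4 * M)); [apply Rmult_lt_compat_r; lra|right; field; lra]. }
  apply (Rmult_lt_compat_r d0) in Hsm; [|lra].
  pose proof (Rabs_triang (u s x y - u s x' y' - (x - x')) (x - x')) as G1.
  replace (u s x y - u s x' y' - (x - x') + (x - x')) with (u s x y - u s x' y') in G1 by ring.
  pose proof (Rabs_triang (v s x y - v s x' y' - (y - y')) (y - y')) as G2.
  replace (v s x y - v s x' y' - (y - y') + (y - y')) with (v s x y - v s x' y') in G2 by ring.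
  unfold dist1; unfold d0 in *; unfold dist1 in *; lra. }
assert (cd : continuous (fun w => dist1 (u w x y) (v w x y) (u w x' y') (v w x' y')) s).
{ unfold dist1.
  apply (continuous_plus (fun w => Rabs (u w x y - u w x' y')) (fun w => Rabs (v w x y - v w x' y'))).
  - apply (continuous_comp (fun w => u w x y - u w x' y') Rabs); [|apply continuous_Rabs].
    apply (ex_derive_continuous (fun w => u w x y - u w x' y')); eexists.
    apply @is_derive_minus; eassumption.
  - apply (continuous_comp (fun w => v w x y - v w x' y') Rabs); [|apply continuous_Rabs].
    apply (ex_derive_continuous (fun w => v w x y - v w x' y')); eexists.
    apply @is_derive_minus; eassumption. }
destruct (continuous_abs_near _ s (2 * d0 - dist1 (u s x y) (v s x y) (u s x' y') (v s x' y')) cd)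
  as (d & Hd & N); [lra|].
exists d; split; [exact Hd|]; intros w Hw _.
destruct (Rlt_le_dec w s) as [Hl|Hl]; [apply Hin; lra|].
specialize (N w); rewrite Rabs_right in N by lra; specialize (N ltac:(lra)).
apply Rabs_def2 in N; lra.
Qed.

Variable zeta : R -> R -> R.
Hypothesis sz : smooth_on p R0 zeta.

(** The Lie derivative of [zeta] along the field. *)
Definition along x y := fint zeta x y (xi x y) (eta x y).

Lemma flow_increment x y t : in_box p (R0 / 2) x y -> 0 < t < Rmin eps (R0 / (2 * M)) ->
  exists c, 0 < c < t /\ zeta (u t x y) (v t x y) - zeta x y = t * along (u c x y) (v c x y).
Proof.
intros Hb Ht; assert (Hm1 := Rmin_l eps (R0 / (2 * M))).
destruct (flow_start x y Hb) as (Eu & Ev).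
destruct (mvt_interior (fun s => zeta (u s x y) (v s x y)) (fun s => along (u s x y) (v s x y)) t)
  as (c & Hc & E); [lra| |rewrite Eu, Ev in E; exists c; auto].
intros s Hs; destruct (flow_d x y s Hb ltac:(lra)) as (D1 & D2).
apply (smooth_chain p R0 zeta (fun s => u s x y) (fun s => v s x y)); auto.
apply (flow_stays x y s Hb); lra.
Qed.

(** Closeness of the flow to the identity in terms of differences, without differentiating it in its
    starting point. Applied to the abscissa and to [Y] along a solution, it keeps both strictly
    monotone for small times. *)
Lemma flow_chord N x y x' y' t :
  (forall a b a' b', in_box p R0 a b -> in_box p R0 a' b' ->
     Rabs (along a b - along a' b') <= N * dist1 a b a' b') ->
  0 <= N -> in_box p (R0 / 2) x y -> in_box p (R0 / 2) x' y' ->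
  0 < t < Rmin (Rmin eps (R0 / (2 * M))) (/ (4 * M)) ->
  Rabs (zeta (u t x y) (v t x y) - zeta (u t x' y') (v t x' y') - (zeta x y - zeta x' y'))
   <= t * (2 * N * dist1 x y x' y').
Proof.
intros HN N0 Hb Hb' Ht.
assert (HT1 := Rmin_l (Rmin eps (R0 / (2 * M))) (/ (4 * M))).
assert (HT3 : Rmin (Rmin eps (R0 / (2 * M))) (/ (4 * M)) <= eps)
  by (eapply Rle_trans; [exact HT1|apply Rmin_l]).
destruct (flow_start x y Hb) as (Eu & Ev); destruct (flow_start x' y' Hb') as (Eu' & Ev').
destruct (mvt_interior (fun s => zeta (u s x y) (v s x y) - zeta (u s x' y') (v s x' y'))
  (fun s => along (u s x y) (v s x y) - along (u s x' y') (v s x' y')) t) as (c & Hc & E); [lra| |].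
{ intros s Hs; destruct (flow_d x y s Hb ltac:(lra)) as (D1 & D2).
  destruct (flow_d x' y' s Hb' ltac:(lra)) as (D1' & D2').
  apply @is_derive_minus.
  - apply (smooth_chain p R0 zeta (fun s => u s x y) (fun s => v s x y)); auto.
    apply (flow_stays x y s Hb); lra.
  - apply (smooth_chain p R0 zeta (fun s => u s x' y') (fun s => v s x' y')); auto.
    apply (flow_stays x' y' s Hb'); lra. }
rewrite Eu, Ev, Eu', Ev' in E; rewrite E, Rabs_mult, (Rabs_right t) by lra.
apply Rmult_le_compat_l; [lra|].
eapply Rle_trans; [apply HN; [apply (flow_stays x y c Hb)|apply (flow_stays x' y' c Hb')]; lra|].
replace (2 * N * dist1 x y x' y') with (N * (2 * dist1 x y x' y')) by ring.
apply Rmult_le_compat_l; [exact N0|apply flow_close; auto; lra].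
Qed.
End Flow.

(** * Point symmetries in normal coordinates *)

Section Transfer.
Variables (E : equation) (p : R * R) (r : R) (X Y l K : R -> R -> R).
Hypothesis nc : normal_coordinates E p r X Y l K.

Let sX : smooth_on p r X := nc_X _ _ _ _ _ _ _ nc.
Let sY : smooth_on p r Y := nc_Y _ _ _ _ _ _ _ nc.
Let sl : smooth_on p r l := nc_l _ _ _ _ _ _ _ nc.
Let HJ := nc_jac _ _ _ _ _ _ _ nc.

(** The right-hand side made homogeneous of degree 3, so that the equation makes sense for curves in
    any parametrisation. *)
Definition cubic (x y u v : R) : R :=
  coefP E x y * u ^ 3 + 3 * coefQ E x y * u ^ 2 * v
  + 3 * coefR E x y * u * v ^ 2 + coefS E x y * v ^ 3.

Definition hess (f : R -> R -> R) (x y u v : R) : R :=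
  dx (dx f) x y * u ^ 2 + 2 * dy (dx f) x y * u * v + dy (dy f) x y * v ^ 2.

(** The conditions [nc_P] to [nc_S] are the coefficients of the monomials of degree 3 in [u1], [v1];
    the second derivatives enter only through the determinant [jac]. *)
Lemma equation_transfer x y u1 v1 u2 v2 : in_box p r x y ->
  fint X x y u1 v1 * (fint Y x y u2 v2 + hess Y x y u1 v1)
  - fint Y x y u1 v1 * (fint X x y u2 v2 + hess X x y u1 v1)
  - (X x y ^ 2 / 2 + l x y) * fint Y x y u1 v1 ^ 3 =
  jac X Y x y * ((u1 * v2 - v1 * u2) - cubic x y u1 v1).
Proof.
intros Hb.
pose proof (nc_P _ _ _ _ _ _ _ nc x y Hb) as HP; pose proof (nc_Q _ _ _ _ _ _ _ nc x y Hb) as HQ.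
pose proof (nc_R _ _ _ _ _ _ _ nc x y Hb) as HR; pose proof (nc_S _ _ _ _ _ _ _ nc x y Hb) as HS.
set (z := X x y ^ 2 / 2 + l x y) in *.
apply (f_equal (fun e => e * u1 ^ 3)) in HP; apply (f_equal (fun e => e * (u1 ^ 2 * v1))) in HQ.
apply (f_equal (fun e => e * (u1 * v1 ^ 2))) in HR; apply (f_equal (fun e => e * v1 ^ 3)) in HS.
unfold fint, hess, cubic, jac in *; lra.
Qed.

Lemma fint_derive (f : R -> R -> R) (u v u1 v1 : R -> R) (u2 v2 t : R) :
  smooth_on p r f -> in_box p r (u t) (v t) ->
  is_derive u t (u1 t) -> is_derive v t (v1 t) -> is_derive u1 t u2 -> is_derive v1 t v2 ->
  is_derive (fun s => fint f (u s) (v s) (u1 s) (v1 s)) t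
    (fint f (u t) (v t) u2 v2 + hess f (u t) (v t) (u1 t) (v1 t)).
Proof.
intros sf Hb du dv du1 dv1.
pose proof (smooth_chain p r (dx f) u v t _ _ (smooth_dx p r f sf) Hb du dv) as D1.
pose proof (smooth_chain p r (dy f) u v t _ _ (smooth_dy p r f sf) Hb du dv) as D2.
rewrite (smooth_schwarz p r f _ _ sf Hb) in D2.
unfold fint at 2, hess.
match goal with |- is_derive _ _ ?e => replace e with
  (((dx (dx f) (u t) (v t) * u1 t + dy (dx f) (u t) (v t) * v1 t) * u1 t + dx f (u t) (v t) * u2)
   + ((dy (dx f) (u t) (v t) * u1 t + dy (dy f) (u t) (v t) * v1 t) * v1 t + dy f (u t) (v t) * v2))
  by ring end.
apply (is_derive_plus (fun s => dx f (u s) (v s) * u1 s) (fun s => dy f (u s) (v s) * v1 s)).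
- apply (is_derive_mult (fun s => dx f (u s) (v s)) u1); auto; exact Rmult_comm.
- apply (is_derive_mult (fun s => dy f (u s) (v s)) v1); auto; exact Rmult_comm.
Qed.

Lemma smooth_curve_continuous {T : UniformSpace} (f : R -> R -> R) (u v : T -> R) t :
  smooth_on p r f -> in_box p r (u t) (v t) -> continuous u t -> continuous v t ->
  continuous (fun s => f (u s) (v s)) t.
Proof.
intros sf Hb cu cv.
apply (continuous_comp_2 u v f); auto.
apply (continuity_2d_pt_filterlim f), (smooth_cont p r); auto.
Qed.

(** By homogeneity the factor [u1 t ^ 3] cancels in the second derivative of the graph, leaving the
    equation in the slope. *)
Lemma curve_to_solution (u v u1 v1 u2 v2 : R -> R) a b : a < b ->
  (forall t, a <= t <= b -> is_derive u t (u1 t) /\ is_derive v t (v1 t) /\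
     is_derive u1 t (u2 t) /\ is_derive v1 t (v2 t) /\ u1 t <> 0) ->
  (forall t, a <= t <= b -> u1 t * v2 t - v1 t * u2 t = cubic (u t) (v t) (u1 t) (v1 t)) ->
  exists c d g, c < d /\ is_solution E c d g /\
    (forall x, c < x < d <-> exists t, a < t < b /\ x = u t) /\
    (forall t, a < t < b -> g (u t) = v t /\ Derive g (u t) = v1 t / u1 t).
Proof.
intros Hab H Hc.
destruct (curve_graph u v u1 v1 u2 v2 a b Hab H) as (c & d & g & Hcd & Himg & Hg).
exists c, d, g; split; [exact Hcd|split; [|split; [exact Himg|]]].
- intros x Hx; apply Himg in Hx; destruct Hx as (t & Ht & ->).
  destruct (Hg t Ht) as (E1 & D1 & D2); split; [eexists; exact D1|].
  destruct (H t) as (_ & _ & _ & _ & Hn); [lra|].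
  rewrite (is_derive_unique _ _ _ D1), E1.
  rewrite (Hc t) in D2 by lra.
  match type of D2 with is_derive _ _ ?w => match goal with |- is_derive _ _ ?w' =>
    replace w' with w; [exact D2|] end end.
  unfold cubic; field; exact Hn.
- intros t Ht; destruct (Hg t Ht) as (E1 & D1 & _); split; [exact E1|].
  apply is_derive_unique, D1.
Qed.

(* In normal coordinates a solution is a graph [X = h (Y)] with
   [h'' = - (h^2 / 2 + l)], as long as it is transversal to [Y = const]. *)
Lemma solution_to_normal (a b : R) (f : R -> R) a' b' :
  is_solution E a b f -> a < a' -> a' < b' -> b' < b ->
  (forall x, a' <= x <= b' -> in_box p r x (f x)) ->
  (forall x, a' <= x <= b' -> fint Y x (f x) 1 (Derive f x) <> 0) ->
  exists c d h, c < d /\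
    (forall y, c < y < d <-> exists x, a' < x < b' /\ y = Y x (f x)) /\
    (forall x, a' < x < b' -> h (Y x (f x)) = X x (f x) /\
       is_derive h (Y x (f x)) (fint X x (f x) 1 (Derive f x) / fint Y x (f x) 1 (Derive f x)) /\
       is_derive (Derive h) (Y x (f x)) (- (X x (f x) ^ 2 / 2 + l x (f x)))).
Proof.
intros Hf Ha Hab Hb Hbox Hn.
pose (f2 := fun x => coefP E x (f x) + 3 * coefQ E x (f x) * Derive f x
       + 3 * coefR E x (f x) * Derive f x ^ 2 + coefS E x (f x) * Derive f x ^ 3).
assert (df : forall x, a' <= x <= b' -> is_derive f x (Derive f x))
  by (intros x Hx; apply Derive_correct, Hf; lra).
assert (df2 : forall x, a' <= x <= b' -> is_derive (Derive f) x (f2 x))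
  by (intros x Hx; apply Hf; lra).
assert (d1 : forall g, smooth_on p r g -> forall x, a' <= x <= b' ->
  is_derive (fun x => g x (f x)) x (fint g x (f x) 1 (Derive f x))).
{ intros g sg x Hx; unfold fint.
  apply (smooth_chain p r g (fun x => x) f); [exact sg|apply Hbox, Hx|apply @is_derive_id|apply df, Hx]. }
assert (d2 : forall g, smooth_on p r g -> forall x, a' <= x <= b' ->
  is_derive (fun x => fint g x (f x) 1 (Derive f x)) x
   (fint g x (f x) 0 (f2 x) + hess g x (f x) 1 (Derive f x))).
{ intros g sg x Hx.
  apply (fint_derive g (fun x => x) f (fun _ => 1) (Derive f));
    [exact sg|apply Hbox, Hx|apply @is_derive_id|apply df, Hx|apply @is_derive_const|apply df2, Hx]. }
destruct (curve_graph (fun x => Y x (f x)) (fun x => X x (f x))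
  (fun x => fint Y x (f x) 1 (Derive f x)) (fun x => fint X x (f x) 1 (Derive f x))
  (fun x => fint Y x (f x) 0 (f2 x) + hess Y x (f x) 1 (Derive f x))
  (fun x => fint X x (f x) 0 (f2 x) + hess X x (f x) 1 (Derive f x)) a' b' Hab)
  as (c & d & h & Hcd & Himg & Hh).
{ intros x Hx.
  exact (conj (d1 Y sY x Hx) (conj (d1 X sX x Hx) (conj (d2 Y sY x Hx) (conj (d2 X sX x Hx) (Hn x Hx))))). }
exists c, d, h; split; [exact Hcd|split; [exact Himg|]].
intros x Hx; destruct (Hh x Hx) as (E1 & D1 & D2).
split; [exact E1|split; [exact D1|]].
pose proof (equation_transfer x (f x) 1 (Derive f x) 0 (f2 x) (Hbox x ltac:(lra))) as T.
replace (1 * f2 x - Derive f x * 0 - cubic x (f x) 1 (Derive f x)) with 0 in T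
  by (unfold f2, cubic; ring).
rewrite Rmult_0_r in T.
match type of D2 with is_derive _ _ ?w => match goal with |- is_derive _ _ ?w' =>
    replace w' with w; [exact D2|] end end.
pose proof (Hn x ltac:(lra)) as Hnx.
apply (Rmult_eq_reg_r (fint Y x (f x) 1 (Derive f x) ^ 3)); [|apply pow_nonzero, Hnx].
unfold Rdiv at 1; rewrite Rmult_assoc, Rinv_l, Rmult_1_r by (apply pow_nonzero, Hnx); lra.
Qed.

(** * The inverse of the normal coordinates *)

Variables (r1 rho C : R) (PX PY : R -> R -> R).
Hypotheses (Hr1 : 0 < r1) (Hr1r : r1 < r) (Hrho : 0 < rho) (HC : 0 < C).
Hypothesis Hlip : forall x y x' y', in_box p r1 x y -> in_box p r1 x' y' ->
     dist1 x y x' y' <= C * dist1 (X x y) (Y x y) (X x' y') (Y x' y').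
Hypothesis Hinv : forall a b, Rabs (a - X (fst p) (snd p)) < rho ->
     Rabs (b - Y (fst p) (snd p)) < rho ->
     in_box p r1 (PX a b) (PY a b) /\ X (PX a b) (PY a b) = a /\ Y (PX a b) (PY a b) = b.

Definition in_range (a b : R) : Prop :=
  Rabs (a - X (fst p) (snd p)) < rho /\ Rabs (b - Y (fst p) (snd p)) < rho.

Lemma box_r1_r x y : in_box p r1 x y -> in_box p r x y.
Proof. apply in_box_le; lra. Qed.

Lemma normal_injective x y x' y' : in_box p r1 x y -> in_box p r1 x' y' ->
  X x y = X x' y' -> Y x y = Y x' y' -> x = x' /\ y = y'.
Proof.
intros H1 H2 EX EY; specialize (Hlip _ _ _ _ H1 H2).
rewrite EX, EY, dist1_refl, Rmult_0_r in Hlip; unfold dist1 in Hlip.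
abs_lra.
Qed.

Lemma inverse_normal x y : in_box p r1 x y -> in_range (X x y) (Y x y) ->
  PX (X x y) (Y x y) = x /\ PY (X x y) (Y x y) = y.
Proof.
intros Hb (H1 & H2); destruct (Hinv _ _ H1 H2) as (H3 & H4 & H5).
apply normal_injective; auto.
Qed.

Lemma continuous_abs_locally {T : UniformSpace} (a : T -> R) t e :
  continuous a t -> 0 < e -> locally t (fun s => Rabs (a s - a t) < e).
Proof. intros ca He; exact (proj1 (filterlim_locally a (a t)) ca (mkposreal e He)). Qed.

Lemma in_range_locally {T : UniformSpace} (a b : T -> R) t :
  continuous a t -> continuous b t -> in_range (a t) (b t) ->
  locally t (fun s => in_range (a s) (b s)).
Proof.
intros ca cb (H1 & H2).
generalize (filter_and _ _ (continuous_abs_locally a t _ ca (proj2 (Rlt_0_minus _ _) H1))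
  (continuous_abs_locally b t _ cb (proj2 (Rlt_0_minus _ _) H2))).
apply filter_imp; intros s (G1 & G2); split.
- abs_lra.
- abs_lra.
Qed.

(** Continuity comes from [Hlip]. The source is arbitrary because it is the line for curves, and the
    plane of time and abscissa for the slope of an image. *)
Lemma inverse_continuous {T : UniformSpace} (a b : T -> R) t :
  continuous a t -> continuous b t -> in_range (a t) (b t) ->
  continuous (fun s => PX (a s) (b s)) t /\ continuous (fun s => PY (a s) (b s)) t.
Proof.
intros ca cb Hab.
destruct (Hinv _ _ (proj1 Hab) (proj2 Hab)) as (Hb0 & EX0 & EY0).
assert (Hmain : forall eps, 0 < eps -> locally t (fun s =>
   dist1 (PX (a s) (b s)) (PY (a s) (b s)) (PX (a t) (b t)) (PY (a t) (b t)) < eps)).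
{ intros eps Heps.
  assert (He : 0 < eps / (2 * C)) by (apply Rdiv_lt_0_compat; lra).
  generalize (filter_and _ _ (in_range_locally a b t ca cb Hab)
    (filter_and _ _ (continuous_abs_locally a t _ ca He) (continuous_abs_locally b t _ cb He))).
  apply filter_imp; intros s ((G1 & G2) & H1 & H2).
  destruct (Hinv _ _ G1 G2) as (Hbs & EXs & EYs).
  eapply Rle_lt_trans; [apply Hlip; auto|]; rewrite EXs, EYs, EX0, EY0; unfold dist1.
  replace eps with (C * (eps / (2 * C) + eps / (2 * C))) by (field; lra).
  apply Rmult_lt_compat_l; lra. }
split; apply filterlim_locally; intros eps; generalize (Hmain eps (cond_pos eps));
  apply filter_imp; intros s Hs; unfold dist1 in Hs.
- change (Rabs (PX (a s) (b s) - PX (a t) (b t)) < eps).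
  abs_lra.
- change (Rabs (PY (a s) (b s) - PY (a t) (b t)) < eps).
  abs_lra.
Qed.

(** Cramer's rule: the vector on which [dX] and [dY] take the values [a1] and [b1]. *)
Definition pull1 (x y a1 b1 : R) : R := (dy Y x y * a1 - dy X x y * b1) / jac X Y x y.
Definition pull2 (x y a1 b1 : R) : R := (dx X x y * b1 - dx Y x y * a1) / jac X Y x y.

Lemma pull_fint x y a1 b1 : in_box p r x y ->
  fint X x y (pull1 x y a1 b1) (pull2 x y a1 b1) = a1 /\
  fint Y x y (pull1 x y a1 b1) (pull2 x y a1 b1) = b1.
Proof.
intros Hb; pose proof (HJ x y Hb) as HJb; unfold fint, pull1, pull2, jac in *.
split; field; exact HJb.
Qed.

Lemma fint_pull x y u v : in_box p r x y ->
  pull1 x y (fint X x y u v) (fint Y x y u v) = u /\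
  pull2 x y (fint X x y u v) (fint Y x y u v) = v.
Proof.
intros Hb; pose proof (HJ x y Hb) as HJb; unfold fint, pull1, pull2, jac in *.
split; field; exact HJb.
Qed.

Lemma inverse_derive (a b : R -> R) t a1 b1 :
  is_derive a t a1 -> is_derive b t b1 -> in_range (a t) (b t) ->
  is_derive (fun s => PX (a s) (b s)) t (pull1 (PX (a t) (b t)) (PY (a t) (b t)) a1 b1) /\
  is_derive (fun s => PY (a s) (b s)) t (pull2 (PX (a t) (b t)) (PY (a t) (b t)) a1 b1).
Proof.
intros da db Hab.
assert (ca : continuous a t) by (apply (ex_derive_continuous a); exists a1; exact da).
assert (cb : continuous b t) by (apply (ex_derive_continuous b); exists b1; exact db).
destruct (inverse_continuous a b t ca cb Hab) as (cu & cv).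
destruct (Hinv _ _ (proj1 Hab) (proj2 Hab)) as (Hb0 & _ & _).
apply box_r1_r in Hb0.
apply (implicit_derive X Y (fun s => PX (a s) (b s)) (fun s => PY (a s) (b s))).
- apply (smooth_differentiable p r); auto.
- apply (smooth_differentiable p r); auto.
- apply HJ, Hb0.
- exact cu.
- exact cv.
- apply (is_derive_ext_loc a); [|exact da].
  apply (filter_imp (fun s => in_range (a s) (b s))); [|apply in_range_locally; auto].
  intros s (G1 & G2); symmetry; apply (Hinv _ _ G1 G2).
- apply (is_derive_ext_loc b); [|exact db].
  apply (filter_imp (fun s => in_range (a s) (b s))); [|apply in_range_locally; auto].
  intros s (G1 & G2); symmetry; apply (Hinv _ _ G1 G2).
Qed.

(** The velocities [u1], [v1] are explicit, hence differentiable again. Their derivatives are never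
    written out, as only the combination in [equation_transfer] matters. *)
Lemma pullback_curve (a b a1 b1 a2 b2 : R -> R) lo hi :
  (forall t, lo < t < hi -> in_range (a t) (b t) /\
     is_derive a t (a1 t) /\ is_derive b t (b1 t) /\
     is_derive a1 t (a2 t) /\ is_derive b1 t (b2 t)) ->
  exists u v u1 v1 u2 v2 : R -> R,
  (forall t, u t = PX (a t) (b t) /\ v t = PY (a t) (b t) /\
     u1 t = pull1 (u t) (v t) (a1 t) (b1 t) /\ v1 t = pull2 (u t) (v t) (a1 t) (b1 t)) /\
  forall t, lo < t < hi ->
    in_box p r1 (u t) (v t) /\ is_derive u t (u1 t) /\ is_derive v t (v1 t) /\
    is_derive u1 t (u2 t) /\ is_derive v1 t (v2 t) /\
    a1 t * b2 t - b1 t * a2 t - (a t ^ 2 / 2 + l (u t) (v t)) * b1 t ^ 3 =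
    jac X Y (u t) (v t) *
     ((u1 t * v2 t - v1 t * u2 t) - cubic (u t) (v t) (u1 t) (v1 t)).
Proof.
intros H.
pose (u := fun t => PX (a t) (b t)); pose (v := fun t => PY (a t) (b t)).
pose (u1 := fun t => pull1 (u t) (v t) (a1 t) (b1 t)).
pose (v1 := fun t => pull2 (u t) (v t) (a1 t) (b1 t)).
assert (Hb : forall t, lo < t < hi -> in_box p r1 (u t) (v t) /\ X (u t) (v t) = a t /\ Y (u t) (v t) = b t)
  by (intros t Ht; destruct (H t Ht) as ((G1 & G2) & _); apply (Hinv _ _ G1 G2)).
assert (duv : forall t, lo < t < hi -> is_derive u t (u1 t) /\ is_derive v t (v1 t)).
{ intros t Ht; destruct (H t Ht) as (G & G1 & G2 & _); exact (inverse_derive a b t _ _ G1 G2 G). }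
assert (Hbr : forall t, lo < t < hi -> in_box p r (u t) (v t))
  by (intros t Ht; apply box_r1_r, Hb, Ht).
assert (sJ : smooth_on p r (fun x y => / jac X Y x y))
  by (apply smooth_inv; [exact HJ|unfold jac; smooth]).
assert (Hex1 : forall t, lo < t < hi -> ex_derive u1 t).
{ intros t Ht; destruct (H t Ht) as (_ & _ & _ & G3 & G4); destruct (duv t Ht) as (D1 & D2).
  unfold u1, pull1, Rdiv.
  apply (ex_derive_mult (fun t => dy Y (u t) (v t) * a1 t - dy X (u t) (v t) * b1 t)
     (fun t => / jac X Y (u t) (v t))).
  - apply @ex_derive_minus.
    + apply (ex_derive_mult (fun t => dy Y (u t) (v t)) a1); [|eexists; exact G3].
      eexists; apply (smooth_chain p r (dy Y) u v t _ _ (smooth_dy p r Y sY) (Hbr t Ht) D1 D2).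
    + apply (ex_derive_mult (fun t => dy X (u t) (v t)) b1); [|eexists; exact G4].
      eexists; apply (smooth_chain p r (dy X) u v t _ _ (smooth_dy p r X sX) (Hbr t Ht) D1 D2).
  - eexists; apply (smooth_chain p r (fun x y => / jac X Y x y) u v t _ _ sJ (Hbr t Ht) D1 D2). }
assert (Hex2 : forall t, lo < t < hi -> ex_derive v1 t).
{ intros t Ht; destruct (H t Ht) as (_ & _ & _ & G3 & G4); destruct (duv t Ht) as (D1 & D2).
  unfold v1, pull2, Rdiv.
  apply (ex_derive_mult (fun t => dx X (u t) (v t) * b1 t - dx Y (u t) (v t) * a1 t)
     (fun t => / jac X Y (u t) (v t))).
  - apply @ex_derive_minus.
    + apply (ex_derive_mult (fun t => dx X (u t) (v t)) b1); [|eexists; exact G4].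
      eexists; apply (smooth_chain p r (dx X) u v t _ _ (smooth_dx p r X sX) (Hbr t Ht) D1 D2).
    + apply (ex_derive_mult (fun t => dx Y (u t) (v t)) a1); [|eexists; exact G3].
      eexists; apply (smooth_chain p r (dx Y) u v t _ _ (smooth_dx p r Y sY) (Hbr t Ht) D1 D2).
  - eexists; apply (smooth_chain p r (fun x y => / jac X Y x y) u v t _ _ sJ (Hbr t Ht) D1 D2). }
exists u, v, u1, v1, (Derive u1), (Derive v1); split; [repeat split; reflexivity|].
intros t Ht; destruct (duv t Ht) as (D1 & D2).
pose proof (Derive_correct _ _ (Hex1 t Ht)) as D3; pose proof (Derive_correct _ _ (Hex2 t Ht)) as D4.
split; [apply (Hb t Ht)|].
refine (conj D1 (conj D2 (conj D3 (conj D4 _)))).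
pose proof (equation_transfer (u t) (v t) (u1 t) (v1 t) (Derive u1 t) (Derive v1 t) (Hbr t Ht)) as T.
assert (Hloc : locally t (fun s => lo < s < hi))
  by (apply filter_and; [apply (open_gt lo)|apply (open_lt hi)]; lra).
(* Two expressions for the derivative of [a1]: the given [a2], and the chain rule for [fint X] along
   the curve, which coincides with [a1] near [t]. *)
assert (A2 : fint X (u t) (v t) (Derive u1 t) (Derive v1 t) + hess X (u t) (v t) (u1 t) (v1 t) = a2 t).
{ destruct (H t Ht) as (_ & _ & _ & G3 & _).
  rewrite <- (is_derive_unique _ _ _ G3); symmetry; apply is_derive_unique.
  apply (is_derive_ext_loc (fun s => fint X (u s) (v s) (u1 s) (v1 s))).
  - apply (filter_imp _ _ (fun s Hs => proj1 (pull_fint _ _ (a1 s) (b1 s) (Hbr s Hs))) Hloc).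
  - apply fint_derive; auto. }
assert (B2 : fint Y (u t) (v t) (Derive u1 t) (Derive v1 t) + hess Y (u t) (v t) (u1 t) (v1 t) = b2 t).
{ destruct (H t Ht) as (_ & _ & _ & _ & G3).
  rewrite <- (is_derive_unique _ _ _ G3); symmetry; apply is_derive_unique.
  apply (is_derive_ext_loc (fun s => fint Y (u s) (v s) (u1 s) (v1 s))).
  - apply (filter_imp _ _ (fun s Hs => proj2 (pull_fint _ _ (a1 s) (b1 s) (Hbr s Hs))) Hloc).
  - apply fint_derive; auto. }
rewrite A2, B2 in T.
destruct (pull_fint (u t) (v t) (a1 t) (b1 t) (Hbr t Ht)) as (A1 & B1).
fold (u1 t) (v1 t) in A1, B1.
change (fint X (u t) (v t) (u1 t) (v1 t) = a1 t) in A1.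
change (fint Y (u t) (v t) (u1 t) (v1 t) = b1 t) in B1.
rewrite A1, B1, (proj1 (proj2 (Hb t Ht))) in T; exact T.
Qed.

(** The function of one variable through which [l] depends on [Y], read off on the curve through [p]
    where [X] is constant. *)
Definition lY (eta : R) : R := l (PX (X (fst p) (snd p)) eta) (PY (X (fst p) (snd p)) eta).

(** As [dl = K dY], [l] does not change along [Y = const]. The connecting segment is taken in normal
    coordinates, where the range is a square and contains it. *)
Lemma l_lY x y : in_box p r1 x y -> in_range (X x y) (Y x y) -> l x y = lY (Y x y).
Proof.
intros Hb Hr; set (b := Y x y); set (Xp := X (fst p) (snd p)).
assert (Hseg : forall t, Rmin Xp (X x y) <= t <= Rmax Xp (X x y) -> in_range t b).
{ intros t Ht; split; [|apply Hr].
  apply (abs_between Xp (X x y)); auto; [|apply Hr].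
  fold Xp; rewrite Rminus_diag, Rabs_R0; exact Hrho. }
pose proof (mvt_bound (fun t => l (PX t b) (PY t b)) (fun _ => 0) 0 Xp (X x y)) as Hm.
destruct (inverse_normal x y Hb Hr) as (E1 & E2); fold b in E1, E2.
cbv beta in Hm; rewrite E1, E2 in Hm; unfold lY; fold Xp.
apply Rminus_diag_uniq, Rabs_eq_0, Rle_antisym; [|apply Rabs_pos].
rewrite Rmult_0_l in Hm; apply Hm; [|intros; rewrite Rabs_R0; lra].
intros t Ht; pose proof (Hseg t Ht) as Hrt.
destruct (Hinv _ _ (proj1 Hrt) (proj2 Hrt)) as (Hbt & _ & _).
apply box_r1_r in Hbt.
destruct (inverse_derive (fun t => t) (fun _ => b) t 1 0) as (D1 & D2);
  [apply @is_derive_id|apply @is_derive_const|exact Hrt|].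
pose proof (smooth_chain p r l (fun t => PX t b) (fun t => PY t b) t _ _ sl Hbt D1 D2) as D.
cbv beta in D.
rewrite (nc_dxl _ _ _ _ _ _ _ nc _ _ Hbt), (nc_dyl _ _ _ _ _ _ _ nc _ _ Hbt) in D.
match type of D with is_derive _ _ ?w => replace 0 with w; [exact D|] end.
destruct (pull_fint _ _ 1 0 Hbt) as (_ & F); unfold fint in F.
transitivity (K (PX t b) (PY t b) * 0); [|ring].
rewrite <- F at 3; ring.
Qed.

Lemma lY_continuous eta : Rabs (eta - Y (fst p) (snd p)) < rho -> continuous lY eta.
Proof.
intros He.
assert (Hr : in_range (X (fst p) (snd p)) eta)
  by (split; [rewrite Rminus_diag, Rabs_R0; exact Hrho|exact He]).
destruct (inverse_continuous (fun _ => X (fst p) (snd p)) (fun t => t) eta) as (c1 & c2);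
  [apply continuous_const|apply continuous_id|exact Hr|].
apply (smooth_curve_continuous l (fun t => PX (X (fst p) (snd p)) t)
  (fun t => PY (X (fst p) (snd p)) t)); auto.
apply box_r1_r, (Hinv _ _ (proj1 Hr) (proj2 Hr)).
Qed.

(** The solution is built as a graph [X = h (Y)] and pulled back. Transversality to [Y = const]
    makes [Y] a parameter; the velocity at the point is then [(/ n, m / n)], of slope [m]. *)
Lemma solution_through x0 y0 m e :
  in_box p r1 x0 y0 -> in_range (X x0 y0) (Y x0 y0) -> fint Y x0 y0 1 m <> 0 ->
  in_box p e x0 y0 ->
  exists a b f, a < x0 < b /\ is_solution E a b f /\ f x0 = y0 /\ Derive f x0 = m /\
    forall x, a < x < b -> in_box p e x (f x).
Proof.
intros Hb0 Hr0 Hn He.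
set (X0 := X x0 y0) in *; set (Y0 := Y x0 y0) in *.
set (n := fint Y x0 y0 1 m) in *.
set (h1 := fint X x0 y0 1 m / n).
set (Xp := X (fst p) (snd p)); set (Yp := Y (fst p) (snd p)).
assert (G1 : Rabs (X0 - Xp) < rho) by apply Hr0.
assert (G2 : Rabs (Y0 - Yp) < rho) by apply Hr0.
destruct (picard (fun t => lY (Y0 + t)) ((rho - Rabs (Y0 - Yp)) / 2) X0 h1
  ((rho - Rabs (X0 - Xp)) / 2)) as (rr & H & H1 & Hrr & Hrr0 & EH & EH1 & HH).
- lra.
- lra.
- intros t Ht; apply (continuous_comp (fun t => Y0 + t) lY).
  + apply (continuous_plus (fun _ => Y0) (fun t => t)); [apply continuous_const|apply continuous_id].
  + apply lY_continuous; fold Yp; replace (Y0 + t - Yp) with ((Y0 - Yp) + t) by ring.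
    abs_lra.
- assert (Hin : forall t, - rr < t < rr -> in_range (H t) (Y0 + t)).
  { intros t Ht; assert (Ht' : Rabs t <= rr) by (apply Rlt_le, Rabs_def1; lra).
    destruct (HH t Ht') as (_ & _ & Hk); split; fold Xp; fold Yp.
    - abs_lra.
    - abs_lra. }
  destruct (pullback_curve H (fun t => Y0 + t) H1 (fun _ => 1)
    (fun t => - (H t ^ 2 / 2 + lY (Y0 + t))) (fun _ => 0) (- rr) rr)
    as (u & v & u1 & v1 & u2 & v2 & Hdef & Huv).
  { intros t Ht; assert (Ht' : Rabs t <= rr) by (apply Rlt_le, Rabs_def1; lra).
    destruct (HH t Ht') as (D1 & D2 & _).
    refine (conj (Hin t Ht) (conj D1 (conj _ (conj D2 _)))).
    - replace 1 with (0 + 1) by ring.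
      apply (is_derive_plus (fun _ => Y0) (fun t => t)); [apply @is_derive_const|apply @is_derive_id].
    - apply @is_derive_const. }
  assert (Hz : - rr < 0 < rr) by lra.
  destruct (inverse_normal x0 y0 Hb0 Hr0) as (Ex & Ey); fold X0 Y0 in Ex, Ey.
  destruct (Hdef 0) as (Eu & Ev & Eu1 & Ev1).
  rewrite EH, Rplus_0_r in Eu, Ev; rewrite Ex in Eu; rewrite Ey in Ev.
  rewrite Eu, Ev, EH1 in Eu1, Ev1.
  assert (Hbr0 : in_box p r x0 y0) by (apply box_r1_r, Hb0).
  destruct (fint_pull x0 y0 1 m Hbr0) as (F1 & F2).
  assert (U1 : u1 0 = / n).
  { rewrite Eu1; unfold h1; transitivity (pull1 x0 y0 (fint X x0 y0 1 m) n / n).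
    - unfold pull1; field; split; auto; apply HJ, Hbr0.
    - unfold n; rewrite F1; fold n; field; exact Hn. }
  assert (V1 : v1 0 = m / n).
  { rewrite Ev1; unfold h1; transitivity (pull2 x0 y0 (fint X x0 y0 1 m) n / n).
    - unfold pull2; field; split; auto; apply HJ, Hbr0.
    - unfold n; rewrite F2; fold n; field; exact Hn. }
  assert (HU1 : u1 0 <> 0) by (rewrite U1; apply Rinv_neq_0_compat, Hn).
  destruct (Huv 0 Hz) as (_ & Du & Dv & Du1 & _).
  assert (cu : continuous u 0) by (apply (ex_derive_continuous u); eexists; exact Du).
  assert (cv : continuous v 0) by (apply (ex_derive_continuous v); eexists; exact Dv).
  assert (cu1 : continuous u1 0) by (apply (ex_derive_continuous u1); eexists; exact Du1).
  destruct (continuous_abs_near u1 0 (Rabs (u1 0)) cu1 (Rabs_pos_lt _ HU1)) as (d1 & Hd1 & N1).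
  destruct (in_box_open p e x0 y0 He) as (e' & He' & Hbe).
  destruct (continuous_abs_near u 0 e' cu He') as (d2 & Hd2 & N2).
  destruct (continuous_abs_near v 0 e' cv He') as (d3 & Hd3 & N3).
  set (d := Rmin (Rmin d1 rr) (Rmin d2 d3) / 2).
  assert (Hd : 0 < d) by (assert (0 < Rmin (Rmin d1 rr) (Rmin d2 d3))
     by (repeat apply Rmin_glb_lt; auto); unfold d; lra).
  assert (L1 : d < d1 /\ d < rr /\ d < d2 /\ d < d3).
  { unfold d in *; abs_lra. }
  destruct L1 as (L1 & L2 & L3 & L4).
  destruct (curve_to_solution u v u1 v1 u2 v2 (- d) d) as (a & b & g & Hab & Hsol & Himg & Hg).
  + lra.
  + intros t Ht; destruct (Huv t ltac:(lra)) as (_ & D1 & D2 & D3 & D4 & _).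
    refine (conj D1 (conj D2 (conj D3 (conj D4 _)))).
    assert (Ht' : Rabs (t - 0) < d1) by (rewrite Rminus_0_r; apply Rabs_def1; lra).
    specialize (N1 t Ht'); intros E0; rewrite E0 in N1.
    unfold Rminus in N1; rewrite Rplus_0_l, Rabs_Ropp in N1; lra.
  + intros t Ht; destruct (Huv t ltac:(lra)) as (Hbt & _ & _ & _ & _ & Hj).
    destruct (Hdef t) as (Eut & Evt & _).
    destruct (Hin t ltac:(lra)) as (R1 & R2); destruct (Hinv _ _ R1 R2) as (_ & EX & EY).
    rewrite <- Eut, <- Evt in EX, EY.
    assert (El : l (u t) (v t) = lY (Y0 + t)).
    { rewrite l_lY; [rewrite EY; reflexivity|exact Hbt|rewrite EX, EY; apply Hin; lra]. }
    rewrite El in Hj.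
    apply Rminus_diag_uniq, (Rmult_eq_reg_l (jac X Y (u t) (v t))); [|apply HJ, box_r1_r, Hbt].
    rewrite <- Hj; ring.
  + assert (Hz0 : - d < 0 < d) by lra.
    destruct (Hg 0 Hz0) as (G3 & G4); rewrite Eu in G3, G4; rewrite Ev in G3.
    exists a, b, g; split; [apply Himg; exists 0; auto|split; [exact Hsol|split; [exact G3|split]]].
    * rewrite G4, U1, V1; field; exact Hn.
    * intros x Hx; apply Himg in Hx; destruct Hx as (t & Ht & ->).
      rewrite (proj1 (Hg t Ht)).
      assert (At : Rabs (t - 0) < d) by (rewrite Rminus_0_r; apply Rabs_def1; lra).
      rewrite <- Eu, <- Ev in Hbe; apply Hbe; [apply N2|apply N3]; lra.
Qed.

(** * Images of solutions under a flow *)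

Lemma derive_neq_0_of_chord (F : R -> R) x D k : is_derive F x D -> 0 < k ->
  (exists e, 0 < e /\ forall x', Rabs (x' - x) < e -> k * Rabs (x' - x) <= Rabs (F x' - F x)) ->
  D <> 0.
Proof.
intros HD Hk (e & He & Hch) E0; subst D; apply is_derive_Reals in HD.
destruct (HD k Hk) as (d & Hd).
set (h := Rmin e d / 2).
assert (Hm : 0 < Rmin e d) by (apply Rmin_glb_lt; [exact He|apply cond_pos]).
assert (Hh : 0 < h) by (unfold h; lra).
assert (H1 : h < e) by (pose proof (Rmin_l e d); unfold h; lra).
assert (H2 : h < d) by (pose proof (Rmin_r e d); unfold h; lra).
specialize (Hd h ltac:(lra)); rewrite Rabs_right in Hd by lra; specialize (Hd H2).
specialize (Hch (x + h)); replace (x + h - x) with h in Hch by ring.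
rewrite (Rabs_right h) in Hch by lra; specialize (Hch H1).
rewrite Rminus_0_r in Hd; unfold Rdiv in Hd; rewrite Rabs_mult, Rabs_inv, (Rabs_right h) in Hd by lra.
apply (Rmult_lt_compat_r h) in Hd; [|exact Hh].
rewrite Rmult_assoc, Rinv_l, Rmult_1_r in Hd by lra; lra.
Qed.

(** The image graph [g] is known only as a set. The bound on [U] makes [U] increasing, so [g] passes
    through the points in the order of [z]; the lower bound on chords of [Y] makes [g] transversal
    to [Y = const]. The shorter range [de'] places closed intervals inside the domain of [g], where
    [solution_to_normal] applies. *)
Lemma image_normal (c d : R) (g U V : R -> R) (x0 de mu de' : R) :
  is_solution E c d g ->
  (forall x y, (c < x < d /\ y = g x) <-> exists z, Rabs (z - x0) < de /\ x = U z /\ y = V z) ->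
  (forall z, Rabs (z - x0) < de -> in_box p r1 (U z) (V z)) ->
  (forall z z', Rabs (z - x0) < de -> Rabs (z' - x0) < de ->
     Rabs (U z - U z' - (z - z')) <= / 2 * Rabs (z - z')) ->
  0 < mu ->
  (forall z z', Rabs (z - x0) < de -> Rabs (z' - x0) < de ->
     mu * Rabs (z - z') <= Rabs (Y (U z) (V z) - Y (U z') (V z'))) ->
  0 < de' < de ->
  exists c' d' h, c' < d' /\ (forall z, Rabs (z - x0) < de' -> c' < Y (U z) (V z) < d') /\
    forall y, c' < y < d' -> exists z, Rabs (z - x0) < de' /\ y = Y (U z) (V z) /\
      h y = X (U z) (V z) /\ ex_derive h y /\
      is_derive (Derive h) y (- (X (U z) (V z) ^ 2 / 2 + l (U z) (V z))).
Proof.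
intros Hg Himg Hbox HU Hmu HY Hde.
assert (Hin : forall z, Rabs (z - x0) < de -> c < U z < d /\ V z = g (U z)).
{ intros z Hz; apply (Himg (U z) (V z)); exists z; auto. }
assert (Hpre : forall x, c < x < d -> exists z, Rabs (z - x0) < de /\ x = U z /\ g x = V z)
  by (intros x Hx; apply Himg; auto).
assert (Hmono : forall z z', Rabs (z - x0) < de -> Rabs (z' - x0) < de -> z < z' -> U z < U z').
{ intros z z' Hz Hz' Hlt; specialize (HU z z' Hz Hz').
  rewrite (Rabs_left (z - z')) in HU by lra; apply Rabs_le_between in HU; lra. }
assert (Hmono' : forall z z', Rabs (z - x0) < de -> Rabs (z' - x0) < de -> U z < U z' -> z < z').
{ intros z z' Hz Hz' Hlt; destruct (Rtotal_order z z') as [H|[H|H]]; auto; exfalso.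
  - subst z'; lra.
  - specialize (Hmono z' z Hz' Hz H); lra. }
set (zm := x0 - de'); set (zp := x0 + de').
assert (Hzm : Rabs (zm - x0) < de).
{ unfold zm; replace (x0 - de' - x0) with (- de') by ring; rewrite Rabs_Ropp, Rabs_right; lra. }
assert (Hzp : Rabs (zp - x0) < de).
{ unfold zp; replace (x0 + de' - x0) with de' by ring; rewrite Rabs_right; lra. }
assert (Hzmp : zm < zp) by (unfold zm, zp; lra).
assert (Hclosed : forall x, U zm <= x <= U zp -> c < x < d)
  by (intros x Hx; pose proof (proj1 (Hin zm Hzm)); pose proof (proj1 (Hin zp Hzp)); lra).
destruct (solution_to_normal c d g (U zm) (U zp) Hg) as (c' & d' & h & Hcd' & Himg' & Hh).
- apply (Hin zm Hzm).
- apply Hmono; auto.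
- apply (Hin zp Hzp).
- intros x Hx; destruct (Hpre x (Hclosed x Hx)) as (z & Hz & Ex & Eg); rewrite Eg, Ex.
  apply box_r1_r, Hbox, Hz.
- intros x Hx; destruct (Hpre x (Hclosed x Hx)) as (z & Hz & Ex & Eg).
  apply (derive_neq_0_of_chord (fun x => Y x (g x)) x _ (mu / 2)); [|lra|].
  + unfold fint; apply (smooth_chain p r Y (fun x => x) g); auto.
    * rewrite Eg, Ex; apply box_r1_r, Hbox, Hz.
    * apply @is_derive_id.
    * apply Derive_correct, Hg, Hclosed, Hx.
  (* A chord of [U] is at most 3/2 of the chord of [z], so the bound [mu] in terms of [z] gives
     [mu / 2] in terms of the abscissa. *)
  + pose proof (Hclosed x Hx) as Hxo.
    exists (Rmin (x - c) (d - x)); split; [apply Rmin_glb_lt; lra|].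
    intros x' Hx'; pose proof (Rmin_l (x - c) (d - x)); pose proof (Rmin_r (x - c) (d - x)).
    apply Rabs_def2 in Hx'; assert (Hxo' : c < x' < d) by lra.
    destruct (Hpre x' Hxo') as (z' & Hz' & Ex' & Eg').
    rewrite Eg, Eg', Ex, Ex'; eapply Rle_trans; [|apply HY; auto].
    specialize (HU z' z Hz' Hz).
    pose proof (Rabs_triang (U z' - U z - (z' - z)) (z' - z)) as T.
    replace (U z' - U z - (z' - z) + (z' - z)) with (U z' - U z) in T by ring.
    replace (mu / 2 * Rabs (U z' - U z)) with (mu * (Rabs (U z' - U z) / 2)) by field.
    apply Rmult_le_compat_l; [lra|]; abs_lra.
- exists c', d', h; split; [exact Hcd'|split].
  + intros z Hz; apply Himg'; exists (U z).
    assert (Hz2 : Rabs (z - x0) < de) by lra.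
    rewrite <- (proj2 (Hin z Hz2)); split; [|reflexivity].
    apply Rabs_def2 in Hz; split; apply Hmono; auto; unfold zm, zp; lra.
  + intros y Hy; apply Himg' in Hy; destruct Hy as (x & Hx & ->).
    destruct (Hpre x) as (z & Hz & Ex & Eg); [apply Hclosed; lra|].
    destruct (Hh x Hx) as (E1 & D1 & D2); rewrite Eg, Ex in *.
    exists z; split; [|split; [reflexivity|split; [exact E1|split; [eexists; exact D1|exact D2]]]].
    destruct Hx as (Hx1 & Hx2); apply Hmono' in Hx1; auto; apply Hmono' in Hx2; auto.
    unfold zm in Hx1; unfold zp in Hx2; apply Rabs_def1; lra.
Qed.

(* [y] lies between [yp] and [ym], whose order depends on the sign of [n]. *)
Lemma window c d yp ym y Y0 n k : c < yp < d -> c < ym < d -> n <> 0 ->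
  n ^ 2 * k <= (yp - Y0) * n -> (ym - Y0) * n <= - (n ^ 2 * k) ->
  Rabs (y - Y0) < Rabs n * k -> c < y < d.
Proof.
intros Hp Hm Hn H1 H2 Hy; destruct (Rdichotomy _ _ Hn) as [Hlt|Hgt].
- rewrite (Rabs_left n) in Hy by exact Hlt; apply Rabs_def2 in Hy.
  assert (yp - Y0 <= n * k).
  { apply Ropp_le_cancel; apply (Rmult_le_reg_l (- n)); [lra|].
    abs_lra. }
  assert (- (n * k) <= ym - Y0).
  { apply (Rmult_le_reg_l (- n)); [lra|].
    abs_lra. }
  lra.
- rewrite (Rabs_right n) in Hy by lra; apply Rabs_def2 in Hy.
  assert (n * k <= yp - Y0).
  { apply (Rmult_le_reg_l n); [lra|]; replace (n * (n * k)) with (n ^ 2 * k) by ring; lra. }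
  assert (ym - Y0 <= - (n * k)).
  { apply (Rmult_le_reg_l n); [lra|].
    abs_lra. }
  lra.
Qed.

Lemma in_range_near : near p (fun x y => in_range (X x y) (Y x y)).
Proof.
assert (Hp : in_box p r (fst p) (snd p)) by (apply in_box_center; lra).
apply near_and; [apply (smooth_cont p r X _ _ sX Hp (mkposreal rho Hrho))|
  apply (smooth_cont p r Y _ _ sY Hp (mkposreal rho Hrho))].
Qed.

Lemma smooth_along xi eta R0 zeta : smooth_on p R0 xi -> smooth_on p R0 eta ->
  smooth_on p R0 zeta -> smooth_on p R0 (along xi eta zeta).
Proof. intros; unfold along, fint; smooth. Qed.

Lemma along_fst xi eta x y : along xi eta (fun x _ => x) x y = xi x y.
Proof.
unfold along, fint, dx, dy.
rewrite Derive_id, Derive_const; ring.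
Qed.

(* [w y] is the normal component of the symmetry along the solution [h], and
   [ht t] is the image of [h] under the time-[t] flow. *)
Lemma symmetry_variation xi eta : point_symmetry E p xi eta ->
  exists R2, 0 < R2 /\ R2 <= r1 /\ smooth_on p R2 xi /\ smooth_on p R2 eta /\
  forall x0 y0 m, in_box p R2 x0 y0 -> fint Y x0 y0 1 m <> 0 ->
  exists k0 t0 (h : R -> R) (ht : R -> R -> R), 0 < k0 /\ 0 < t0 /\
    h (Y x0 y0) = X x0 y0 /\
    Derive h (Y x0 y0) = fint X x0 y0 1 m / fint Y x0 y0 1 m /\
    PX (X x0 y0) (Y x0 y0) = x0 /\ PY (X x0 y0) (Y x0 y0) = y0 /\
    (forall y, Rabs (y - Y x0 y0) < k0 -> in_range (h y) y /\
       in_box p R2 (PX (h y) y) (PY (h y) y) /\ l (PX (h y) y) (PY (h y) y) = lY y /\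
       ex_derive h y /\ is_derive (Derive h) y (- (h y ^ 2 / 2 + lY y))) /\
    (forall t, 0 < t < t0 -> forall y, Rabs (y - Y x0 y0) < k0 ->
       ex_derive (ht t) y /\ is_derive (Derive (ht t)) y (- (ht t y ^ 2 / 2 + lY y))) /\
    (forall y1, Rabs (y1 - Y x0 y0) < k0 -> forall e, 0 < e -> exists d, 0 < d /\
     forall t y, 0 < t < d -> Rabs (y - y1) < d -> Rabs ((ht t y - h y) / t -
       (along xi eta X (PX (h y1) y1) (PY (h y1) y1)
        - Derive h y1 * along xi eta Y (PX (h y1) y1) (PY (h y1) y1))) < e).
Proof.
intros (sxi & seta & eps & u & v & Heps & Hflow & Hmaps).
apply smooth_near_on in sxi; destruct sxi as (rx & Hrx & sxi).
apply smooth_near_on in seta; destruct seta as (ry & Hry & seta).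
set (rs := Rmin (Rmin rx ry) r).
assert (Hrs : 0 < rs) by (repeat apply Rmin_glb_lt; lra).
assert (sxi' : smooth_on p rs xi)
  by (apply (smooth_on_le p rx); auto; eapply Rle_trans; [apply Rmin_l|apply Rmin_l]).
assert (seta' : smooth_on p rs eta)
  by (apply (smooth_on_le p ry); auto; eapply Rle_trans; [apply Rmin_l|apply Rmin_r]).
assert (sX' : smooth_on p rs X) by (apply (smooth_on_le p r); auto; apply Rmin_r).
assert (sY' : smooth_on p rs Y) by (apply (smooth_on_le p r); auto; apply Rmin_r).
set (a := along xi eta X); set (b := along xi eta Y).
assert (sa : smooth_on p rs a) by (apply smooth_along; auto).
assert (sb : smooth_on p rs b) by (apply smooth_along; auto).
destruct (smooth_lipschitz p rs xi Hrs sxi') as (R1 & M1 & HR1 & HR1' & HM1 & B1 & L1).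
destruct (smooth_lipschitz p rs eta Hrs seta') as (R2 & M2 & HR2 & HR2' & HM2 & B2 & L2).
destruct (smooth_lipschitz p rs a Hrs sa) as (R3 & M3 & HR3 & HR3' & HM3 & B3 & L3).
destruct (smooth_lipschitz p rs b Hrs sb) as (R4 & M4 & HR4 & HR4' & HM4 & B4 & L4).
destruct (proj1 (near_box p _) in_range_near) as (R5 & HR5 & Hrange).
set (R0 := Rmin (Rmin (Rmin R1 R2) (Rmin R3 R4)) (Rmin (Rmin R5 eps) r1)).
assert (HR0 : 0 < R0) by (repeat apply Rmin_glb_lt; auto).
assert (HR0s : R0 <= R1 /\ R0 <= R2 /\ R0 <= R3 /\ R0 <= R4 /\ R0 <= R5 /\ R0 <= eps /\ R0 <= r1).
{ unfold R0; abs_lra. }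
destruct HR0s as (HA1 & HA2 & HA3 & HA4 & HA5 & HA6 & HA7).
clearbody R0.
set (M := M1 + M2 + M3 + M4).
assert (BM : forall x y, in_box p R0 x y -> Rabs (xi x y) <= M /\ Rabs (eta x y) <= M).
{ intros x y Hb; specialize (B1 x y (in_box_le p _ _ _ _ HA1 Hb)).
  specialize (B2 x y (in_box_le p _ _ _ _ HA2 Hb)); unfold M; split; lra. }
assert (LM : forall x y x' y', in_box p R0 x y -> in_box p R0 x' y' ->
   Rabs (xi x y - xi x' y') <= M * dist1 x y x' y' /\
   Rabs (eta x y - eta x' y') <= M * dist1 x y x' y').
{ intros x y x' y' Hb Hb'; pose proof (dist1_pos x y x' y').
  specialize (L1 _ _ _ _ (in_box_le p _ _ _ _ HA1 Hb) (in_box_le p _ _ _ _ HA1 Hb')).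
  specialize (L2 _ _ _ _ (in_box_le p _ _ _ _ HA2 Hb) (in_box_le p _ _ _ _ HA2 Hb')).
  split; (eapply Rle_trans; [eassumption|apply Rmult_le_compat_r; [auto|unfold M; lra]]). }
assert (Lb : forall x y x' y', in_box p R0 x y -> in_box p R0 x' y' ->
   Rabs (b x y - b x' y') <= M * dist1 x y x' y').
{ intros x y x' y' Hb Hb'; pose proof (dist1_pos x y x' y').
  specialize (L4 _ _ _ _ (in_box_le p _ _ _ _ HA4 Hb) (in_box_le p _ _ _ _ HA4 Hb')).
  eapply Rle_trans; [eassumption|apply Rmult_le_compat_r; [auto|unfold M; lra]]. }
assert (Bb : forall x y, in_box p R0 x y -> Rabs (b x y) <= M).
{ intros x y Hb; specialize (B4 x y (in_box_le p _ _ _ _ HA4 Hb)); unfold M; lra. }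
assert (HM : 0 < M) by (unfold M; lra).
assert (H0s : R0 <= rs) by lra.
clear B1 L1 B2 L2 B3 L3 B4 L4; clearbody M rs.
apply (smooth_on_le p rs R0) in sxi'; [|exact H0s]; apply (smooth_on_le p rs R0) in seta'; [|exact H0s].
apply (smooth_on_le p rs R0) in sX'; [|exact H0s]; apply (smooth_on_le p rs R0) in sY'; [|exact H0s].
apply (smooth_on_le p rs R0) in sa; [|exact H0s]; apply (smooth_on_le p rs R0) in sb; [|exact H0s].
exists (R0 / 2); split; [lra|split; [lra|split; [apply (smooth_on_le p R0); auto; lra|
  split; [apply (smooth_on_le p R0); auto; lra|]]]].
intros x0 y0 m Hb0 Hn.
assert (Hhalf : forall x y, in_box p (R0 / 2) x y -> in_box p R0 x y)
  by (intros; apply (in_box_le p (R0 / 2)); auto; lra).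
assert (Hr1b : forall x y, in_box p R0 x y -> in_box p r1 x y)
  by (intros; apply (in_box_le p R0); auto; lra).
assert (Hrb : forall x y, in_box p R0 x y -> in_box p r x y)
  by (intros; apply (in_box_le p R0); auto; lra).
assert (Hrg : forall x y, in_box p R0 x y -> in_range (X x y) (Y x y))
  by (intros; apply Hrange, (in_box_le p R0); auto).
destruct (solution_through x0 y0 m (R0 / 2)) as (fa & fb & f & Hfx & Hf & Hf0 & Hf1 & Hfbox); auto.
set (n := fint Y x0 y0 1 m) in *.
(* The derivative of [Y] along the solution. It is kept close to its nonzero value [n] at [x0], so
   that [Y] is a parameter on the piece considered. *)
pose (D := fun x => fint Y x (f x) 1 (Derive f x)).
assert (HD0 : D x0 = n) by (unfold D; rewrite Hf0, Hf1; reflexivity).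
assert (df : forall x, fa < x < fb -> is_derive f x (Derive f x))
  by (intros x Hx; apply Derive_correct, Hf, Hx).
assert (dY : forall g, smooth_on p R0 g -> forall x, fa < x < fb ->
   is_derive (fun x => g x (f x)) x (fint g x (f x) 1 (Derive f x))).
{ intros g sg x Hx; unfold fint.
  apply (smooth_chain p R0 g (fun x => x) f); auto; [apply @is_derive_id]. }
assert (cD : continuous D x0).
{ apply (ex_derive_continuous D); eexists.
  apply (fint_derive Y (fun x => x) f (fun _ => 1) (Derive f)); auto.
  - apply @is_derive_id.
  - apply @is_derive_const.
  - apply Hf, Hfx. }
assert (cf' : continuous (Derive f) x0)
  by (apply (ex_derive_continuous (Derive f)); eexists; apply Hf, Hfx).
assert (Hn0 : 0 < Rabs n) by (apply Rabs_pos_lt, Hn).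
destruct (continuous_abs_near D x0 (Rabs n / 2) cD) as (k1 & Hk1 & N1); [lra|].
destruct (continuous_abs_near (Derive f) x0 1 cf') as (k2 & Hk2 & N2); [lra|].
set (ka := Rmin (Rmin k1 k2) (Rmin (x0 - fa) (fb - x0))).
assert (Hka : 0 < ka) by (repeat apply Rmin_glb_lt; lra).
assert (Hkas : ka <= k1 /\ ka <= k2 /\ ka <= x0 - fa /\ ka <= fb - x0).
{ unfold ka; abs_lra. }
destruct Hkas as (Ka1 & Ka2 & Ka3 & Ka4); clearbody ka.
destruct (Hmaps (x0 - ka) (x0 + ka) f) with (x1 := x0) as (de & Hde & Hda & Hdb & Himg).
{ intros x Hx; apply Hf; lra. }
{ intros x Hx; apply (in_box_le p (R0 / 2)); [lra|apply Hfbox; lra]. }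
{ lra. }
assert (Hbase : forall z, Rabs (z - x0) < de -> fa < z < fb /\ in_box p (R0 / 2) z (f z) /\
   Rabs (D z - n) < Rabs n / 2 /\ Rabs (Derive f z) <= Rabs m + 1).
{ intros z Hz; assert (Hz' := Rabs_def2 _ _ Hz); split; [lra|split; [apply Hfbox; lra|split]].
  - specialize (N1 z ltac:(lra)); rewrite HD0 in N1; exact N1.
  - specialize (N2 z ltac:(lra)); rewrite Hf1 in N2.
    abs_lra. }
assert (Hbetw : forall z z' t, Rabs (z - x0) < de -> Rabs (z' - x0) < de ->
   Rmin z z' <= t <= Rmax z z' -> Rabs (t - x0) < de)
  by (intros z z' t Hz Hz' Ht; apply (abs_between z z'); auto).
set (Lf := Rabs m + 2).
assert (HLf : 2 <= Lf) by (pose proof (Rabs_pos m); unfold Lf; lra).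
assert (Hfl : forall z z', Rabs (z - x0) < de -> Rabs (z' - x0) < de ->
   dist1 z (f z) z' (f z') <= Lf * Rabs (z - z')).
{ intros z z' Hz Hz'; unfold dist1, Lf.
  pose proof (mvt_bound f (Derive f) (Rabs m + 1) z' z) as Hm.
  enough (Rabs (f z - f z') <= (Rabs m + 1) * Rabs (z - z')) by lra.
  apply Hm; intros t Ht; pose proof (Hbase t (Hbetw z' z t Hz' Hz Ht)) as Hbt; [apply df|]; apply Hbt. }
assert (HY0 : forall z z', Rabs (z - x0) < de -> Rabs (z' - x0) < de ->
   exists c, Rabs (c - x0) < de /\ Y z (f z) - Y z' (f z') = D c * (z - z')).
{ intros z z' Hz Hz'; destruct (MVT_gen (fun x => Y x (f x)) z' z D) as (c & Hc & EE).
  - intros t Ht; apply (dY Y sY'), (Hbase t); apply (Hbetw z' z); auto; lra.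
  - intros t Ht; apply continuity_pt_filterlim, (ex_derive_continuous (fun x => Y x (f x))).
    eexists; apply (dY Y sY'), (Hbase t); apply (Hbetw z' z); auto; lra.
  - exists c; split; [apply (Hbetw z' z); auto; lra|exact EE]. }
assert (HDn : forall z, Rabs (z - x0) < de -> Rabs n / 2 <= Rabs (D z) /\ n ^ 2 / 2 <= D z * n).
{ intros z Hz; destruct (Hbase z Hz) as (_ & _ & Hd & _); apply Rabs_def2 in Hd.
  destruct (Rdichotomy _ _ Hn) as [Hlt|Hgt].
  - rewrite (Rabs_left n) in * by exact Hlt; rewrite (Rabs_left (D z)) by lra; split; [lra|].
    assert (0 <= (n / 2 - D z) * (- n)) by (apply Rmult_le_pos; lra); lra.
  - rewrite (Rabs_right n) in * by lra; rewrite (Rabs_right (D z)) by lra; split; [lra|].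
    assert (0 <= (D z - n / 2) * n) by (apply Rmult_le_pos; lra); lra. }
assert (HY0' : forall z z', Rabs (z - x0) < de -> Rabs (z' - x0) < de ->
   Rabs n / 2 * Rabs (z - z') <= Rabs (Y z (f z) - Y z' (f z'))).
{ intros z z' Hz Hz'; destruct (HY0 z z' Hz Hz') as (c & Hc & ->); rewrite Rabs_mult.
  apply Rmult_le_compat_r; [apply Rabs_pos|apply HDn, Hc]. }
(* Bounds on the time, in this order: the flow estimates apply; the symmetry provides an image
   graph; abscissae remain increasing; chords of [Y] keep a quarter of the slope [n]; and [Y] moves
   by at most [Rabs n * de / 64], so that every image still covers a common window around [Y0]. *)
set (T := Rmin (Rmin (Rmin (Rmin eps (R0 / (2 * M))) (/ (4 * M))) de)
   (Rmin (/ (4 * M * Lf)) (Rmin (Rabs n / (8 * M * Lf)) (Rabs n * de / (64 * M))))).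
assert (HML : 0 < M * Lf) by (apply Rmult_lt_0_compat; lra).
assert (HT : 0 < T).
{ assert (0 < Rabs n * de) by (apply Rmult_lt_0_compat; lra).
  repeat apply Rmin_glb_lt; try lra; try apply Rinv_0_lt_compat; try apply Rdiv_lt_0_compat; lra. }
assert (HTs : T <= Rmin (Rmin eps (R0 / (2 * M))) (/ (4 * M)) /\ T <= de /\
   T <= / (4 * M * Lf) /\ T <= Rabs n / (8 * M * Lf) /\ T <= Rabs n * de / (64 * M)).
{ unfold T; abs_lra. }
destruct HTs as (T1 & T2 & T3 & T4 & T5); clearbody T.
assert (T1' := Rmin_l (Rmin eps (R0 / (2 * M))) (/ (4 * M))).
assert (T1'' : T <= Rmin eps (R0 / (2 * M))) by lra.
apply (Rmult_le_compat_r (4 * M * Lf)) in T3; [|lra].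
rewrite Rinv_l in T3 by lra.
apply (Rmult_le_compat_r (8 * M * Lf)) in T4; [|lra].
replace (Rabs n / (8 * M * Lf) * (8 * M * Lf)) with (Rabs n) in T4 by (field; split; lra).
apply (Rmult_le_compat_r (64 * M)) in T5; [|lra].
replace (Rabs n * de / (64 * M) * (64 * M)) with (Rabs n * de) in T5 by (field; lra).
assert (Hstay : forall t z, 0 <= t < T -> Rabs (z - x0) < de ->
   in_box p R0 (u t z (f z)) (v t z (f z)) /\ Rabs (u t z (f z) - z) <= M * t /\
   Rabs (v t z (f z) - f z) <= M * t).
{ intros t z Ht Hz; apply (flow_stays p xi eta eps u v R0 M Hflow HR0 HA6 HM BM);
    [apply Hbase, Hz|lra]. }
assert (HchU : forall t, 0 < t < T -> forall z z', Rabs (z - x0) < de -> Rabs (z' - x0) < de ->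
   Rabs (u t z (f z) - u t z' (f z') - (z - z')) <= / 2 * Rabs (z - z')).
{ intros t Ht z z' Hz Hz'.
  eapply Rle_trans.
  - apply (flow_chord p xi eta eps u v R0 M Hflow HR0 HA6 HM BM LM (fun x _ => x)
      (smooth_fst p R0) M z (f z) z' (f z') t).
    + intros a0 b0 a0' b0' H1 H2; rewrite !along_fst; apply (LM _ _ _ _ H1 H2).
    + lra.
    + apply Hbase, Hz.
    + apply Hbase, Hz'.
    + lra.
  - specialize (Hfl z z' Hz Hz'); pose proof (Rabs_pos (z - z')).
    apply Rle_trans with (t * (2 * M * (Lf * Rabs (z - z')))).
    + apply Rmult_le_compat_l; [lra|apply Rmult_le_compat_l; lra].
    + replace (t * (2 * M * (Lf * Rabs (z - z')))) with (t * (4 * M * Lf) / 2 * Rabs (z - z')) by field.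
      apply Rmult_le_compat_r; [lra|].
      assert (t * (4 * M * Lf) <= T * (4 * M * Lf)) by (apply Rmult_le_compat_r; lra); lra. }
assert (HchY : forall t, 0 < t < T -> forall z z', Rabs (z - x0) < de -> Rabs (z' - x0) < de ->
   Rabs n / 4 * Rabs (z - z') <=
   Rabs (Y (u t z (f z)) (v t z (f z)) - Y (u t z' (f z')) (v t z' (f z')))).
{ intros t Ht z z' Hz Hz'.
  assert (G := flow_chord p xi eta eps u v R0 M Hflow HR0 HA6 HM BM LM Y
      sY' M z (f z) z' (f z') t Lb ltac:(lra) (proj1 (proj2 (Hbase z Hz)))
      (proj1 (proj2 (Hbase z' Hz'))) ltac:(lra)).
  specialize (HY0' z z' Hz Hz'); specialize (Hfl z z' Hz Hz'); pose proof (Rabs_pos (z - z')) as Pz.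
  assert (G2 : t * (2 * M * dist1 z (f z) z' (f z')) <= Rabs n / 4 * Rabs (z - z')).
  { apply Rle_trans with (t * (2 * M * (Lf * Rabs (z - z')))).
    + apply Rmult_le_compat_l; [lra|apply Rmult_le_compat_l; lra].
    + replace (t * (2 * M * (Lf * Rabs (z - z')))) with (t * (8 * M * Lf) / 4 * Rabs (z - z')) by field.
      apply Rmult_le_compat_r; [lra|].
      assert (t * (8 * M * Lf) <= T * (8 * M * Lf)) by (apply Rmult_le_compat_r; lra); lra. }
  set (q1 := Y (u t z (f z)) (v t z (f z)) - Y (u t z' (f z')) (v t z' (f z'))) in *.
  set (q0 := Y z (f z) - Y z' (f z')) in *.
  pose proof (Rabs_triang_inv q0 (- (q1 - q0))) as Tr.
  replace (q0 - - (q1 - q0)) with q1 in Tr by ring; rewrite Rabs_Ropp in Tr; lra. }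
assert (HincY : forall t z, 0 < t < T -> Rabs (z - x0) < de ->
   exists c, 0 < c < t /\ Y (u t z (f z)) (v t z (f z)) - Y z (f z)
      = t * b (u c z (f z)) (v c z (f z))).
{ intros t z Ht Hz; apply (flow_increment p xi eta eps u v R0 M Hflow HR0 HA6 HM BM Y sY');
   [apply Hbase, Hz|lra]. }
assert (HincX : forall t z, 0 < t < T -> Rabs (z - x0) < de ->
   exists c, 0 < c < t /\ X (u t z (f z)) (v t z (f z)) - X z (f z)
      = t * a (u c z (f z)) (v c z (f z))).
{ intros t z Ht Hz; apply (flow_increment p xi eta eps u v R0 M Hflow HR0 HA6 HM BM X sX');
   [apply Hbase, Hz|lra]. }
assert (HincY' : forall t z, 0 < t < T -> Rabs (z - x0) < de ->
   Rabs (Y (u t z (f z)) (v t z (f z)) - Y z (f z)) <= M * t).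
{ intros t z Ht Hz; destruct (HincY t z Ht Hz) as (c & Hc & ->).
  rewrite Rabs_mult, (Rabs_right t), Rmult_comm by lra; apply Rmult_le_compat_r; [lra|].
  apply Bb, Hstay; auto; lra. }
set (Y0 := Y x0 y0) in *.
assert (Hx00 : Rabs (x0 - x0) < de) by (rewrite Rminus_diag, Rabs_R0; lra).
assert (Hq : Rabs (x0 + de / 4 - x0) < de /\ Rabs (x0 - de / 4 - x0) < de).
{ abs_lra. }
destruct Hq as (Hqp & Hqm).
assert (Hq2 : Rabs (x0 + de / 4 - x0) < de / 2 /\ Rabs (x0 - de / 4 - x0) < de / 2).
{ abs_lra. }
destruct Hq2 as (Hqp2 & Hqm2).
(* At [x0 + de / 4] and [x0 - de / 4] the ordinate has moved at least [Rabs n * de / 8] to either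
   side of [Y0]. Multiplication by [n] treats both signs of [n] at once. *)
assert (Wp : n ^ 2 * (de / 8) <= (Y (x0 + de / 4) (f (x0 + de / 4)) - Y0) * n).
{ destruct (HY0 (x0 + de / 4) x0 Hqp Hx00) as (c & Hc & EE); rewrite Hf0 in EE; fold Y0 in EE; rewrite EE.
  destruct (HDn c Hc) as (_ & HD2).
  replace (D c * (x0 + de / 4 - x0) * n) with (D c * n * (de / 4)) by ring.
  replace (n ^ 2 * (de / 8)) with (n ^ 2 / 2 * (de / 4)) by field.
  apply Rmult_le_compat_r; lra. }
assert (Wm : (Y (x0 - de / 4) (f (x0 - de / 4)) - Y0) * n <= - (n ^ 2 * (de / 8))).
{ destruct (HY0 (x0 - de / 4) x0 Hqm Hx00) as (c & Hc & EE); rewrite Hf0 in EE; fold Y0 in EE; rewrite EE.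
  destruct (HDn c Hc) as (_ & HD2).
  replace (D c * (x0 - de / 4 - x0) * n) with (- (D c * n * (de / 4))) by ring.
  replace (n ^ 2 * (de / 8)) with (n ^ 2 / 2 * (de / 4)) by field.
  apply Ropp_le_contravar, Rmult_le_compat_r; lra. }
assert (Hnde : 0 < Rabs n * (de / 16)) by (apply Rmult_lt_0_compat; lra).
destruct (solution_to_normal fa fb f (x0 - de / 2) (x0 + de / 2) Hf) as (c & d & h & Hcd & Himg0 & Hh).
{ lra. } { lra. } { lra. }
{ intros x Hx; apply Hrb, Hhalf, Hfbox; lra. }
{ intros x Hx; assert (Hx' : Rabs (x - x0) < de) by (apply Rabs_def1; lra).
  destruct (HDn x Hx') as (HDx & _); intros E0; change (D x = 0) in E0; rewrite E0, Rabs_R0 in HDx; lra. }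
assert (Hwin0 : forall y, Rabs (y - Y0) < Rabs n * (de / 16) -> c < y < d).
{ intros y Hy; apply (window c d (Y (x0 + de / 4) (f (x0 + de / 4)))
    (Y (x0 - de / 4) (f (x0 - de / 4))) y Y0 n (de / 8)); auto.
  - apply Himg0; exists (x0 + de / 4); split; [lra|reflexivity].
  - apply Himg0; exists (x0 - de / 4); split; [lra|reflexivity].
  - lra. }
(* The image is selected for each time separately, with a dummy function outside [(0, T)]; nothing
   is claimed about its dependence on [t]. *)
assert (Hht : forall t, exists g : R -> R, 0 < t < T -> forall y, Rabs (y - Y0) < Rabs n * (de / 16) ->
   exists z, Rabs (z - x0) < de / 2 /\ y = Y (u t z (f z)) (v t z (f z)) /\
     g y = X (u t z (f z)) (v t z (f z)) /\ ex_derive g y /\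
     is_derive (Derive g) y (- (g y ^ 2 / 2 + lY y))).
{ intros t; destruct (classic (0 < t < T)) as [Ht|Ht]; [|exists (fun _ => 0); intros; contradiction].
  destruct (Himg t) as (ct & dt & g & Hcdt & Hg & Hgimg); [rewrite Rabs_right; lra|].
  destruct (image_normal ct dt g (fun z => u t z (f z)) (fun z => v t z (f z)) x0 de (Rabs n / 4) (de / 2))
    as (c' & d' & h' & Hcd' & Hwn & Hy'); auto.
  - intros z Hz; apply Hr1b, (Hstay t z); auto; lra.
  - lra.
  - lra.
  - exists h'; intros _ y Hy.
    assert (Hy2 : c' < y < d').
    { assert (HMt : M * t * Rabs n <= n ^ 2 * (de / 64)).
      { assert (T * (64 * M) * Rabs n <= Rabs n * de * Rabs n) by (apply Rmult_le_compat_r; lra).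
        assert (t * (64 * M) * Rabs n <= T * (64 * M) * Rabs n)
          by (apply Rmult_le_compat_r; [lra|apply Rmult_le_compat_r; lra]).
        replace (n ^ 2) with (Rabs n * Rabs n) by (rewrite <- Rabs_mult, Rabs_right; [ring|apply Rle_ge, Rle_0_sqr]); lra. }
      assert (Hn2 : 0 < n ^ 2 * (de / 64)) by (apply Rmult_lt_0_compat;
        [rewrite <- Rsqr_pow2; apply Rsqr_pos_lt, Hn|lra]).
      assert (Hmv : forall z, Rabs (z - x0) < de ->
        Rabs ((Y (u t z (f z)) (v t z (f z)) - Y z (f z)) * n) <= n ^ 2 * (de / 64)).
      { intros z Hz; rewrite Rabs_mult; eapply Rle_trans; [|exact HMt].
        apply Rmult_le_compat_r; [lra|apply HincY'; auto]. }
      pose proof (Hmv _ Hqp) as Mp; pose proof (Hmv _ Hqm) as Mm.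
      apply Rabs_le_between in Mp; apply Rabs_le_between in Mm.
      apply (window c' d' _ _ y Y0 n (de / 16) (Hwn _ Hqp2) (Hwn _ Hqm2) Hn); lra. }
    destruct (Hy' y Hy2) as (z & Hz & E1 & E2 & D1 & D2).
    exists z; split; [exact Hz|split; [exact E1|split; [exact E2|split; [exact D1|]]]].
    assert (Hbz : in_box p R0 (u t z (f z)) (v t z (f z))) by (apply Hstay; lra).
    rewrite E2, E1, <- l_lY; [rewrite <- E1; exact D2|apply Hr1b, Hbz|apply Hrg, Hbz]. }
assert (Hch : exists ht : R -> R -> R, forall t, 0 < t < T -> forall y, Rabs (y - Y0) < Rabs n * (de / 16) ->
   exists z, Rabs (z - x0) < de / 2 /\ y = Y (u t z (f z)) (v t z (f z)) /\
     ht t y = X (u t z (f z)) (v t z (f z)) /\ ex_derive (ht t) y /\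
     is_derive (Derive (ht t)) y (- (ht t y ^ 2 / 2 + lY y))).
{ exists (fun t => proj1_sig (constructive_indefinite_description _ (Hht t))).
  intros t; destruct (constructive_indefinite_description _ (Hht t)); auto. }
destruct Hch as (ht & Hht').
assert (Hbase0 : forall y, Rabs (y - Y0) < Rabs n * (de / 16) ->
   exists z, Rabs (z - x0) < de / 2 /\ y = Y z (f z) /\ h y = X z (f z) /\
     in_box p (R0 / 2) z (f z) /\ PX (h y) y = z /\ PY (h y) y = f z /\
     is_derive h y (fint X z (f z) 1 (Derive f z) / fint Y z (f z) 1 (Derive f z)) /\
     is_derive (Derive h) y (- (h y ^ 2 / 2 + lY y))).
{ intros y Hy; pose proof (proj1 (Himg0 y) (Hwin0 y Hy)) as (z & Hz & Ey).
  assert (Hz2 : Rabs (z - x0) < de / 2) by (apply Rabs_def1; lra).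
  destruct (Hh z Hz) as (E1 & D1 & D2); rewrite <- Ey in *.
  assert (Hbz : in_box p (R0 / 2) z (f z)) by (apply Hbase; lra).
  destruct (inverse_normal z (f z)) as (P1 & P2); [apply Hr1b, Hhalf, Hbz|apply Hrg, Hhalf, Hbz|].
  rewrite <- E1, <- Ey in P1, P2.
  rewrite l_lY, <- Ey, <- E1 in D2; [|apply Hr1b, Hhalf, Hbz|apply Hrg, Hhalf, Hbz].
  exists z; exact (conj Hz2 (conj Ey (conj E1 (conj Hbz (conj P1 (conj P2 (conj D1 D2))))))). }
destruct (inverse_normal x0 y0) as (Pa & Pb);
  [apply Hr1b, Hhalf, Hb0|apply Hrg, Hhalf, Hb0|].
destruct (Hh x0) as (Eh0 & Dh0 & _); [lra|].
rewrite Hf0, Hf1 in Dh0; rewrite Hf0 in Eh0; fold Y0 n in Dh0, Eh0.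
exists (Rabs n * (de / 16)), T, h, ht.
split; [exact Hnde|split; [exact HT|split; [exact Eh0|split; [apply is_derive_unique, Dh0|]]]].
split; [exact Pa|split; [exact Pb|split; [|split]]].
- intros y Hy; destruct (Hbase0 y Hy) as (z & Hz & Ey & E1 & Hbz & P1 & P2 & D1 & D2).
  split; [rewrite E1, Ey; apply Hrg, Hhalf, Hbz|split; [rewrite P1, P2; exact Hbz|split]].
  + rewrite P1, P2, Ey; apply l_lY; [apply Hr1b, Hhalf, Hbz|apply Hrg, Hhalf, Hbz].
  + split; [eexists; exact D1|exact D2].
- intros t Ht y Hy; destruct (Hht' t Ht y Hy) as (z & _ & _ & _ & D1 & D2); split; [exact D1|exact D2].
- intros y1 Hy1 e He.
  destruct (Hbase0 y1 Hy1) as (z1 & Hz1 & Ey1 & Eh1 & Hbz1 & P1 & P2 & _ & D2); rewrite P1, P2.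
  fold a b; set (A1 := a z1 (f z1)); set (B1 := b z1 (f z1)); set (h1 := Derive h y1).
  set (S := 2 + Rabs B1 + Rabs h1).
  assert (HS : 2 <= S) by (pose proof (Rabs_pos B1); pose proof (Rabs_pos h1); unfold S; lra).
  (* Three errors, in [a], in [h'] and in [b], add up to at most [e1] times
     [1 + (Rabs B1 + 1) + Rabs h1], which is [e1 * S]. *)
  set (e1 := Rmin 1 (e / (2 * S))).
  assert (He1 : 0 < e1) by (apply Rmin_glb_lt; [lra|apply Rdiv_lt_0_compat; lra]).
  assert (He1' : e1 * S < e).
  { apply Rle_lt_trans with (e / (2 * S) * S); [apply Rmult_le_compat_r; [lra|apply Rmin_r]|].
    replace (e / (2 * S) * S) with (e / 2) by (field; lra); lra. }
  assert (He11 : e1 <= 1) by apply Rmin_l.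
  destruct (smooth_cont p R0 a z1 (f z1) sa (Hhalf _ _ Hbz1) (mkposreal e1 He1)) as (d1 & N3).
  destruct (smooth_cont p R0 b z1 (f z1) sb (Hhalf _ _ Hbz1) (mkposreal e1 He1)) as (d2 & N4).
  destruct (continuous_abs_near (Derive h) y1 e1) as (d3 & Hd3 & N5);
    [apply (ex_derive_continuous (Derive h)); eexists; exact D2|exact He1|].
  simpl in N3, N4.
  set (dm := Rmin d1 d2).
  assert (Hdm : 0 < dm) by (apply Rmin_glb_lt; apply cond_pos).
  assert (Hdm1 : dm <= d1) by apply Rmin_l; assert (Hdm2 : dm <= d2) by apply Rmin_r.
  set (gap := Rabs n * (de / 16) - Rabs (y1 - Y0)).
  assert (Hgap : 0 < gap) by (unfold gap; lra).
  (* [dl] keeps the chosen points within [dm] of [(z1, f z1)], and the two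
     arguments of [h] within the window and within [d3] of [y1]. *)
  set (dy1 := Rmin (Rmin d3 gap) (Rabs n * dm / (4 * Lf))).
  assert (Hdy1 : 0 < dy1).
  { repeat apply Rmin_glb_lt; auto; apply Rdiv_lt_0_compat; [apply Rmult_lt_0_compat|]; lra. }
  assert (Hdy3 : dy1 <= d3) by (unfold dy1; abs_lra).
  assert (Hdyg : dy1 <= gap) by (unfold dy1; abs_lra).
  assert (Hdym : Lf * (dy1 * 2) <= Rabs n * dm / 2).
  { apply Rle_trans with (Lf * (Rabs n * dm / (4 * Lf) * 2)); [|right; field; lra].
    apply Rmult_le_compat_l; [lra|]; apply Rmult_le_compat_r; [lra|apply Rmin_r]. }
  clearbody dy1 dm.
  set (dl := Rmin (Rmin T (dy1 / 4)) (Rmin (dy1 / (4 * M)) (dm / (2 * M)))).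
  assert (Hdl : 0 < dl) by (repeat apply Rmin_glb_lt; try lra; apply Rdiv_lt_0_compat; lra).
  assert (Hdls : dl <= T /\ dl <= dy1 / 4 /\ dl <= dy1 / (4 * M) /\ dl <= dm / (2 * M)).
  { unfold dl; abs_lra. }
  destruct Hdls as (Q1 & Q2 & Q3 & Q4); clearbody dl.
  apply (Rmult_le_compat_l M) in Q3; [|lra]; apply (Rmult_le_compat_l M) in Q4; [|lra].
  replace (M * (dy1 / (4 * M))) with (dy1 / 4) in Q3 by (field; lra).
  replace (M * (dm / (2 * M))) with (dm / 2) in Q4 by (field; lra).
  exists dl; split; [exact Hdl|]; intros t y Ht Hy.
  assert (HtT : 0 < t < T) by lra.
  assert (HMt : M * t < M * dl) by (apply Rmult_lt_compat_l; lra).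
  assert (Hyw : Rabs (y - Y0) < Rabs n * (de / 16)).
  { replace (y - Y0) with ((y - y1) + (y1 - Y0)) by ring.
    eapply Rle_lt_trans; [apply Rabs_triang|unfold gap in *; lra]. }
  destruct (Hht' t HtT y Hyw) as (z & Hz & Ey & Ex & _ & _).
  assert (Hzd : Rabs (z - x0) < de) by lra; assert (Hz1d : Rabs (z1 - x0) < de) by lra.
  set (yz := Y z (f z)).
  assert (Hyz : Rabs (y - yz) <= M * t) by (rewrite Ey; apply HincY'; auto).
  assert (Hyz1 : Rabs (yz - y1) < dy1 / 2).
  { abs_lra. }
  assert (Hyy1 : Rabs (y - y1) < dy1 / 2) by lra.
  assert (Hzz : dist1 z (f z) z1 (f z1) < dm / 2).
  { eapply Rle_lt_trans; [apply Hfl; auto|].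
    pose proof (HY0' z z1 Hzd Hz1d) as G; fold yz in G; rewrite <- Ey1 in G.
    apply (Rmult_lt_reg_l (Rabs n)); [exact Hn0|].
    replace (Rabs n * (Lf * Rabs (z - z1))) with (Lf * (Rabs n / 2 * Rabs (z - z1) * 2)) by field.
    apply Rle_lt_trans with (Lf * (Rabs (yz - y1) * 2)); [apply Rmult_le_compat_l; lra|].
    apply Rlt_le_trans with (Lf * (dy1 * 2)); [apply Rmult_lt_compat_l; lra|lra]. }
  assert (Hclose : forall s, 0 < s < t ->
     Rabs (u s z (f z) - z1) < dm /\ Rabs (v s z (f z) - f z1) < dm).
  { intros s Hs; destruct (Hstay s z ltac:(lra) Hzd) as (_ & S1 & S2).
    assert (M * s < M * t) by (apply Rmult_lt_compat_l; lra).
    unfold dist1 in Hzz; pose proof (Rabs_pos (z - z1)); pose proof (Rabs_pos (f z - f z1)).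
    split.
    - abs_lra.
    - abs_lra. }
  destruct (HincX t z HtT Hzd) as (s1 & Hs1 & EX); destruct (HincY t z HtT Hzd) as (s2 & Hs2 & EY).
  assert (Hyzw : Rabs (yz - Y0) < Rabs n * (de / 16)).
  { replace (yz - Y0) with ((yz - y1) + (y1 - Y0)) by ring.
    eapply Rle_lt_trans; [apply Rabs_triang|unfold gap in *; lra]. }
  destruct (MVT_gen h yz y (Derive h)) as (th & Hth & EH).
  { intros w Hw; destruct (Hbase0 w) as (? & _ & _ & _ & _ & _ & _ & Dw & _);
      [apply (abs_between yz y); auto; lra|].
    apply Derive_correct; eexists; exact Dw. }
  { intros w Hw; destruct (Hbase0 w) as (? & _ & _ & _ & _ & _ & _ & Dw & _);
      [apply (abs_between yz y); auto; lra|].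
    apply continuity_pt_filterlim, (ex_derive_continuous h); eexists; exact Dw. }
  assert (Hhz : h yz = X z (f z)).
  { unfold yz; apply (Hh z); apply Rabs_def2 in Hz; lra. }
  set (As := a (u s1 z (f z)) (v s1 z (f z))) in *.
  set (Bs := b (u s2 z (f z)) (v s2 z (f z))) in *.
  (* The point of the image over [y] comes from the point of the solution over [yz]. Its value of
     [X] has changed by [t * As], while [h] changes by its slope at [th] times [t * Bs] between [yz]
     and [y]. *)
  replace ((ht t y - h y) / t) with (As - Derive h th * Bs).
  2:{ assert (Eyz : y - yz = t * Bs) by (rewrite Ey; exact EY).
      rewrite Eyz, Hhz in EH.
      rewrite Ex; replace (h y) with (X z (f z) + Derive h th * (t * Bs)) by lra.
      replace (X (u t z (f z)) (v t z (f z))) with (X z (f z) + t * As) by lra; field; lra. }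
  destruct (Hclose s1 Hs1) as (c1 & c2); destruct (Hclose s2 Hs2) as (c3 & c4).
  assert (GA : Rabs (As - A1) < e1) by (apply N3; lra).
  assert (GB : Rabs (Bs - B1) < e1) by (apply N4; lra).
  assert (GH : Rabs (Derive h th - h1) < e1).
  { apply N5; apply (abs_between yz y); auto; lra. }
  replace (As - Derive h th * Bs - (A1 - h1 * B1)) with
    ((As - A1) - (Derive h th - h1) * Bs - h1 * (Bs - B1)) by ring.
  assert (GBs : Rabs Bs <= Rabs B1 + 1).
  { abs_lra. }
  unfold Rminus at 1; eapply Rle_lt_trans; [apply Rabs_triang|].
  unfold Rminus at 1; pose proof (Rabs_triang (As - A1) (- ((Derive h th - h1) * Bs))) as G1.
  rewrite Rabs_Ropp, Rabs_mult in G1; rewrite Rabs_Ropp, Rabs_mult.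
  assert (G2 : Rabs (Derive h th - h1) * Rabs Bs <= e1 * (Rabs B1 + 1))
    by (apply Rmult_le_compat; try apply Rabs_pos; lra).
  assert (G3 : Rabs h1 * Rabs (Bs - B1) <= Rabs h1 * e1)
    by (apply Rmult_le_compat_l; [apply Rabs_pos|lra]).
  unfold S in He1'; lra.
Qed.

(** [DX] and [DY] are the coordinate fields of [(X, Y)], written in the original variables. They
    allow calculation in normal coordinates on the original box, without composing with the
    inverse. *)
Definition DX (f : R -> R -> R) (x y : R) : R :=
  (dy Y x y * dx f x y - dx Y x y * dy f x y) / jac X Y x y.
Definition DY (f : R -> R -> R) (x y : R) : R :=
  (dx X x y * dy f x y - dy X x y * dx f x y) / jac X Y x y.

Section Derivations.
Variable R2 : R.
Hypothesis HR2 : R2 <= r.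

Let HJ2 x y : in_box p R2 x y -> jac X Y x y <> 0.
Proof. intros Hb; apply HJ, (in_box_le p R2); auto. Qed.
Let sX2 : smooth_on p R2 X := smooth_on_le p r R2 X HR2 sX.
Let sY2 : smooth_on p R2 Y := smooth_on_le p r R2 Y HR2 sY.

Lemma smooth_DX f : smooth_on p R2 f -> smooth_on p R2 (DX f).
Proof. intros sf; unfold DX; smooth; [exact HJ2|unfold jac; smooth]. Qed.

Lemma smooth_DY f : smooth_on p R2 f -> smooth_on p R2 (DY f).
Proof. intros sf; unfold DY; smooth; [exact HJ2|unfold jac; smooth]. Qed.

Lemma DX_eq f g : (forall x y, in_box p R2 x y -> f x y = g x y) ->
  forall x y, in_box p R2 x y -> DX f x y = DX g x y.
Proof.
intros H x y Hb; unfold DX.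
rewrite (dx_eq p R2 f g H x y Hb), (dy_eq p R2 f g H x y Hb); reflexivity.
Qed.

Lemma DY_eq f g : (forall x y, in_box p R2 x y -> f x y = g x y) ->
  forall x y, in_box p R2 x y -> DY f x y = DY g x y.
Proof.
intros H x y Hb; unfold DY.
rewrite (dx_eq p R2 f g H x y Hb), (dy_eq p R2 f g H x y Hb); reflexivity.
Qed.

Lemma DXY_dx f x y : in_box p R2 x y ->
  dx f x y = dx X x y * DX f x y + dx Y x y * DY f x y /\
  dy f x y = dy X x y * DX f x y + dy Y x y * DY f x y.
Proof.
intros Hb; pose proof (HJ2 x y Hb) as HJb; unfold DX, DY, jac in *; split; field; exact HJb.
Qed.

(** Write the equality of mixed derivatives of [f] with [df = DX f dX + DY f dY]. The second
    derivatives of [X] and [Y] are symmetric and drop out, and what remains is the numerator of the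
    commutator. *)
Lemma DX_DY f x y : smooth_on p R2 f -> in_box p R2 x y -> DX (DY f) x y = DY (DX f) x y.
Proof.
intros sf Hb.
pose proof (smooth_DX f sf) as sDX; pose proof (smooth_DY f sf) as sDY.
pose proof (smooth_schwarz p R2 f x y sf Hb) as HS.
rewrite (dx_eq p R2 _ _ (fun x y Hb => proj2 (DXY_dx f x y Hb)) x y Hb) in HS.
rewrite (dy_eq p R2 _ _ (fun x y Hb => proj1 (DXY_dx f x y Hb)) x y Hb) in HS.
assert (E1 : dx (fun x y => dy X x y * DX f x y + dy Y x y * DY f x y) x y =
  dx (dy X) x y * DX f x y + dy X x y * dx (DX f) x y
  + dx (dy Y) x y * DY f x y + dy Y x y * dx (DY f) x y).
{ set (F := DX f) in *; set (G := DY f) in *; clearbody F G; expand_partials; ring. }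
assert (E2 : dy (fun x y => dx X x y * DX f x y + dx Y x y * DY f x y) x y =
  dy (dx X) x y * DX f x y + dx X x y * dy (DX f) x y
  + dy (dx Y) x y * DY f x y + dx Y x y * dy (DY f) x y).
{ set (F := DX f) in *; set (G := DY f) in *; clearbody F G; expand_partials; ring. }
rewrite E1, E2, (smooth_schwarz p R2 X x y sX2 Hb), (smooth_schwarz p R2 Y x y sY2 Hb) in HS.
pose proof (HJ2 x y Hb) as HJb.
change ((dy Y x y * dx (DY f) x y - dx Y x y * dy (DY f) x y) / jac X Y x y =
  (dx X x y * dy (DX f) x y - dy X x y * dx (DX f) x y) / jac X Y x y).
apply Rmult_eq_compat_r; lra.
Qed.

Lemma DX_plus f g x y : smooth_on p R2 f -> smooth_on p R2 g -> in_box p R2 x y ->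
  DX (fun x y => f x y + g x y) x y = DX f x y + DX g x y.
Proof.
intros sf sg Hb; pose proof (HJ2 x y Hb) as HJb.
assert (E1 : dx (fun x y => f x y + g x y) x y = dx f x y + dx g x y) by (expand_partials; ring).
assert (E2 : dy (fun x y => f x y + g x y) x y = dy f x y + dy g x y) by (expand_partials; ring).
unfold DX; rewrite E1, E2; field; exact HJb.
Qed.

Lemma DX_mult f g x y : smooth_on p R2 f -> smooth_on p R2 g -> in_box p R2 x y ->
  DX (fun x y => f x y * g x y) x y = DX f x y * g x y + f x y * DX g x y.
Proof.
intros sf sg Hb; pose proof (HJ2 x y Hb) as HJb.
assert (E1 : dx (fun x y => f x y * g x y) x y = dx f x y * g x y + f x y * dx g x y) by (expand_partials; ring).
assert (E2 : dy (fun x y => f x y * g x y) x y = dy f x y * g x y + f x y * dy g x y) by (expand_partials; ring).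
unfold DX; rewrite E1, E2; field; exact HJb.
Qed.

Lemma DY_plus f g x y : smooth_on p R2 f -> smooth_on p R2 g -> in_box p R2 x y ->
  DY (fun x y => f x y + g x y) x y = DY f x y + DY g x y.
Proof.
intros sf sg Hb; pose proof (HJ2 x y Hb) as HJb.
assert (E1 : dx (fun x y => f x y + g x y) x y = dx f x y + dx g x y) by (expand_partials; ring).
assert (E2 : dy (fun x y => f x y + g x y) x y = dy f x y + dy g x y) by (expand_partials; ring).
unfold DY; rewrite E1, E2; field; exact HJb.
Qed.

Lemma DY_mult f g x y : smooth_on p R2 f -> smooth_on p R2 g -> in_box p R2 x y ->
  DY (fun x y => f x y * g x y) x y = DY f x y * g x y + f x y * DY g x y.
Proof.
intros sf sg Hb; pose proof (HJ2 x y Hb) as HJb.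
assert (E1 : dx (fun x y => f x y * g x y) x y = dx f x y * g x y + f x y * dx g x y) by (expand_partials; ring).
assert (E2 : dy (fun x y => f x y * g x y) x y = dy f x y * g x y + f x y * dy g x y) by (expand_partials; ring).
unfold DY; rewrite E1, E2; field; exact HJb.
Qed.

Lemma DX_const c x y : DX (fun _ _ => c) x y = 0.
Proof. unfold DX, dx, dy; rewrite !Derive_const; unfold Rdiv; ring. Qed.

Lemma DY_const c x y : DY (fun _ _ => c) x y = 0.
Proof. unfold DY, dx, dy; rewrite !Derive_const; unfold Rdiv; ring. Qed.

Lemma DX_scal c f x y : smooth_on p R2 f -> in_box p R2 x y ->
  DX (fun x y => c * f x y) x y = c * DX f x y.
Proof.
intros sf Hb; rewrite (DX_mult (fun _ _ => c) f), DX_const; auto; [ring|apply smooth_const].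
Qed.

Lemma DY_scal c f x y : smooth_on p R2 f -> in_box p R2 x y ->
  DY (fun x y => c * f x y) x y = c * DY f x y.
Proof.
intros sf Hb; rewrite (DY_mult (fun _ _ => c) f), DY_const; auto; [ring|apply smooth_const].
Qed.

Lemma DX_X x y : in_box p R2 x y -> DX X x y = 1.
Proof. intros Hb; pose proof (HJ2 x y Hb) as HJb; unfold DX, jac in *; field; exact HJb. Qed.
Lemma DX_Y x y : in_box p R2 x y -> DX Y x y = 0.
Proof. intros Hb; pose proof (HJ2 x y Hb) as HJb; unfold DX, jac in *; field; exact HJb. Qed.
Lemma DY_X x y : in_box p R2 x y -> DY X x y = 0.
Proof. intros Hb; pose proof (HJ2 x y Hb) as HJb; unfold DY, jac in *; field; exact HJb. Qed.
Lemma DY_Y x y : in_box p R2 x y -> DY Y x y = 1.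
Proof. intros Hb; pose proof (HJ2 x y Hb) as HJb; unfold DY, jac in *; field; exact HJb. Qed.

Lemma DX_l x y : in_box p R2 x y -> DX l x y = 0.
Proof.
intros Hb; pose proof (HJ2 x y Hb) as HJb; assert (Hb' := in_box_le p R2 r x y HR2 Hb).
unfold DX; rewrite (nc_dxl _ _ _ _ _ _ _ nc x y Hb'), (nc_dyl _ _ _ _ _ _ _ nc x y Hb').
field; exact HJb.
Qed.

Lemma DY_l x y : in_box p R2 x y -> DY l x y = K x y.
Proof.
intros Hb; pose proof (HJ2 x y Hb) as HJb; assert (Hb' := in_box_le p R2 r x y HR2 Hb).
unfold DY; rewrite (nc_dxl _ _ _ _ _ _ _ nc x y Hb'), (nc_dyl _ _ _ _ _ _ _ nc x y Hb').
unfold jac in *; field; exact HJb.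
Qed.

Lemma constant_of_DXY f : 0 < R2 -> smooth_on p R2 f ->
  (forall x y, in_box p R2 x y -> DX f x y = 0 /\ DY f x y = 0) ->
  forall x y, in_box p R2 x y -> f x y = f (fst p) (snd p).
Proof.
intros H0 sf H x y Hb; apply Rminus_diag_uniq, Rabs_eq_0, Rle_antisym; [|apply Rabs_pos].
pose proof (increment_bound p R2 f 0 0 0 sf) as HI.
replace (f x y - f (fst p) (snd p)) with
  (f x y - f (fst p) (snd p) - (0 * (x - fst p) + 0 * (y - snd p))) by ring.
eapply Rle_trans; [apply HI; auto; [|apply in_box_center, H0]|lra].
intros a b Hab; destruct (DXY_dx f a b Hab) as (E1 & E2); destruct (H a b Hab) as (G1 & G2).
rewrite E1, E2, G1, G2, !Rmult_0_r, Rplus_0_r, Rminus_diag, Rabs_R0; lra.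
Qed.
End Derivations.

(** * The determining equations and their solution *)

Lemma graph_derive R2 (f : R -> R -> R) (h : R -> R) y q : R2 <= r ->
  smooth_on p R2 f -> is_derive h y q -> in_range (h y) y -> in_box p R2 (PX (h y) y) (PY (h y) y) ->
  is_derive (fun y => f (PX (h y) y) (PY (h y) y)) y
    (DY f (PX (h y) y) (PY (h y) y) + q * DX f (PX (h y) y) (PY (h y) y)).
Proof.
intros HR sf Hh Hr Hb.
destruct (inverse_derive h (fun y => y) y q 1 Hh (is_derive_id y) Hr) as (D1 & D2).
pose proof (smooth_chain p R2 f (fun y => PX (h y) y) (fun y => PY (h y) y) y _ _ sf Hb D1 D2) as D.
match type of D with is_derive _ _ ?w => match goal with |- is_derive _ _ ?w' =>
    replace w' with w; [exact D|] end end.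
pose proof (HJ _ _ (in_box_le p R2 r _ _ HR Hb)) as HJb.
unfold DX, DY, pull1, pull2; field; exact HJb.
Qed.

(** The function [w = a - h' b] is differentiated twice along a solution with [h'' = - s], and the
    result is compared with [- h w]. Only the value and the slope [q] of the solution survive, the
    latter polynomially. *)
Lemma symmetry_polynomial xi eta : point_symmetry E p xi eta ->
  exists R2, 0 < R2 /\ R2 <= r1 /\ smooth_on p R2 xi /\ smooth_on p R2 eta /\
  forall x y m, in_box p R2 x y -> fint Y x y 1 m <> 0 ->
  let a := along xi eta X in let b := along xi eta Y in
  let q := fint X x y 1 m / fint Y x y 1 m in let s := X x y ^ 2 / 2 + l x y in
  (DY (DY a) x y - s * DX a x y + 2 * s * DY b x y + K x y * b x y + X x y * a x y)
  + (2 * DX (DY a) x y - DY (DY b) x y + 3 * s * DX b x y) * q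
  + (DX (DX a) x y - 2 * DX (DY b) x y) * q ^ 2 - DX (DX b) x y * q ^ 3 = 0.
Proof.
intros Hsym; destruct (symmetry_variation xi eta Hsym) as (R2 & HR2 & HR2' & sxi & seta & H).
exists R2; split; [exact HR2|split; [exact HR2'|split; [exact sxi|split; [exact seta|]]]].
intros x0 y0 m Hb Hn a b q s.
destruct (H x0 y0 m Hb Hn) as (k0 & t0 & h & ht & Hk0 & Ht0 & Eh & Eh1 & EPX & EPY & Hh & Hht & Hlim).
fold q in Eh1; fold a b in Hlim.
assert (HRr : R2 <= r) by lra.
assert (sX2 := smooth_on_le p r R2 X HRr sX); assert (sY2 := smooth_on_le p r R2 Y HRr sY).
assert (sl2 := smooth_on_le p r R2 l HRr sl).
assert (sa : smooth_on p R2 a) by (apply smooth_along; auto).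
assert (sb : smooth_on p R2 b) by (apply smooth_along; auto).
pose (sg := fun x y => X x y ^ 2 / 2 + l x y).
assert (ssg : smooth_on p R2 sg) by (unfold sg, Rdiv; smooth).
set (Y0 := Y x0 y0) in *.
pose (at_ := fun (f : R -> R -> R) y => f (PX (h y) y) (PY (h y) y)).
assert (dat : forall f, smooth_on p R2 f -> forall y, Rabs (y - Y0) < k0 ->
   is_derive (at_ f) y (at_ (DY f) y + Derive h y * at_ (DX f) y)).
{ intros f sf y Hy; destruct (Hh y Hy) as (G1 & G2 & _ & G3 & _).
  apply (graph_derive R2 f h y); auto; apply Derive_correct, G3. }
assert (dh2 : forall y, Rabs (y - Y0) < k0 -> is_derive (Derive h) y (- at_ sg y)).
{ intros y Hy; destruct (Hh y Hy) as ((G1 & G1') & G2 & G4 & _ & G5).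
  unfold at_, sg; rewrite G4, (proj1 (proj2 (Hinv _ _ G1 G1'))); exact G5. }
pose (w := fun y => at_ a y - Derive h y * at_ b y).
pose (w1 := fun y => at_ (DY a) y + Derive h y * at_ (DX a) y
   - (- at_ sg y * at_ b y + Derive h y * (at_ (DY b) y + Derive h y * at_ (DX b) y))).
assert (dw : forall y, Rabs (y - Y0) < k0 -> is_derive w y (w1 y)).
{ intros y Hy; apply @is_derive_minus; [apply dat; auto|].
  apply (is_derive_mult (Derive h) (at_ b)); [apply dh2, Hy|apply dat; auto|exact Rmult_comm]. }
assert (HY0 : Rabs (Y0 - Y0) < k0) by (rewrite Rminus_diag, Rabs_R0; exact Hk0).
assert (sDXa := smooth_DX R2 HRr a sa); assert (sDYa := smooth_DY R2 HRr a sa).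
assert (sDXb := smooth_DX R2 HRr b sb); assert (sDYb := smooth_DY R2 HRr b sb).
pose (W2 := (at_ (DY (DY a)) Y0 + Derive h Y0 * at_ (DX (DY a)) Y0)
  + (- at_ sg Y0 * at_ (DX a) Y0 + Derive h Y0 * (at_ (DY (DX a)) Y0 + Derive h Y0 * at_ (DX (DX a)) Y0))
  - ((- (at_ (DY sg) Y0 + Derive h Y0 * at_ (DX sg) Y0) * at_ b Y0
      + - at_ sg Y0 * (at_ (DY b) Y0 + Derive h Y0 * at_ (DX b) Y0))
     + (- at_ sg Y0 * (at_ (DY b) Y0 + Derive h Y0 * at_ (DX b) Y0)
       + Derive h Y0 * ((at_ (DY (DY b)) Y0 + Derive h Y0 * at_ (DX (DY b)) Y0)
         + (- at_ sg Y0 * at_ (DX b) Y0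
            + Derive h Y0 * (at_ (DY (DX b)) Y0 + Derive h Y0 * at_ (DX (DX b)) Y0)))))).
assert (dw1 : is_derive w1 Y0 W2).
{ pose proof (dh2 Y0 HY0) as Dh.
  apply @is_derive_minus.
  - apply (is_derive_plus (at_ (DY a)) (fun y => Derive h y * at_ (DX a) y)); [apply dat; auto|].
    apply (is_derive_mult (Derive h) (at_ (DX a))); [exact Dh|apply dat; auto|exact Rmult_comm].
  - apply (is_derive_plus (fun y => - at_ sg y * at_ b y)
      (fun y => Derive h y * (at_ (DY b) y + Derive h y * at_ (DX b) y))).
    + apply (is_derive_mult (fun y => - at_ sg y) (at_ b));
        [apply @is_derive_opp, dat; auto|apply dat; auto|exact Rmult_comm].
    + apply (is_derive_mult (Derive h) (fun y => at_ (DY b) y + Derive h y * at_ (DX b) y));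
        [exact Dh| |exact Rmult_comm].
      apply (is_derive_plus (at_ (DY b)) (fun y => Derive h y * at_ (DX b) y)); [apply dat; auto|].
      apply (is_derive_mult (Derive h) (at_ (DX b))); [exact Dh|apply dat; auto|exact Rmult_comm]. }
assert (HV := variation_equation k0 Y0 W2 h lY w w1 ht t0 Hk0 Ht0
  (fun y Hy => proj2 (proj2 (proj2 (Hh y Hy)))) Hht Hlim dw dw1).
assert (Eat : forall f, at_ f Y0 = f x0 y0) by (intros f; unfold at_; rewrite Eh, EPX, EPY; reflexivity).
unfold W2, w in HV; rewrite !Eat, Eh, Eh1 in HV.
assert (HDXsg : DX sg x0 y0 = X x0 y0).
{ transitivity (DX (fun x y => / 2 * (X x y * X x y) + l x y) x0 y0).
  - apply (DX_eq R2); auto; intros; unfold sg; field.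
  - assert (sXX : smooth_on p R2 (fun x y => X x y * X x y)) by smooth.
    assert (sXX2 : smooth_on p R2 (fun x y => / 2 * (X x y * X x y))) by smooth.
    rewrite (DX_plus R2 HRr (fun x y => / 2 * (X x y * X x y)) l), (DX_scal R2 HRr), (DX_mult R2 HRr X X),
      (DX_X R2 HRr), (DX_l R2 HRr) by auto; field. }
assert (HDYsg : DY sg x0 y0 = K x0 y0).
{ transitivity (DY (fun x y => / 2 * (X x y * X x y) + l x y) x0 y0).
  - apply (DY_eq R2); auto; intros; unfold sg; field.
  - assert (sXX : smooth_on p R2 (fun x y => X x y * X x y)) by smooth.
    assert (sXX2 : smooth_on p R2 (fun x y => / 2 * (X x y * X x y))) by smooth.
    rewrite (DY_plus R2 HRr (fun x y => / 2 * (X x y * X x y)) l), (DY_scal R2 HRr), (DY_mult R2 HRr X X),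
      (DY_X R2 HRr), (DY_l R2 HRr) by auto; field. }
rewrite HDXsg, HDYsg, <- !(DX_DY R2 HRr) in HV by auto.
change (sg x0 y0) with s in HV; lra.
Qed.

Lemma symmetry_coefficients xi eta : point_symmetry E p xi eta ->
  exists R2, 0 < R2 /\ R2 <= r1 /\ smooth_on p R2 xi /\ smooth_on p R2 eta /\
  forall x y, in_box p R2 x y ->
  let a := along xi eta X in let b := along xi eta Y in
  let s := X x y ^ 2 / 2 + l x y in
  DY (DY a) x y - s * DX a x y + 2 * s * DY b x y + K x y * b x y + X x y * a x y = 0 /\
  2 * DX (DY a) x y - DY (DY b) x y + 3 * s * DX b x y = 0 /\
  DX (DX a) x y - 2 * DX (DY b) x y = 0 /\ DX (DX b) x y = 0.
Proof.
intros Hsym; destruct (symmetry_polynomial xi eta Hsym) as (R2 & HR2 & HR2' & sxi & seta & H).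
exists R2; split; [exact HR2|split; [exact HR2'|split; [exact sxi|split; [exact seta|]]]].
intros x y Hb a b s.
assert (HJb : jac X Y x y <> 0) by (apply HJ, (in_box_le p R2); auto; lra).
specialize (H x y).
set (c0 := DY (DY a) x y - s * DX a x y + 2 * s * DY b x y + K x y * b x y + X x y * a x y).
set (c1 := 2 * DX (DY a) x y - DY (DY b) x y + 3 * s * DX b x y).
set (c2 := DX (DX a) x y - 2 * DX (DY b) x y); set (c3 := DX (DX b) x y).
(* As [m] varies, [q] takes every value except that of the vertical direction, where
   [dy X - q * dy Y] vanishes. Multiplying by this factor gives an identity valid for every [q]; [m]
   below is the slope that produces a given [q]. *)
assert (Hq : forall q, (dy X x y - q * dy Y x y) * (c0 + c1 * q + c2 * q ^ 2 - c3 * q ^ 3) = 0).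
{ intros q; set (D := dy X x y - q * dy Y x y).
  destruct (Req_dec D 0) as [->|HD]; [ring|].
  set (m := (q * dx Y x y - dx X x y) / D).
  assert (EY : fint Y x y 1 m = - jac X Y x y / D)
    by (unfold fint, m, jac; unfold D in *; field; exact HD).
  assert (EX : fint X x y 1 m = q * (- jac X Y x y / D))
    by (unfold fint, m, jac; unfold D in *; field; exact HD).
  assert (Hn : - jac X Y x y / D <> 0).
  { unfold Rdiv; apply Rmult_integral_contrapositive_currified;
      [apply Ropp_neq_0_compat, HJb|apply Rinv_neq_0_compat, HD]. }
  specialize (H m Hb); rewrite EX, EY in H; specialize (H Hn); cbv zeta in H.
  replace (q * (- jac X Y x y / D) / (- jac X Y x y / D)) with q in H by (field; split; auto).
  fold a b s c0 c1 c2 c3 in H; rewrite H; ring. }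
(* A polynomial of degree 4 in [q] with 5 roots. *)
pose proof (Hq 0) as P0; pose proof (Hq 1) as P1; pose proof (Hq (-1)) as P2;
pose proof (Hq 2) as P3; pose proof (Hq (-2)) as P4.
set (A := dy X x y) in *; set (B := dy Y x y) in *.
assert (K0 : A * c0 = 0) by lra.
assert (K1 : A * c1 - B * c0 = 0) by lra.
assert (K2 : A * c2 - B * c1 = 0) by lra.
assert (K3 : - A * c3 - B * c2 = 0) by lra.
assert (K4 : B * c3 = 0) by lra.
destruct (Req_dec A 0) as [HA|HA].
- assert (HB : B <> 0).
  { intros HB; apply HJb; unfold jac; fold A B; rewrite HA, HB; ring. }
  rewrite HA in *.
  assert (Z3 : c3 = 0) by (apply (Rmult_eq_reg_l B); auto; lra).
  assert (Z2 : c2 = 0) by (apply (Rmult_eq_reg_l B); auto; lra).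
  assert (Z1 : c1 = 0) by (apply (Rmult_eq_reg_l B); auto; lra).
  assert (Z0 : c0 = 0) by (apply (Rmult_eq_reg_l B); auto; lra).
  auto.
- assert (Z0 : c0 = 0) by (apply (Rmult_eq_reg_l A); auto; lra).
  assert (Z1 : c1 = 0) by (apply (Rmult_eq_reg_l A); auto; rewrite Z0 in K1; lra).
  assert (Z2 : c2 = 0) by (apply (Rmult_eq_reg_l A); auto; rewrite Z1 in K2; lra).
  assert (Z3 : c3 = 0) by (apply (Rmult_eq_reg_l A); auto; rewrite Z2 in K3; lra).
  auto.
Qed.

(** Repeated application of [DX], commuted past [DY], strips off the dependence on [X]: [b] does not
    depend on [X], then [a] is linear in [X], and two values of [DX (DY a)] leave [b] affine in
    [Y]. *)
Lemma symmetry_normal_form xi eta : point_symmetry E p xi eta ->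
  exists al be R2, 0 < R2 /\ R2 <= r1 /\ forall x y, in_box p R2 x y ->
    along xi eta X x y = - 2 * al * X x y /\
    along xi eta Y x y = al * Y x y + be /\
    (al * Y x y + be) * K x y + 4 * al * l x y = 0.
Proof.
intros Hsym; destruct (symmetry_coefficients xi eta Hsym) as (R2 & HR2 & HR2' & sxi & seta & H).
set (a := along xi eta X) in *; set (b := along xi eta Y) in *.
assert (HR : R2 <= r) by lra.
assert (sX2 := smooth_on_le p r R2 X HR sX); assert (sY2 := smooth_on_le p r R2 Y HR sY).
assert (sl2 := smooth_on_le p r R2 l HR sl).
assert (sK2 := smooth_on_le p r R2 K HR (nc_K _ _ _ _ _ _ _ nc)).
assert (sa : smooth_on p R2 a) by (apply smooth_along; auto).
assert (sb : smooth_on p R2 b) by (apply smooth_along; auto).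
pose (s := fun x y => / 2 * (X x y * X x y) + l x y).
assert (sXX : smooth_on p R2 (fun x y => X x y * X x y)) by smooth.
assert (ss : smooth_on p R2 s) by (unfold s; smooth).
assert (sX_ : forall f, smooth_on p R2 f -> smooth_on p R2 (DX f)) by (apply smooth_DX; auto).
assert (sY_ : forall f, smooth_on p R2 f -> smooth_on p R2 (DY f)) by (apply smooth_DY; auto).
assert (DXs : forall x y, in_box p R2 x y -> DX s x y = X x y).
{ intros x y Hb; unfold s.
  rewrite (DX_plus R2 HR (fun x y => / 2 * (X x y * X x y)) l), (DX_scal R2 HR), (DX_mult R2 HR X X),
      (DX_X R2 HR), (DX_l R2 HR) by (auto; smooth); field. }
assert (e0 : forall x y, in_box p R2 x y -> DY (DY a) x y
   + (- 1 * (s x y * DX a x y) + (2 * (s x y * DY b x y) + (K x y * b x y + X x y * a x y))) = 0)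
  by (intros x y Hb; destruct (H x y Hb) as (H0 & _); unfold s; lra).
assert (e1 : forall x y, in_box p R2 x y -> 2 * DX (DY a) x y
   + (- 1 * DY (DY b) x y + 3 * (s x y * DX b x y)) = 0)
  by (intros x y Hb; destruct (H x y Hb) as (_ & H0 & _); unfold s; lra).
assert (e2 : forall x y, in_box p R2 x y -> DX (DX a) x y = 2 * DX (DY b) x y)
  by (intros x y Hb; destruct (H x y Hb) as (_ & _ & H0 & _); lra).
assert (e3 : forall x y, in_box p R2 x y -> DX (DX b) x y = 0)
  by (intros x y Hb; destruct (H x y Hb) as (_ & _ & _ & H0); lra).
clear H.
assert (com : forall f x y, smooth_on p R2 f -> in_box p R2 x y -> DX (DY f) x y = DY (DX f) x y)
  by (apply DX_DY; auto).
assert (e2' : forall x y, in_box p R2 x y -> DX (DX a) x y = 2 * DY (DX b) x y)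
  by (intros; rewrite e2, com; auto).
(* Applying [DX] to [e1] gives [DY (DY (DX b)) + X DX b = 0]. *)
assert (e4 : forall x y, in_box p R2 x y -> DY (DY (DX b)) x y + X x y * DX b x y = 0).
{ intros x y Hb.
  pose proof (DX_eq R2 _ _ e1 x y Hb) as Hd; rewrite DX_const in Hd.
  rewrite (DX_plus R2 HR (fun x y => 2 * DX (DY a) x y)
    (fun x y => - 1 * DY (DY b) x y + 3 * (s x y * DX b x y))) in Hd by (auto; smooth; auto).
  rewrite (DX_plus R2 HR (fun x y => - 1 * DY (DY b) x y) (fun x y => 3 * (s x y * DX b x y))) in Hd
    by (auto; smooth; auto).
  rewrite !(DX_scal R2 HR) in Hd by (auto; smooth; auto).
  rewrite (DX_mult R2 HR s (DX b)), DXs, e3 in Hd by (auto; smooth; auto).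
  rewrite (com (DY b)) in Hd by auto.
  rewrite (DY_eq R2 _ _ (fun x y Hb => com b x y sb Hb) x y Hb) in Hd.
  assert (Ha : DX (DX (DY a)) x y = 2 * DY (DY (DX b)) x y).
  { rewrite (DX_eq R2 _ _ (fun x y Hb => com a x y sa Hb) x y Hb), com by auto.
    rewrite (DY_eq R2 _ _ e2' x y Hb), (DY_scal R2 HR) by auto; reflexivity. }
  rewrite Ha in Hd; lra. }
(* One more [DX] kills the first term of [e4], as [DX (DX b) = 0], and leaves [DX b] from the factor
   [X]. Here the quadratic term of the equation restricts the symmetries. *)
assert (e5 : forall x y, in_box p R2 x y -> DX b x y = 0).
{ intros x y Hb.
  pose proof (DX_eq R2 _ _ e4 x y Hb) as Hd; rewrite DX_const in Hd.
  rewrite (DX_plus R2 HR (DY (DY (DX b))) (fun x y => X x y * DX b x y)) in Hd by (auto; smooth; auto).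
  rewrite (DX_mult R2 HR X (DX b)), e3, (DX_X R2 HR) in Hd by auto.
  rewrite com in Hd by auto.
  rewrite (DY_eq R2 _ _ (fun x y Hb => com (DX b) x y (sX_ b sb) Hb) x y Hb) in Hd.
  assert (Hz : forall x y, in_box p R2 x y -> DY (DX (DX b)) x y = 0).
  { intros x' y' Hb'; rewrite (DY_eq R2 _ (fun _ _ => 0) e3 x' y' Hb'); apply DY_const. }
  rewrite (DY_eq R2 _ (fun _ _ => 0) Hz x y Hb), DY_const in Hd; lra. }
assert (e5' : forall x y, in_box p R2 x y -> DX (DY b) x y = 0).
{ intros x y Hb; rewrite com by auto; rewrite (DY_eq R2 _ (fun _ _ => 0) e5 x y Hb); apply DY_const. }
assert (e6 : forall x y, in_box p R2 x y -> DX (DY a) x y = / 2 * DY (DY b) x y).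
{ intros x y Hb; specialize (e1 x y Hb); rewrite e5 in e1 by auto; lra. }
assert (DXK : forall x y, in_box p R2 x y -> DX K x y = 0).
{ intros x y Hb; transitivity (DX (DY l) x y).
  - apply (DX_eq R2); auto; intros; symmetry; apply (DY_l R2 HR); auto.
  - rewrite com by auto; rewrite (DY_eq R2 _ (fun _ _ => 0) (DX_l R2 HR) x y Hb); apply DY_const. }
(* In the derivative of [e0] the terms [X * DX a] cancel, and the product [X * a] contributes [a]
   itself. *)
assert (e7 : forall x y, in_box p R2 x y ->
   a x y = - 2 * (X x y * DY b x y) + - / 2 * DY (DY (DY b)) x y).
{ intros x y Hb.
  pose proof (DX_eq R2 _ _ e0 x y Hb) as Hd; rewrite DX_const in Hd.
  rewrite (DX_plus R2 HR (DY (DY a)) (fun x y => - 1 * (s x y * DX a x y)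
    + (2 * (s x y * DY b x y) + (K x y * b x y + X x y * a x y)))) in Hd by (auto; smooth; auto).
  rewrite (DX_plus R2 HR (fun x y => - 1 * (s x y * DX a x y))
    (fun x y => 2 * (s x y * DY b x y) + (K x y * b x y + X x y * a x y))) in Hd by (auto; smooth; auto).
  rewrite (DX_plus R2 HR (fun x y => 2 * (s x y * DY b x y))
    (fun x y => K x y * b x y + X x y * a x y)) in Hd by (auto; smooth; auto).
  rewrite (DX_plus R2 HR (fun x y => K x y * b x y) (fun x y => X x y * a x y)) in Hd by (auto; smooth; auto).
  rewrite !(DX_scal R2 HR), (DX_mult R2 HR s (DX a)), (DX_mult R2 HR s (DY b)),
    (DX_mult R2 HR K b), (DX_mult R2 HR X a) in Hd by (auto; smooth; auto).
  rewrite DXs, DXK, e5, e5', e2, e5', (DX_X R2 HR) in Hd by auto.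
  assert (Ha : DX (DY (DY a)) x y = / 2 * DY (DY (DY b)) x y).
  { rewrite com by auto; rewrite (DY_eq R2 _ _ e6 x y Hb); apply (DY_scal R2 HR); auto. }
  rewrite Ha in Hd; lra. }
assert (e8 : forall x y, in_box p R2 x y -> DX a x y = - 2 * DY b x y).
{ intros x y Hb.
  rewrite (DX_eq R2 _ _ e7 x y Hb).
  rewrite (DX_plus R2 HR (fun x y => - 2 * (X x y * DY b x y)) (fun x y => - / 2 * DY (DY (DY b)) x y))
    by (auto; smooth; auto).
  rewrite !(DX_scal R2 HR), (DX_mult R2 HR X (DY b)), (DX_X R2 HR), e5' by (auto; smooth; auto).
  assert (Hz2 : forall x y, in_box p R2 x y -> DX (DY (DY b)) x y = 0).
  { intros x' y' Hb'; rewrite com by auto;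
      rewrite (DY_eq R2 _ (fun _ _ => 0) e5' x' y' Hb'); apply DY_const. }
  rewrite (com (DY (DY b))), (DY_eq R2 _ (fun _ _ => 0) Hz2 x y Hb), DY_const by auto; ring. }
(* [DX (DY a)] is half of [DY (DY b)] by [e6], and minus twice it by [e8]. *)
assert (e9 : forall x y, in_box p R2 x y -> DY (DY b) x y = 0).
{ intros x y Hb; pose proof (e6 x y Hb) as E6; rewrite com in E6 by auto.
  rewrite (DY_eq R2 _ _ e8 x y Hb), (DY_scal R2 HR) in E6 by auto; lra. }
pose (al := DY b (fst p) (snd p)).
assert (Hal : forall x y, in_box p R2 x y -> DY b x y = al).
{ apply (constant_of_DXY R2 HR (DY b) HR2); auto. }
assert (Ha : forall x y, in_box p R2 x y -> a x y = - 2 * al * X x y).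
{ intros x y Hb; rewrite e7, Hal by auto.
  rewrite (DY_eq R2 _ (fun _ _ => 0) e9 x y Hb), DY_const; ring. }
pose (be := b (fst p) (snd p) + - al * Y (fst p) (snd p)).
assert (Hbe : forall x y, in_box p R2 x y -> b x y + - al * Y x y = be).
{ apply (constant_of_DXY R2 HR (fun x y => b x y + - al * Y x y) HR2); [smooth|].
  intros x y Hb.
  rewrite (DX_plus R2 HR b (fun x y => - al * Y x y)), (DY_plus R2 HR b (fun x y => - al * Y x y)),
    (DX_scal R2 HR), (DY_scal R2 HR), (DX_Y R2 HR), (DY_Y R2 HR), e5, Hal by (auto; smooth).
  split; ring. }
exists al, be, R2; split; [exact HR2|split; [exact HR2'|]].
intros x y Hb; pose proof (Hbe x y Hb) as Hbe'.
assert (Eb : b x y = al * Y x y + be) by lra.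
split; [apply Ha, Hb|split; [exact Eb|]].
(* Now [e0] reads [4 al s + K b - 2 al X^2 = 0], and the quadratic terms cancel because
   [s = X^2 / 2 + l]. *)
pose proof (e0 x y Hb) as E0; rewrite Eb, Hal, Ha, e8, Hal in E0 by exact Hb.
assert (Hz : DY (DY a) x y = 0).
{ assert (Hz1 : forall x y, in_box p R2 x y -> DY a x y = 0).
  { intros x' y' Hb'; rewrite (DY_eq R2 _ _ Ha x' y' Hb'), (DY_scal R2 HR (- 2 * al) X),
      (DY_X R2 HR) by auto; ring. }
  rewrite (DY_eq R2 _ (fun _ _ => 0) Hz1 x y Hb); apply DY_const. }
rewrite Hz in E0; unfold s in E0; lra.
Qed.

(** * The flow of a field in normal form *)

Definition eprim (al t : R) : R :=
  if Req_dec_T al 0 then t else (exp (al * t) - 1) / al.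

Lemma eprim_0 al : eprim al 0 = 0.
Proof.
unfold eprim; destruct (Req_dec_T al 0); [reflexivity|].
rewrite Rmult_0_r, exp_0; unfold Rdiv; ring.
Qed.

Lemma eprim_mult al t : al * eprim al t = exp (al * t) - 1.
Proof.
unfold eprim; destruct (Req_dec_T al 0) as [->|Hn].
- rewrite !Rmult_0_l, exp_0; ring.
- field; exact Hn.
Qed.

Lemma eprim_derive al t : is_derive (eprim al) t (exp (al * t)).
Proof.
unfold eprim; destruct (Req_dec_T al 0) as [->|Hn].
- rewrite Rmult_0_l, exp_0; apply @is_derive_id.
- auto_derive; [trivial|field; exact Hn].
Qed.

Lemma exp_lin_derive k t : is_derive (fun t => exp (k * t)) t (k * exp (k * t)).
Proof. auto_derive; [trivial|ring]. Qed.

Section NormalSymmetry.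
Variables (xi eta : R -> R -> R) (al be R2 : R).
Hypotheses (HR2 : 0 < R2) (HR2r : R2 <= r1).
Hypothesis Hnf : forall x y, in_box p R2 x y ->
    along xi eta X x y = - 2 * al * X x y /\
    along xi eta Y x y = al * Y x y + be /\
    (al * Y x y + be) * K x y + 4 * al * l x y = 0.

(** The solution of [X' = - 2 al X], [Y' = al Y + be]. The function [eprim] is the primitive of
    [exp (al t)] vanishing at 0, so that one formula covers [al = 0]. *)
Definition flX (t x y : R) : R := exp (- 2 * al * t) * X x y.
Definition flY (t x y : R) : R := exp (al * t) * Y x y + be * eprim al t.

(** A single [eps] must bound times and starting points, as in [local_flow]. Images stay in the
    range of the inverse, and by the Lipschitz constant [C], closeness [R2 / (2 * C)] of both
    coordinates keeps their preimages in the box of the normal form. *)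
Lemma flow_range : exists eps, 0 < eps /\ eps <= R2 /\
  forall t x y, Rabs t < eps -> in_box p eps x y ->
    in_range (flX t x y) (flY t x y) /\
    in_box p R2 (PX (flX t x y) (flY t x y)) (PY (flX t x y) (flY t x y)).
Proof.
assert (Hp : in_box p r (fst p) (snd p)) by (apply in_box_center; lra).
set (Xp := X (fst p) (snd p)); set (Yp := Y (fst p) (snd p)).
set (k := Rmin rho (R2 / (2 * C))).
assert (Hk : 0 < k) by (apply Rmin_glb_lt; [lra|apply Rdiv_lt_0_compat; lra]).
set (k4 := Rmin 1 (k / 4)); assert (Hk4 : 0 < k4) by (apply Rmin_glb_lt; lra).
assert (Hk41 : k4 <= 1) by apply Rmin_l; assert (Hk42 : k4 <= k / 4) by apply Rmin_r.
set (W := Rabs Xp + Rabs Yp + Rabs be + 1).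
assert (HW : 1 <= W)
  by (pose proof (Rabs_pos Xp); pose proof (Rabs_pos Yp); pose proof (Rabs_pos be); unfold W; lra).
assert (Hq : 0 < k / (4 * W)) by (apply Rdiv_lt_0_compat; lra).
assert (HqW : k / (4 * W) * W = k / 4) by (field; lra).
destruct (continuous_abs_near (fun t => exp (- 2 * al * t)) 0 (k / (4 * W))) as (d1 & Hd1 & N1);
  [apply (ex_derive_continuous (fun t => exp (- 2 * al * t))); auto_derive; trivial|exact Hq|].
destruct (continuous_abs_near (fun t => exp (al * t)) 0 (k / (4 * W))) as (d2 & Hd2 & N2);
  [apply (ex_derive_continuous (fun t => exp (al * t))); auto_derive; trivial|exact Hq|].
destruct (continuous_abs_near (eprim al) 0 (k / (4 * W))) as (d3 & Hd3 & N3);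
  [apply (ex_derive_continuous (eprim al)); eexists; apply eprim_derive|exact Hq|].
rewrite Rmult_0_r, exp_0 in N1, N2; rewrite eprim_0 in N3.
destruct (proj1 (near_box p _) (near_and p _ _
  (smooth_cont p r X _ _ sX Hp (mkposreal k4 Hk4))
  (smooth_cont p r Y _ _ sY Hp (mkposreal k4 Hk4)))) as (d4 & Hd4 & N4); simpl in N4.
set (eps := Rmin (Rmin (Rmin d1 d2) (Rmin d3 d4)) R2).
exists eps; split; [repeat apply Rmin_glb_lt; auto|split; [apply Rmin_r|]].
assert (Hes : eps <= d1 /\ eps <= d2 /\ eps <= d3 /\ eps <= d4).
{ unfold eps; abs_lra. }
destruct Hes as (E1 & E2 & E3 & E4); intros t x y Ht Hb.
specialize (N1 t); specialize (N2 t); specialize (N3 t); rewrite Rminus_0_r in N1, N2, N3.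
specialize (N1 ltac:(lra)); specialize (N2 ltac:(lra)); specialize (N3 ltac:(lra)).
rewrite Rminus_0_r in N3.
destruct (N4 x y (in_box_le p eps d4 x y E4 Hb)) as (G1 & G2); fold Xp in G1; fold Yp in G2.
assert (Bd : forall w, Rabs w <= W -> forall z, Rabs z < k / (4 * W) -> Rabs (z * w) <= k / 4).
{ intros w Hw z Hz; rewrite Rabs_mult, <- HqW.
  apply Rmult_le_compat; try apply Rabs_pos; lra. }
pose proof (Rabs_pos Xp) as PX'; pose proof (Rabs_pos Yp) as PY'; pose proof (Rabs_pos be) as Pb.
assert (BX : Rabs (X x y) <= W).
{ replace (X x y) with ((X x y - Xp) + Xp) by ring; eapply Rle_trans; [apply Rabs_triang|unfold W; lra]. }
assert (BY : Rabs (Y x y) <= W).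
{ replace (Y x y) with ((Y x y - Yp) + Yp) by ring; eapply Rle_trans; [apply Rabs_triang|unfold W; lra]. }
assert (Bbe : Rabs be <= W) by (unfold W; lra).
assert (F1 : Rabs (flX t x y - Xp) < k).
{ unfold flX; replace (exp (- 2 * al * t) * X x y - Xp) with
    ((exp (- 2 * al * t) - 1) * X x y + (X x y - Xp)) by ring.
  eapply Rle_lt_trans; [apply Rabs_triang|]; pose proof (Bd _ BX _ N1); lra. }
assert (F2 : Rabs (flY t x y - Yp) < k).
{ unfold flY; replace (exp (al * t) * Y x y + be * eprim al t - Yp) with
    ((exp (al * t) - 1) * Y x y + eprim al t * be + (Y x y - Yp)) by ring.
  eapply Rle_lt_trans; [apply Rabs_triang|].
  pose proof (Rabs_triang ((exp (al * t) - 1) * Y x y) (eprim al t * be)).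
  pose proof (Bd _ BY _ N2); pose proof (Bd _ Bbe _ N3); lra. }
assert (Hkr : k <= rho) by apply Rmin_l; assert (HkR : k <= R2 / (2 * C)) by apply Rmin_r.
assert (Hr : in_range (flX t x y) (flY t x y)) by (split; fold Xp Yp; lra).
split; [exact Hr|]; apply dist1_in_box.
destruct (Hinv _ _ (proj1 Hr) (proj2 Hr)) as (Hb1 & EX & EY).
eapply Rle_lt_trans; [apply Hlip; [apply in_box_center, Hr1|exact Hb1]|].
rewrite EX, EY, dist1_sym; fold Xp Yp; unfold dist1.
apply Rlt_le_trans with (C * (2 * (R2 / (2 * C)))); [apply Rmult_lt_compat_l; lra|right; field; lra].
Qed.

(** The explicit flow, read through the inverse coordinates, has the given field as velocity by
    [fint_pull]. It permutes solutions because both sides of the normal equation scale by the same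
    factor. *)
Lemma normal_form_symmetry : smooth_near p xi -> smooth_near p eta -> point_symmetry E p xi eta.
Proof.
intros sxi seta; split; [exact sxi|split; [exact seta|]].
destruct flow_range as (eps & Heps & HepsR & Hfl).
pose (u := fun t x y => PX (flX t x y) (flY t x y)).
pose (v := fun t x y => PY (flX t x y) (flY t x y)).
assert (HR2b : forall x y, in_box p R2 x y -> in_box p r x y)
  by (intros; apply (in_box_le p R2); auto; lra).
assert (Heb : forall x y, in_box p eps x y -> in_box p R2 x y)
  by (intros; apply (in_box_le p eps); auto).
assert (Er0 : Rabs 0 < eps) by (rewrite Rabs_R0; exact Heps).
assert (Hz : forall x y, flX 0 x y = X x y /\ flY 0 x y = Y x y).
{ intros x y; unfold flX, flY; rewrite eprim_0, !Rmult_0_r, exp_0; split; ring. }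
assert (Hinvxy : forall t x y, Rabs t < eps -> in_box p eps x y ->
  X (u t x y) (v t x y) = flX t x y /\ Y (u t x y) (v t x y) = flY t x y /\
  in_box p R2 (u t x y) (v t x y)).
{ intros t x y Ht Hb; destruct (Hfl t x y Ht Hb) as (H1 & H2).
  destruct (Hinv _ _ (proj1 H1) (proj2 H1)) as (_ & H3 & H4); auto. }
assert (H0 : forall x y, in_box p eps x y -> u 0 x y = x /\ v 0 x y = y).
{ intros x y Hb; destruct (Hfl 0 x y Er0 Hb) as (H1 & _); destruct (Hz x y) as (E1 & E2).
  unfold u, v; rewrite E1, E2 in *; apply inverse_normal; [|exact H1].
  apply (in_box_le p R2); auto. }
assert (Hder : forall x y, in_box p eps x y -> forall t, Rabs t < eps ->
  is_derive (fun s => u s x y) t (xi (u t x y) (v t x y)) /\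
  is_derive (fun s => v s x y) t (eta (u t x y) (v t x y))).
{ intros x y Hb t Ht; destruct (Hfl t x y Ht Hb) as (H1 & H2).
  destruct (Hinvxy t x y Ht Hb) as (EX & EY & _).
  destruct (Hnf _ _ H2) as (F1 & F2 & _); fold (u t x y) (v t x y) in F1, F2.
  destruct (inverse_derive (fun t => flX t x y) (fun t => flY t x y) t
    (- 2 * al * flX t x y) (al * flY t x y + be)) as (D1 & D2).
  - unfold flX; replace (- 2 * al * (exp (- 2 * al * t) * X x y)) with
      (X x y * (- 2 * al * exp (- 2 * al * t))) by ring.
    apply (is_derive_ext (fun t => X x y * exp (- 2 * al * t))); [intros; apply Rmult_comm|].
    apply is_derive_scal, exp_lin_derive.
  - unfold flY; replace (al * (exp (al * t) * Y x y + be * eprim al t) + be) with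
      (Y x y * (al * exp (al * t)) + be * exp (al * t)).
    + apply (is_derive_plus (fun t => exp (al * t) * Y x y) (fun t => be * eprim al t)).
      * apply (is_derive_ext (fun t => Y x y * exp (al * t))); [intros; apply Rmult_comm|].
        apply is_derive_scal, exp_lin_derive.
      * apply is_derive_scal, eprim_derive.
    + pose proof (eprim_mult al t) as Hm; apply (f_equal (Rmult be)) in Hm; lra.
  - exact H1.
  - change (is_derive (fun s => u s x y) t (pull1 (u t x y) (v t x y) (- 2 * al * flX t x y) (al * flY t x y + be))) in D1.
    change (is_derive (fun s => v s x y) t (pull2 (u t x y) (v t x y) (- 2 * al * flX t x y) (al * flY t x y + be))) in D2.
    rewrite <- EX, <- EY, <- F1, <- F2 in D1, D2.
    destruct (fint_pull (u t x y) (v t x y) (xi (u t x y) (v t x y)) (eta (u t x y) (v t x y)))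
      as (P1 & P2); [apply HR2b, H2|].
    unfold along in D1, D2; rewrite P1 in D1; rewrite P2 in D2; split; assumption. }
(* The condition on [al] and [be] says that [exp (4 * al * s) * l] has zero derivative along a
   trajectory. *)
assert (Hl : forall x y, in_box p eps x y -> forall t, Rabs t < eps ->
  l (u t x y) (v t x y) = exp (- 4 * al * t) * l x y).
{ intros x y Hb t Ht.
  pose proof (mvt_bound (fun s => exp (4 * al * s) * l (u s x y) (v s x y)) (fun _ => 0) 0 0 t) as Hm.
  cbv beta in Hm; destruct (H0 x y Hb) as (E1 & E2); rewrite E1, E2, Rmult_0_r, exp_0, Rmult_1_l in Hm.
  assert (Hc : exp (4 * al * t) * l (u t x y) (v t x y) - l x y = 0).
  { apply Rabs_eq_0, Rle_antisym; [|apply Rabs_pos].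
    rewrite Rmult_0_l in Hm; apply Hm; [|intros; rewrite Rabs_R0; lra].
    intros s Hs.
    assert (Hs' : Rabs s < eps).
    { replace s with (s - 0) by ring; apply (abs_between 0 t); rewrite ?Rminus_0_r; auto. }
    destruct (Hder x y Hb s Hs') as (D1 & D2); destruct (Hinvxy s x y Hs' Hb) as (_ & _ & Hbs).
    pose proof (smooth_chain p r l (fun s => u s x y) (fun s => v s x y) s _ _ sl (HR2b _ _ Hbs) D1 D2) as D.
    cbv beta in D.
    rewrite (nc_dxl _ _ _ _ _ _ _ nc _ _ (HR2b _ _ Hbs)), (nc_dyl _ _ _ _ _ _ _ nc _ _ (HR2b _ _ Hbs)) in D.
    destruct (Hnf _ _ Hbs) as (_ & F2 & F3); unfold along, fint in F2.
    replace 0 with (4 * al * exp (4 * al * s) * l (u s x y) (v s x y) + exp (4 * al * s) *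
      (K (u s x y) (v s x y) * dx Y (u s x y) (v s x y) * xi (u s x y) (v s x y) +
       K (u s x y) (v s x y) * dy Y (u s x y) (v s x y) * eta (u s x y) (v s x y))).
    - apply (is_derive_mult (fun s => exp (4 * al * s)) (fun s => l (u s x y) (v s x y)));
        [apply exp_lin_derive|exact D|exact Rmult_comm].
    - rewrite <- F2 in F3; apply (f_equal (Rmult (exp (4 * al * s)))) in F3; lra. }
  replace (- 4 * al * t) with (- (4 * al * t)) by ring; rewrite exp_Ropp.
  apply (Rmult_eq_reg_l (exp (4 * al * t))); [|apply Rgt_not_eq, exp_pos].
  rewrite <- Rmult_assoc, Rinv_r by (apply Rgt_not_eq, exp_pos); lra. }
exists eps, u, v; split; [exact Heps|split].
{ intros x y Hb; destruct (H0 x y Hb) as (E1 & E2); split; [exact E1|split; [exact E2|]].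
  apply Hder, Hb. }
intros a b f Hf Hbox x1 Hx1.
pose (f2 := fun x => coefP E x (f x) + 3 * coefQ E x (f x) * Derive f x
       + 3 * coefR E x (f x) * Derive f x ^ 2 + coefS E x (f x) * Derive f x ^ 3).
assert (df : forall z, a < z < b -> is_derive f z (Derive f z))
  by (intros z Hzz; apply Derive_correct, Hf, Hzz).
assert (df2 : forall z, a < z < b -> is_derive (Derive f) z (f2 z)) by (intros z Hzz; apply Hf, Hzz).
assert (Hbr : forall z, a < z < b -> in_box p r z (f z)) by (intros z Hzz; apply HR2b, Heb, Hbox, Hzz).
assert (d1 : forall g, smooth_on p r g -> forall z, a < z < b ->
  is_derive (fun x => g x (f x)) z (fint g z (f z) 1 (Derive f z))).
{ intros g sg z Hzz; unfold fint.
  apply (smooth_chain p r g (fun x => x) f); auto; apply @is_derive_id. }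
assert (d2 : forall g, smooth_on p r g -> forall z, a < z < b ->
  is_derive (fun x => fint g x (f x) 1 (Derive f x)) z
   (fint g z (f z) 0 (f2 z) + hess g z (f z) 1 (Derive f z))).
{ intros g sg z Hzz.
  apply (fint_derive g (fun x => x) f (fun _ => 1) (Derive f)); auto;
    [apply @is_derive_id|apply @is_derive_const]. }
pose (X1 := fun z => fint X z (f z) 1 (Derive f z)); pose (Y1 := fun z => fint Y z (f z) 1 (Derive f z)).
pose (X2 := fun z => fint X z (f z) 0 (f2 z) + hess X z (f z) 1 (Derive f z)).
pose (Y2 := fun z => fint Y z (f z) 0 (f2 z) + hess Y z (f z) 1 (Derive f z)).
assert (HE : forall z, a < z < b ->
  X1 z * Y2 z - Y1 z * X2 z = (X z (f z) ^ 2 / 2 + l z (f z)) * Y1 z ^ 3).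
{ intros z Hzz; pose proof (equation_transfer z (f z) 1 (Derive f z) 0 (f2 z) (Hbr z Hzz)) as T.
  replace (1 * f2 z - Derive f z * 0 - cubic z (f z) 1 (Derive f z)) with 0 in T
    by (unfold f2, cubic; ring).
  rewrite Rmult_0_r in T; unfold X1, Y1, X2, Y2; lra. }
(* The abscissa of the image curve has derivative 1 at time 0, hence stays
   increasing for small times. *)
pose (U1 := fun t z => pull1 (u t z (f z)) (v t z (f z)) (exp (- 2 * al * t) * X1 z) (exp (al * t) * Y1 z)).
assert (HU0 : U1 0 x1 = 1).
{ unfold U1; destruct (H0 x1 (f x1) (Hbox x1 Hx1)) as (E1 & E2); rewrite E1, E2, !Rmult_0_r, exp_0, !Rmult_1_l.
  apply (fint_pull x1 (f x1) 1 (Derive f x1)), Hbr, Hx1. }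
assert (HUc : continuous (fun w : R * R => U1 (fst w) (snd w)) (0, x1)).
{ assert (cexp : forall k, continuous (fun w : R * R => exp (k * fst w)) (0, x1)).
  { intros k; apply (continuous_comp (fun w : R * R => fst w) (fun t => exp (k * t)));
      [apply continuous_fst|].
    apply (ex_derive_continuous (fun t => exp (k * t))); auto_derive; trivial. }
  assert (cz : forall g : R -> R, ex_derive g x1 -> continuous (fun w : R * R => g (snd w)) (0, x1)).
  { intros g Hg; apply (continuous_comp (fun w : R * R => snd w) g); [apply continuous_snd|].
    apply (ex_derive_continuous g), Hg. }
  assert (cA : continuous (fun w : R * R => flX (fst w) (snd w) (f (snd w))) (0, x1)).
  { apply (continuous_mult (fun w : R * R => exp (- 2 * al * fst w)) (fun w : R * R => X (snd w) (f (snd w))));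
      [apply cexp|apply (cz (fun z => X z (f z))); eexists; apply d1; auto]. }
  assert (cB : continuous (fun w : R * R => flY (fst w) (snd w) (f (snd w))) (0, x1)).
  { apply (continuous_plus (fun w : R * R => exp (al * fst w) * Y (snd w) (f (snd w)))
      (fun w : R * R => be * eprim al (fst w))).
    - apply (continuous_mult (fun w : R * R => exp (al * fst w)) (fun w : R * R => Y (snd w) (f (snd w))));
        [apply cexp|apply (cz (fun z => Y z (f z))); eexists; apply d1; auto].
    - apply (continuous_mult (fun _ : R * R => be) (fun w : R * R => eprim al (fst w)));
        [apply continuous_const|].
      apply (continuous_comp (fun w : R * R => fst w) (eprim al)); [apply continuous_fst|].
      apply (ex_derive_continuous (eprim al)); eexists; apply eprim_derive. }
  destruct (Hfl 0 x1 (f x1) Er0 (Hbox x1 Hx1)) as (Hr0 & Hb0).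
  destruct (inverse_continuous _ _ (0, x1) cA cB Hr0) as (cu & cv).
  assert (cg : forall g, smooth_on p r g ->
    continuous (fun w : R * R => g (u (fst w) (snd w) (f (snd w))) (v (fst w) (snd w) (f (snd w)))) (0, x1)).
  { intros g sg; apply (smooth_curve_continuous g (fun w : R * R => u (fst w) (snd w) (f (snd w)))
      (fun w : R * R => v (fst w) (snd w) (f (snd w))) (0, x1) sg); auto. }
  assert (sJ : smooth_on p r (fun x y => / jac X Y x y))
    by (apply smooth_inv; [exact HJ|unfold jac; smooth]).
  unfold U1, pull1, Rdiv.
  apply (continuous_mult (fun w : R * R =>
     dy Y (u (fst w) (snd w) (f (snd w))) (v (fst w) (snd w) (f (snd w))) * (exp (- 2 * al * fst w) * X1 (snd w))
     - dy X (u (fst w) (snd w) (f (snd w))) (v (fst w) (snd w) (f (snd w))) * (exp (al * fst w) * Y1 (snd w)))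
    (fun w : R * R => / jac X Y (u (fst w) (snd w) (f (snd w))) (v (fst w) (snd w) (f (snd w)))));
    [|apply (cg (fun x y => / jac X Y x y) sJ)].
  apply (continuous_minus (fun w : R * R =>
     dy Y (u (fst w) (snd w) (f (snd w))) (v (fst w) (snd w) (f (snd w))) * (exp (- 2 * al * fst w) * X1 (snd w)))
     (fun w : R * R =>
     dy X (u (fst w) (snd w) (f (snd w))) (v (fst w) (snd w) (f (snd w))) * (exp (al * fst w) * Y1 (snd w)))).
  - apply (continuous_mult (fun w : R * R => dy Y (u (fst w) (snd w) (f (snd w))) (v (fst w) (snd w) (f (snd w))))
      (fun w : R * R => exp (- 2 * al * fst w) * X1 (snd w))); [apply (cg (dy Y)), smooth_dy, sY|].
    apply (continuous_mult (fun w : R * R => exp (- 2 * al * fst w)) (fun w : R * R => X1 (snd w)));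
      [apply cexp|apply cz; eexists; apply (d2 X sX), Hx1].
  - apply (continuous_mult (fun w : R * R => dy X (u (fst w) (snd w) (f (snd w))) (v (fst w) (snd w) (f (snd w))))
      (fun w : R * R => exp (al * fst w) * Y1 (snd w))); [apply (cg (dy X)), smooth_dy, sX|].
    apply (continuous_mult (fun w : R * R => exp (al * fst w)) (fun w : R * R => Y1 (snd w)));
      [apply cexp|apply cz; eexists; apply (d2 Y sY), Hx1]. }
destruct (continuous_abs_locally _ _ 1 HUc Rlt_0_1) as (d0 & Hd0).
set (de := Rmin (Rmin (d0 / 2) eps) (Rmin ((x1 - a) / 2) ((b - x1) / 2))).
assert (Hde : 0 < de) by (pose proof (cond_pos d0); repeat apply Rmin_glb_lt; lra).
assert (Hdes : de <= d0 / 2 /\ de <= eps /\ de <= (x1 - a) / 2 /\ de <= (b - x1) / 2).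
{ unfold de; abs_lra. }
destruct Hdes as (G1 & G2 & G3 & G4); clearbody de; pose proof (cond_pos d0).
exists de; split; [lra|split; [lra|split; [lra|]]].
intros t Ht; assert (Hte : Rabs t < eps) by lra.
destruct (pullback_curve (fun z => flX t z (f z)) (fun z => flY t z (f z))
  (fun z => exp (- 2 * al * t) * X1 z) (fun z => exp (al * t) * Y1 z)
  (fun z => exp (- 2 * al * t) * X2 z) (fun z => exp (al * t) * Y2 z) a b)
  as (cu & cv & u1 & v1 & u2 & v2 & Hdef & Huv).
{ intros z Hzz; split; [apply Hfl; auto|].
  refine (conj _ (conj _ (conj _ _))).
  - apply is_derive_scal, d1; auto.
  - rewrite <- Rplus_0_r.
    apply (is_derive_plus (fun z => exp (al * t) * Y z (f z)) (fun _ => be * eprim al t));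
      [apply is_derive_scal, d1; auto|apply @is_derive_const].
  - apply is_derive_scal, d2; auto.
  - apply is_derive_scal, d2; auto. }
assert (Hcu : forall z, cu z = u t z (f z) /\ cv z = v t z (f z) /\ u1 z = U1 t z).
{ intros z; destruct (Hdef z) as (E1 & E2 & E3 & _).
  assert (Eu : cu z = u t z (f z)) by exact E1; assert (Ev : cv z = v t z (f z)) by exact E2.
  rewrite Eu, Ev in E3; auto. }
destruct (curve_to_solution cu cv u1 v1 u2 v2 (x1 - de) (x1 + de)) as (c & d & g & Hcd & Hg & Himg & Hgv).
- lra.
- intros z Hzz; destruct (Huv z ltac:(lra)) as (_ & D1 & D2 & D3 & D4 & _).
  refine (conj D1 (conj D2 (conj D3 (conj D4 _)))).
  rewrite (proj2 (proj2 (Hcu z))).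
  assert (Hball : Rabs (U1 t z - 1) < 1).
  { replace (U1 t z - 1) with (U1 t z - U1 0 x1) by (rewrite HU0; reflexivity).
    apply (Hd0 (t, z)); split.
    - change (Rabs (t - 0) < d0); rewrite Rminus_0_r; lra.
    - change (Rabs (z - x1) < d0); apply Rabs_def1; lra. }
  apply Rabs_def2 in Hball; lra.
- intros z Hzz; assert (Hzab : a < z < b) by lra.
  destruct (Huv z Hzab) as (Hbz & _ & _ & _ & _ & Hj).
  assert (Hlz : l (cu z) (cv z) = exp (- 4 * al * t) * l z (f z)).
  { destruct (Hcu z) as (Eu & Ev & _); rewrite Eu, Ev; apply Hl; auto. }
  rewrite Hlz in Hj.
  apply Rminus_diag_uniq, (Rmult_eq_reg_l (jac X Y (cu z) (cv z)));
    [|apply HJ, box_r1_r, Hbz].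
  rewrite <- Hj, Rmult_0_r; unfold flX.
  (* With [w = exp (al * t)], the expression [X' Y'' - Y' X''] scales by [w^(-2) w] and
     [(X^2 / 2 + l) Y'^3] by [w^(-4) w^3]: both factors are [/ w]. *)
  assert (W1 : exp (- 2 * al * t) = exp (al * t) * / exp (al * t) ^ 3).
  { replace (- 2 * al * t) with (al * t + - (3 * (al * t))) by ring.
    rewrite exp_plus, exp_Ropp; f_equal; f_equal.
    replace (3 * (al * t)) with (al * t + (al * t + al * t)) by ring; rewrite !exp_plus; ring. }
  assert (W4 : exp (- 4 * al * t) = exp (- 2 * al * t) ^ 2).
  { replace (- 4 * al * t) with (- 2 * al * t + - 2 * al * t) by ring; rewrite exp_plus; ring. }
  rewrite W4, W1; pose proof (HE z Hzab) as HEz; pose proof (exp_pos (al * t)) as Hep.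
  set (w := exp (al * t)) in *.
  transitivity (/ w * (X1 z * Y2 z - Y1 z * X2 z
    - (X z (f z) ^ 2 / 2 + l z (f z)) * Y1 z ^ 3)); [field; lra|].
  rewrite HEz; ring.
- exists c, d, g; split; [exact Hcd|split; [exact Hg|]].
  intros x y; split.
  + intros (Hx & ->); apply Himg in Hx; destruct Hx as (z & Hzz & ->).
    destruct (Hgv z Hzz) as (Eg & _); destruct (Hcu z) as (Eu & Ev & _).
    exists z; rewrite Eg, <- Eu, <- Ev; split; [apply Rabs_def1; lra|auto].
  + intros (z & Hzz & -> & ->); apply Rabs_def2 in Hzz.
    assert (Hzz' : x1 - de < z < x1 + de) by lra.
    destruct (Hgv z Hzz') as (Eg & _); destruct (Hcu z) as (Eu & Ev & _).
    rewrite <- Eu, <- Ev; split; [apply Himg; exists z; auto|symmetry; exact Eg].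
Qed.
End NormalSymmetry.

(** * Admissible pairs and the dimension of the algebra *)

Definition nfx (al be x y : R) : R := pull1 x y (- 2 * al * X x y) (al * Y x y + be).
Definition nfy (al be x y : R) : R := pull2 x y (- 2 * al * X x y) (al * Y x y + be).

Definition admissible (al be : R) : Prop :=
  near p (fun x y => (al * Y x y + be) * K x y + 4 * al * l x y = 0).

Lemma near_in_box : near p (in_box p r).
Proof. apply near_box; exists r; split; [lra|auto]. Qed.

(** Together with [nf_injective] this identifies germs of symmetries with admissible pairs, so that
    the dimension becomes a question in the plane of [(al, be)]. *)
Lemma point_symmetry_iff xi eta : point_symmetry E p xi eta <->
  exists al be, admissible al be /\
    near p (fun x y => xi x y = nfx al be x y /\ eta x y = nfy al be x y).
Proof.
split.
- intros Hs; destruct (symmetry_normal_form xi eta Hs) as (al & be & R2 & HR2 & HR2' & H).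
  exists al, be; split; apply near_box; exists R2; (split; [exact HR2|]);
    intros x y Hb; destruct (H x y Hb) as (H1 & H2 & H3); [exact H3|].
  assert (Hbr : in_box p r x y) by (apply (in_box_le p R2); auto; lra).
  destruct (fint_pull x y (xi x y) (eta x y) Hbr) as (P1 & P2).
  unfold along in H1, H2; rewrite H1, H2 in P1, P2.
  split; symmetry; assumption.
- intros (al & be & Ha & Hxi).
  destruct (proj1 (near_box p _) (near_and _ _ _ Ha Hxi)) as (R3 & HR3 & H).
  set (R2 := Rmin R3 r1).
  assert (HR2 : 0 < R2) by (apply Rmin_glb_lt; lra).
  assert (HR2' : R2 <= r1) by apply Rmin_r.
  assert (Hb2 : forall x y, in_box p R2 x y -> in_box p R3 x y)
    by (intros; apply (in_box_le p R2); auto; apply Rmin_l).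
  assert (Hbr : forall x y, in_box p R2 x y -> in_box p r x y)
    by (intros; apply (in_box_le p R2); auto; lra).
  assert (sX2 := smooth_on_le p r R2 X ltac:(lra) sX).
  assert (sY2 := smooth_on_le p r R2 Y ltac:(lra) sY).
  assert (HJ2 : forall x y, in_box p R2 x y -> jac X Y x y <> 0) by (intros; apply HJ; auto).
  assert (sJ2 : smooth_on p R2 (jac X Y)) by (unfold jac; smooth).
  apply (normal_form_symmetry xi eta al be R2 HR2 HR2').
  + intros x y Hb; destruct (H x y (Hb2 x y Hb)) as (H1 & H2 & H3).
    destruct (pull_fint x y (- 2 * al * X x y) (al * Y x y + be) (Hbr x y Hb)) as (P1 & P2).
    unfold along; rewrite H2, H3; auto.
  + apply smooth_near_on; exists R2; split; [exact HR2|].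
    apply (smooth_ext p R2 (nfx al be)).
    * intros x y Hb; symmetry; apply (H x y (Hb2 x y Hb)).
    * unfold nfx, pull1; smooth; exact HJ2.
  + apply smooth_near_on; exists R2; split; [exact HR2|].
    apply (smooth_ext p R2 (nfy al be)).
    * intros x y Hb; symmetry; apply (H x y (Hb2 x y Hb)).
    * unfold nfy, pull2; smooth; exact HJ2.
Qed.

Lemma nf_scal c al be x y :
  nfx (c * al) (c * be) x y = c * nfx al be x y /\ nfy (c * al) (c * be) x y = c * nfy al be x y.
Proof. unfold nfx, nfy, pull1, pull2, Rdiv; split; ring. Qed.

(** The [Y] component determines [al Y + be], and [dY] is nonzero at [p] because the Jacobian is. *)
Lemma nf_injective al be al' be' :
  near p (fun x y => nfx al be x y = nfx al' be' x y /\ nfy al be x y = nfy al' be' x y) ->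
  al = al' /\ be = be'.
Proof.
intros H; destruct (proj1 (near_box p _) (near_and _ _ _ near_in_box H)) as (R2 & HR2 & H').
assert (E1 : forall x y, in_box p R2 x y -> (al - al') * Y x y + (be - be') = 0).
{ intros x y Hb; destruct (H' x y Hb) as (Hbr & H1 & H2); unfold nfx in H1; unfold nfy in H2.
  destruct (pull_fint x y (- 2 * al * X x y) (al * Y x y + be) Hbr) as (_ & P1).
  destruct (pull_fint x y (- 2 * al' * X x y) (al' * Y x y + be') Hbr) as (_ & P2).
  rewrite H1, H2, P2 in P1; lra. }
assert (Hr : in_box p R2 (fst p) (snd p)) by (apply in_box_center, HR2).
assert (Hbr : in_box p r (fst p) (snd p)) by (apply in_box_center; lra).
assert (D1 : (al - al') * dx Y (fst p) (snd p) = 0).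
{ transitivity (dx (fun x y => (al - al') * Y x y + (be - be')) (fst p) (snd p)).
  - expand_partials; ring.
  - rewrite (dx_eq p R2 _ (fun _ _ => 0) E1 _ _ Hr); apply (Derive_const 0). }
assert (D2 : (al - al') * dy Y (fst p) (snd p) = 0).
{ transitivity (dy (fun x y => (al - al') * Y x y + (be - be')) (fst p) (snd p)).
  - expand_partials; ring.
  - rewrite (dy_eq p R2 _ (fun _ _ => 0) E1 _ _ Hr); apply (Derive_const 0). }
assert (Hal : al = al').
{ apply Rminus_diag_uniq, (Rmult_eq_reg_r (jac X Y (fst p) (snd p))); [|apply HJ, Hbr].
  unfold jac; rewrite Rmult_0_l.
  replace ((al - al') * (dx X (fst p) (snd p) * dy Y (fst p) (snd p)
     - dy X (fst p) (snd p) * dx Y (fst p) (snd p))) with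
    (dx X (fst p) (snd p) * ((al - al') * dy Y (fst p) (snd p))
     - dy X (fst p) (snd p) * ((al - al') * dx Y (fst p) (snd p))) by ring.
  rewrite D1, D2; ring. }
split; [exact Hal|]; specialize (E1 _ _ Hr); rewrite Hal in E1; lra.
Qed.

Lemma one_dimensional_iff : symmetry_algebra_one_dimensional E p <->
  exists al0 be0, (al0 <> 0 \/ be0 <> 0) /\
    forall al be, admissible al be <-> exists c, al = c * al0 /\ be = c * be0.
Proof.
split.
- intros (xi & eta & Hnz & H).
  assert (Hs : point_symmetry E p xi eta).
  { apply H; exists 1; apply near_box; exists 1; split; [lra|intros; split; ring]. }
  apply point_symmetry_iff in Hs; destruct Hs as (al0 & be0 & Ha0 & Hxi).
  exists al0, be0; split.
  + destruct (Req_dec al0 0) as [Ha|Ha]; auto; destruct (Req_dec be0 0) as [Hb|Hb]; auto.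
    exfalso; apply Hnz; revert Hxi; apply near_imp; intros x y (E1 & E2).
    rewrite E1, E2, Ha, Hb; unfold nfx, nfy, pull1, pull2, Rdiv; split; ring.
  + intros al be; split.
    * intros Ha.
      assert (Hs : point_symmetry E p (nfx al be) (nfy al be)).
      { apply point_symmetry_iff; exists al, be; split; [exact Ha|].
        revert Ha; apply near_imp; auto. }
      apply H in Hs; destruct Hs as (c & Hc); exists c.
      apply (nf_injective al be (c * al0) (c * be0)).
      generalize (near_and _ _ _ Hc Hxi); apply near_imp; intros x y ((G1 & G2) & (G3 & G4)).
      destruct (nf_scal c al0 be0 x y) as (S1 & S2); rewrite G1, G2, G3, G4, S1, S2; auto.
    * intros (c & -> & ->); revert Ha0; apply near_imp; intros x y E0.
      transitivity (c * ((al0 * Y x y + be0) * K x y + 4 * al0 * l x y)); [ring|rewrite E0; ring].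
- intros (al0 & be0 & Hnz & H).
  exists (nfx al0 be0), (nfy al0 be0); split.
  + intros Hz; destruct (nf_injective al0 be0 0 0) as (E1 & E2); [|lra].
    revert Hz; apply near_imp; intros x y (-> & ->).
    unfold nfx, nfy, pull1, pull2, Rdiv; split; ring.
  + intros xi eta; rewrite point_symmetry_iff; split.
    * intros (al & be & Ha & Hxi); apply H in Ha; destruct Ha as (c & -> & ->); exists c.
      revert Hxi; apply near_imp; intros x y (-> & ->); apply nf_scal.
    * intros (c & Hc); exists (c * al0), (c * be0); split; [apply H; exists c; auto|].
      revert Hc; apply near_imp; intros x y (-> & ->).
      destruct (nf_scal c al0 be0 x y) as (-> & ->); auto.
Qed.

(* For [al <> 0] the condition says that [(Y + be / al)^4 l] is constant. *)
Lemma admissible_integral al be R2 : 0 < R2 -> R2 <= r ->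
  (forall x y, in_box p R2 x y -> (al * Y x y + be) * K x y + 4 * al * l x y = 0) ->
  forall x y, in_box p R2 x y ->
    (al * Y x y + be) ^ 4 * l x y = (al * Y (fst p) (snd p) + be) ^ 4 * l (fst p) (snd p).
Proof.
intros HR2 HR H.
assert (sX2 := smooth_on_le p r R2 X HR sX); assert (sY2 := smooth_on_le p r R2 Y HR sY).
assert (sl2 := smooth_on_le p r R2 l HR sl).
pose (w := fun x y => al * Y x y + be).
assert (sw : smooth_on p R2 w) by (unfold w; smooth).
apply (constant_of_DXY R2 HR (fun x y => (al * Y x y + be) ^ 4 * l x y) HR2);
  [apply (smooth_mult p R2 (fun x y => w x y ^ 4) l); smooth|].
intros x y Hb; pose proof (HJ _ _ (in_box_le p R2 r x y HR Hb)) as HJb.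
assert (Hb' := in_box_le p R2 r x y HR Hb).
assert (D1 : dx (fun x y => (al * Y x y + be) ^ 4 * l x y) x y =
   4 * (al * Y x y + be) ^ 3 * al * dx Y x y * l x y + (al * Y x y + be) ^ 4 * (K x y * dx Y x y)).
{ rewrite <- (nc_dxl _ _ _ _ _ _ _ nc x y Hb'); expand_partials; ring. }
assert (D2 : dy (fun x y => (al * Y x y + be) ^ 4 * l x y) x y =
   4 * (al * Y x y + be) ^ 3 * al * dy Y x y * l x y + (al * Y x y + be) ^ 4 * (K x y * dy Y x y)).
{ rewrite <- (nc_dyl _ _ _ _ _ _ _ nc x y Hb'); expand_partials; ring. }
specialize (H x y Hb); unfold DX, DY; rewrite D1, D2; split.
- field; exact HJb.
- transitivity ((al * Y x y + be) ^ 3 * ((al * Y x y + be) * K x y + 4 * al * l x y));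
    [unfold jac in *; field; exact HJb|rewrite H; ring].
Qed.

Lemma DX_K R2 x y : R2 <= r -> in_box p R2 x y -> DX K x y = 0.
Proof.
intros HR Hb; transitivity (DX (DY l) x y).
- apply (DX_eq R2); auto; intros; symmetry; apply (DY_l R2 HR); auto.
- rewrite (DX_DY R2 HR l x y (smooth_on_le p r R2 l HR sl) Hb),
    (DY_eq R2 _ (fun _ _ => 0) (DX_l R2 HR) x y Hb); apply DY_const.
Qed.

Lemma one_dimensional_iff_invariant : symmetry_algebra_one_dimensional E p <->
  l (fst p) (snd p) <> 0 /\ exists c, near p (fun x y => K x y ^ 4 / l x y ^ 5 = c).
Proof.
rewrite one_dimensional_iff.
assert (sK := nc_K _ _ _ _ _ _ _ nc).
assert (Hr0 : 0 < r) by lra.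
split.
- intros (al & be & Hnz & H).
  assert (Ha : admissible al be) by (apply H; exists 1; split; ring).
  (* If [l] vanished at [p], the given pair would force [l = 0] near [p]; then all pairs would be
     admissible, and these do not lie on one line. *)
  assert (Hl : l (fst p) (snd p) <> 0).
  { intros El; destruct (proj1 (near_box p _) (near_and _ _ _ near_in_box Ha)) as (R3 & HR3 & H3).
    set (R2 := Rmin R3 r); assert (HR2 : 0 < R2) by (apply Rmin_glb_lt; auto).
    assert (HR : R2 <= r) by apply Rmin_r.
    assert (H2 : forall x y, in_box p R2 x y -> (al * Y x y + be) * K x y + 4 * al * l x y = 0)
      by (intros x y Hb; apply H3, (in_box_le p R2); auto; apply Rmin_l).
    assert (sl2 := smooth_on_le p r R2 l HR sl).
    assert (Hl0 : forall x y, in_box p R2 x y -> l x y = 0).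
    { intros x y Hb; destruct (Req_dec al 0) as [Eal|Hal].
      - rewrite <- El; apply (constant_of_DXY R2 HR l HR2 sl2); [|exact Hb].
        intros x' y' Hb'; split; [apply (DX_l R2 HR); auto|rewrite (DY_l R2 HR) by auto].
        specialize (H2 x' y' Hb'); rewrite Eal in H2.
        apply (Rmult_eq_reg_l be); [lra|destruct Hnz; [contradiction|assumption]].
      - pose proof (admissible_integral al be R2 HR2 HR H2 x y Hb) as Hi; rewrite El, Rmult_0_r in Hi.
        apply Rmult_integral in Hi; destruct Hi as [Hi|Hi]; [|exact Hi].
        (* Where [al Y + be] vanishes the integral gives no information on [l], but there the
           admissibility condition itself reduces to [4 al l = 0]. *)
        assert (Hw : al * Y x y + be = 0).
        { destruct (Req_dec (al * Y x y + be) 0) as [Hw|Hw]; [exact Hw|].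
          exfalso; apply (pow_nonzero _ 4 Hw Hi). }
        specialize (H2 x y Hb); rewrite Hw in H2; apply (Rmult_eq_reg_l al); [lra|exact Hal]. }
    assert (HK0 : forall x y, in_box p R2 x y -> K x y = 0).
    { intros x y Hb; rewrite <- (DY_l R2 HR x y Hb), (DY_eq R2 _ (fun _ _ => 0) Hl0 x y Hb).
      apply DY_const. }
    assert (Hall : forall a b, admissible a b).
    { intros a b; apply near_box; exists R2; split; [exact HR2|].
      intros x y Hb; rewrite (HK0 x y Hb), (Hl0 x y Hb); ring. }
    destruct (proj1 (H 1 0) (Hall 1 0)) as (c1 & E1 & E2);
    destruct (proj1 (H 0 1) (Hall 0 1)) as (c2 & E3 & E4).
    assert (c1 <> 0) by (intros ->; lra); assert (c2 <> 0) by (intros ->; lra).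
    symmetry in E2, E3; apply Rmult_integral in E2; apply Rmult_integral in E3.
    abs_lra. }
  split; [exact Hl|].
  assert (Hln := near_neq0 p r l Hr0 sl Hl).
  destruct (proj1 (near_box p _) (near_and _ _ _ Ha Hln)) as (R3 & HR3 & H3).
  set (R2 := Rmin R3 r); assert (HR2 : 0 < R2) by (apply Rmin_glb_lt; auto).
  assert (HR : R2 <= r) by apply Rmin_r.
  assert (H2 : forall x y, in_box p R2 x y -> (al * Y x y + be) * K x y + 4 * al * l x y = 0 /\ l x y <> 0)
      by (intros x y Hb; apply H3, (in_box_le p R2); auto; apply Rmin_l).
  destruct (Req_dec al 0) as [Eal|Hal].
  + exists 0; apply near_box; exists R2; split; [exact HR2|]; intros x y Hb.
    destruct (H2 x y Hb) as (E0 & Hlx); rewrite Eal in E0.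
    assert (EK : K x y = 0)
      by (apply (Rmult_eq_reg_l be); [lra|destruct Hnz; [contradiction|assumption]]).
    rewrite EK; field; exact Hlx.
  (* Admissibility gives [K = - 4 al l / (al Y + be)], hence [K^4 / l^5] is [256 al^4] divided by
     [(al Y + be)^4 l], which is the constant [kappa]. *)
  + set (kappa := (al * Y (fst p) (snd p) + be) ^ 4 * l (fst p) (snd p)).
    exists (256 * al ^ 4 / kappa); apply near_box; exists R2; split; [exact HR2|]; intros x y Hb.
    destruct (H2 x y Hb) as (E0 & Hlx).
    unfold kappa; rewrite <- (admissible_integral al be R2 HR2 HR (fun x y Hb => proj1 (H2 x y Hb)) x y Hb).
    set (w := al * Y x y + be) in *.
    assert (Hw : w <> 0).
    { intros Ew; rewrite Ew in E0; apply Hlx, (Rmult_eq_reg_l al); [lra|exact Hal]. }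
    assert (EK : K x y = - 4 * al * l x y / w).
    { apply (Rmult_eq_reg_l w); [|exact Hw]; replace (w * (- 4 * al * l x y / w)) with (- 4 * al * l x y)
        by (field; exact Hw); lra. }
    rewrite EK; field; split; auto.
- intros (Hl & c & Hc).
  assert (Hln := near_neq0 p r l Hr0 sl Hl).
  assert (Hp : forall R2, 0 < R2 -> in_box p R2 (fst p) (snd p)) by (intros; apply in_box_center; auto).
  destruct (Req_dec (K (fst p) (snd p)) 0) as [HK|HK].
  + destruct (proj1 (near_box p _) (near_and _ _ _ Hc Hln)) as (R2 & HR2 & H2).
    (* A zero of [K] at [p] makes the invariant 0, so [K = 0] nearby and [l] is constant: only the
       translations of [Y] remain. *)
    assert (Ec : c = 0).
    { destruct (H2 _ _ (Hp R2 HR2)) as (E0 & _); rewrite <- E0, HK; field; exact Hl. }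
    assert (HK0 : forall x y, in_box p R2 x y -> K x y = 0).
    { intros x y Hb; destruct (H2 x y Hb) as (E0 & Hlx).
      destruct (Req_dec (K x y) 0) as [Hz|Hz]; [exact Hz|exfalso].
      apply (pow_nonzero _ 4 Hz); rewrite Ec in E0.
      apply (Rmult_eq_reg_r (/ l x y ^ 5)); [rewrite Rmult_0_l; exact E0|].
      apply Rinv_neq_0_compat, pow_nonzero, Hlx. }
    exists 0, 1; split; [right; lra|]; intros al be; split.
    * intros Ha; destruct (proj1 (near_box p _) Ha) as (R3 & HR3 & H3).
      specialize (H3 _ _ (Hp R3 HR3)); rewrite HK in H3.
      exists be; split; [|ring]; rewrite Rmult_0_r.
      apply (Rmult_eq_reg_r (l (fst p) (snd p))); [lra|exact Hl].
    * intros (c' & -> & ->); apply near_box; exists R2; split; [exact HR2|].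
      intros x y Hb; rewrite (HK0 x y Hb); ring.
  + assert (HKn := near_neq0 p r K Hr0 sK HK).
    destruct (proj1 (near_box p _) (near_and _ _ _ Hc (near_and _ _ _ Hln HKn))) as (R3 & HR3 & H3).
    set (R2 := Rmin R3 r); assert (HR2 : 0 < R2) by (apply Rmin_glb_lt; auto).
    assert (HR : R2 <= r) by apply Rmin_r.
    assert (H2 : forall x y, in_box p R2 x y -> K x y ^ 4 / l x y ^ 5 = c /\ l x y <> 0 /\ K x y <> 0)
      by (intros x y Hb; apply H3, (in_box_le p R2); auto; apply Rmin_l).
    assert (sX2 := smooth_on_le p r R2 X HR sX); assert (sY2 := smooth_on_le p r R2 Y HR sY).
    assert (sl2 := smooth_on_le p r R2 l HR sl); assert (sK2 := smooth_on_le p r R2 K HR sK).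
    assert (HKl : forall x y, in_box p R2 x y -> K x y ^ 4 = c * l x y ^ 5).
    { intros x y Hb; destruct (H2 x y Hb) as (<- & Hlx & _); field; exact Hlx. }
    (* Derivative of [K^4 = c l^5] along [Y], where [DY l = K], with [c] eliminated by the same
       equation. *)
    assert (HDK : forall x y, in_box p R2 x y -> 4 * l x y * DY K x y = 5 * K x y ^ 2).
    { intros x y Hb; destruct (H2 x y Hb) as (_ & Hlx & HKx).
      pose proof (HJ _ _ (in_box_le p R2 r x y HR Hb)) as HJb.
      pose proof (DY_eq R2 _ _ HKl x y Hb) as Hd.
      assert (F1 : DY (fun x y => K x y ^ 4) x y = 4 * K x y ^ 3 * DY K x y).
      { assert (G1 : dx (fun x y => K x y ^ 4) x y = 4 * K x y ^ 3 * dx K x y) by (expand_partials; ring).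
        assert (G2 : dy (fun x y => K x y ^ 4) x y = 4 * K x y ^ 3 * dy K x y) by (expand_partials; ring).
        unfold DY; rewrite G1, G2; field; exact HJb. }
      assert (F2 : DY (fun x y => c * l x y ^ 5) x y = 5 * c * l x y ^ 4 * DY l x y).
      { assert (G1 : dx (fun x y => c * l x y ^ 5) x y = 5 * c * l x y ^ 4 * dx l x y) by (expand_partials; ring).
        assert (G2 : dy (fun x y => c * l x y ^ 5) x y = 5 * c * l x y ^ 4 * dy l x y) by (expand_partials; ring).
        unfold DY; rewrite G1, G2; field; exact HJb. }
      rewrite F1, F2, (DY_l R2 HR x y Hb) in Hd.
      apply (Rmult_eq_reg_l (K x y ^ 3)); [|apply pow_nonzero, HKx].
      transitivity (l x y * (4 * K x y ^ 3 * DY K x y)); [ring|]; rewrite Hd.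
      transitivity (5 * K x y * (c * l x y ^ 5)); [ring|rewrite <- HKl by exact Hb; ring]. }
    (* [be0] solves [(Y + be0) K + 4 l = 0] at [p]. The solution persists on the box because, by
       [HDK], the derivative of [Y + 4 l / K] along [Y] is [1 + 4 - 5 = 0]. *)
    set (be0 := - (Y (fst p) (snd p) + 4 * (l (fst p) (snd p) * / K (fst p) (snd p)))).
    assert (Hconst : forall x y, in_box p R2 x y -> Y x y + 4 * (l x y * / K x y) = - be0).
    { assert (HKr : forall x y, in_box p R2 x y -> K x y <> 0) by (intros x y Hb; apply (H2 x y Hb)).
      intros x y Hb; unfold be0; rewrite Ropp_involutive.
      apply (constant_of_DXY R2 HR (fun x y => Y x y + 4 * (l x y * / K x y)) HR2); [smooth; exact HKr| |exact Hb].
      clear x y Hb; intros x y Hb; pose proof (HKr x y Hb) as HKx.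
      assert (G1 : dx (fun x y => Y x y + 4 * (l x y * / K x y)) x y =
        dx Y x y + 4 * (dx l x y * / K x y - l x y * dx K x y / K x y ^ 2))
        by (expand_partials; field; exact HKx).
      assert (G2 : dy (fun x y => Y x y + 4 * (l x y * / K x y)) x y =
        dy Y x y + 4 * (dy l x y * / K x y - l x y * dy K x y / K x y ^ 2))
        by (expand_partials; field; exact HKx).
      pose proof (HJ _ _ (in_box_le p R2 r x y HR Hb)) as HJb.
      split.
      - transitivity (DX Y x y + 4 * (DX l x y * / K x y - l x y * DX K x y / K x y ^ 2)).
        + unfold DX; rewrite G1, G2; field; split; auto.
        + rewrite (DX_Y R2 HR), (DX_l R2 HR), (DX_K R2) by auto; field; exact HKx.
      - transitivity (DY Y x y + 4 * (DY l x y * / K x y - l x y * DY K x y / K x y ^ 2)).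
        + unfold DY; rewrite G1, G2; field; split; auto.
        + rewrite (DY_Y R2 HR), (DY_l R2 HR) by auto.
          transitivity (5 - (4 * l x y * DY K x y) / K x y ^ 2); [field; exact HKx|].
          rewrite HDK by exact Hb; field; exact HKx. }
    assert (Hadm : forall x y, in_box p R2 x y -> (Y x y + be0) * K x y + 4 * l x y = 0).
    { intros x y Hb; destruct (H2 x y Hb) as (_ & _ & HKx); pose proof (Hconst x y Hb) as Hcx.
      replace be0 with (- (Y x y + 4 * (l x y * / K x y))) by lra; field; exact HKx. }
    exists 1, be0; split; [left; lra|]; intros al be; split.
    * intros Ha; destruct (proj1 (near_box p _) Ha) as (R4 & HR4 & H4).
      specialize (H4 _ _ (Hp R4 HR4)); specialize (Hadm _ _ (Hp R2 HR2)).
      exists al; split; [ring|].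
      apply (Rmult_eq_reg_r (K (fst p) (snd p))); [|exact HK].
      apply (f_equal (Rmult al)) in Hadm; lra.
    * intros (c' & -> & ->); apply near_box; exists R2; split; [exact HR2|].
      intros x y Hb; specialize (Hadm x y Hb).
      transitivity (c' * ((Y x y + be0) * K x y + 4 * l x y)); [ring|rewrite Hadm; ring].
Qed.
End Transfer.

Theorem theorem13p4 (E : equation) (p : R * R)
    (smoothE : smooth_equation E p) (seventhE : seventh_case E p) :
  symmetry_algebra_one_dimensional E p <->
  (qL E p (fst p) (snd p) <> 0 /\
   exists c : R, near p (fun x y => qI1 E p x y = c)).
Proof.
destruct (exists_normal_coordinates E p smoothE seventhE) as (r & X & Y & l & K & e & Hr & nc & He).
assert (Hp : in_box p r (fst p) (snd p)) by (apply in_box_center, Hr).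
destruct (local_inverse p r X Y Hr (nc_X _ _ _ _ _ _ _ nc) (nc_Y _ _ _ _ _ _ _ nc)
  (nc_jac _ _ _ _ _ _ _ nc _ _ Hp)) as (r1 & rho & C & PX & PY & Hr1 & Hr1r & Hrho & HC & Hlip & Hinv).
rewrite (one_dimensional_iff_invariant E p r X Y l K nc r1 rho C PX PY Hr1 Hr1r Hrho HC Hlip Hinv).
assert (HL : qL E p (fst p) (snd p) <> 0 <-> l (fst p) (snd p) <> 0).
{ destruct (He _ _ Hp) as (Hep & -> & _); split; intros H H0; apply H.
  - rewrite H0; ring.
  - apply Rmult_integral in H0; destruct H0 as [H0|H0]; [|exact H0].
    exfalso; apply (pow_nonzero (e (fst p) (snd p)) 4); [lra|exact H0]. }
(* The weights cancel, as the fourth power of [nabla_theta_L] and the fifth power of [qL] both carry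
   [e^20]; the same constant [c] serves both sides. *)
rewrite HL; split; intros (Hl & c & Hc); split; auto; exists c;
  generalize (near_and _ _ _ (near_neq0 p r l Hr (nc_l _ _ _ _ _ _ _ nc) Hl)
    (near_and _ _ _ (proj2 (near_box p (in_box p r)) (ex_intro _ r (conj Hr (fun x y H => H)))) Hc));
  apply near_imp; intros x y (Hlx & Hb & <-);
  destruct (He x y Hb) as (Hep & E1 & E2); unfold qI1; rewrite E1, E2; field; split; auto; lra.
Qed.
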